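(* Let $(L\rightrightarrows L_M;G\rightrightarrows M)$ be a line bundle groupoid, let $\theta\in\Omega^1(G,L)$ be a multiplicative $1$-form, and let $\nabla$ and $\nabla'$ be two connections on $L_M$. Then there is a linear natural isomorphism between the Morita curvatures $\mathsf MK_\theta\to\mathsf MK_\theta^\dagger$ of $\theta$ defined through $\nabla$ and through $\nabla'$.
   Context: A VB groupoid (VBG) $(V\rightrightarrows V_M;G\rightrightarrows M)$ consists of Lie groupoids $V\rightrightarrows V_M$, $G\rightrightarrows M$ and vector bundles $V\to G$, $V_M\to M$ such that all structure maps $s,t,m,i,u$ of $V$ are vector bundle (VB) morphisms covering those of $G$. Products $gg'$ are defined when $s(g)=t(g')$; units are regarded as submanifolds. The core is $C=\ker(s\colon V\to V_M)|_M$. A VBG morphism $(F,f)$ is a VB morphism $F$ covering $f$ with $F,f$ Lie groupoid morphisms. Given VBG morphisms $(F,f),(F',f')\colon(W\rightrightarrows W_N;H\rightrightarrows N)\to(V\rightrightarrows V_M;G\rightrightarrows M)$, a linear natural isomorphism $(F,f)\Rightarrow(F',f')$ is a VB morphism $(T,\tau)\colon(W_N\to N)\to(V\to G)$ such that $T$ is a (smooth) natural isomorphism $F\Rightarrow F'$, i.e. $T(w)$ is an arrow from $F(w)$ to $F'(w)$ and $F'(\omega)T(w)=T(w')F(\omega)$ for each arrow $\omega\colon w\to w'$ of $W$. A line bundle groupoid is a VBG $(L\rightrightarrows L_M;G\rightrightarrows M)$ with $L\to G$, $L_M\to M$ line bundles; its structure maps are isomorphisms on fibers, so line bundle valued forms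 and connections can be pulled back along them. $s_g:=s|_{L_g}$; $G$ acts on $L_M$ by $g.v=t(s_g^{-1}(v))$. $\theta\in\Omega^1(G,L)$ is multiplicative if $\mathrm{pr}_2^*\theta-m^*\theta+\mathrm{pr}_1^*\theta=0$. $A=\ker(ds)|_M$. Morita kernel: $\mathsf MK_\theta$ is the VBG $TG\oplus L\rightrightarrows TM\oplus L_M$ over $G$ with $s(v,\lambda)=(ds(v),s(\lambda))$, $t(v,\lambda)=(dt(v),t(\lambda+\theta(v)))$, $u(v,\lambda)=(du(v),u(\lambda))$, $(v,\lambda)(v',\lambda')=(vv',s_{gg'}^{-1}(s(\lambda')))$ for composable elements over $g,g'$; its core is $A$. Twisted dual: for a VBG $V$ over $G$ with core $C$, $V^\dagger=\operatorname{Hom}(V,L)\rightrightarrows C^\dagger=\operatorname{Hom}(C,L_M)$ is the VBG over $G$ with, for $\psi\in V^\dagger_g$, $\langle s(\psi),c\rangle=-s\langle\psi,0_g\cdot c^{-1}\rangle$, $\langle t(\psi),c'\rangle=t\langle\psi,c'\cdot0_g\rangle$, $\langle\psi\psi',vv'\rangle=s_{gg'}^{-1}(g'^{-1}.s\langle\psi,v\rangle+s\langle\psi',v'\rangle)$, unit $\psi\mapsto\psi\circ\mathrm{pr}_C$ ($\mathrm{pr}_C\colon V|_M\to C$ with kernel $V_M$). So $\mathsf MK_\theta^\dagger=T^\dagger G\oplus\mathbb R_G\rightrightarrows A^\dagger$, $T^\dagger G=\operatorname{Hom}(TG,L)$, $\mathbb R_G=G\times\mathbb R$. The Morita curvature of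 $\theta$ defined through a connection $\nabla$ on $L_M$ is the VBG morphism $\mathsf MR_\theta\colon\mathsf MK_\theta\to\mathsf MK_\theta^\dagger$, $(v,\lambda)\mapsto(\iota_vd^{t^*\nabla}\theta+\lambda\otimes\eta_\nabla,-\eta_\nabla(v))$ covering $\operatorname{id}_G$, where $\eta_\nabla=s^*\nabla-t^*\nabla\in\Omega^1(G)$. *)

(* Defs.v *)
From mathcomp Require Import all_boot all_order all_algebra.
From mathcomp Require Import boolp classical_sets reals topology normedtype derive.
Import Order.TTheory GRing.Theory Num.Theory numFieldNormedType.Exports.

Set Implicit Arguments.
Unset Strict Implicit.
Unset Printing Implicit Defensive.
Local Open Scope classical_set_scope.
Local Open Scope ring_scope.

(* A smooth manifold is encoded by its set of points together with its algebra
   of smooth real functions (Sikorski's differential spaces); the topology is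
   the initial topology of these functions.  Fibred objects are encoded by
   their total spaces.  An operation that is only meaningful on some arguments
   (sums in different fibres, products of non composable arrows) is a total
   function whose values elsewhere are never constrained. *)

Section DifferentialSpaces.
Variable R : realType.

Fixpoint Ck n (k : nat) (f : 'rV[R]_n -> R) : Prop :=
  if k is k'.+1 then
    (forall x, differentiable f x) /\ (forall v, Ck k' (fun x => 'D_v f x))
  else continuous f.

Definition Cinf n (f : 'rV[R]_n -> R) : Prop := forall k, Ck k f.

(* U is a neighbourhood of x for the initial topology of the functions in S *)
Definition nbh (T : Type) (S : set (T -> R)) (x : T) (U : set T) : Prop :=
  exists (k : nat) (h : 'I_k -> T -> R) (e : R),
    [/\ 0 < e, forall i, S (h i) &
        forall y, (forall i, `|h i y - h i x| < e) -> U y].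

(* the differential structure generated by S: the functions which are locally
   smooth functions of finitely many elements of S *)
Definition gen (T : Type) (S : set (T -> R)) : set (T -> R) :=
  [set f | forall x, exists (k : nat) (h : 'I_k -> T -> R) (F : 'rV[R]_k -> R),
    [/\ forall i, S (h i), Cinf F &
        nbh S x [set y | f y = F (\row_i h i y)]]].

Record dspace := DSpace { pt :> Type; sm : set (pt -> R) }.
Arguments sm : clear implicits.

Definition smooth (M N : dspace) (f : M -> N) : Prop :=
  forall h, sm N h -> sm M (h \o f).

Definition dsub (M : dspace) (A : set M) : dspace :=
  @DSpace {x : M | A x} (gen [set k | exists2 h, sm M h & k = h \o sval]).

Definition dprod (M N : dspace) : dspace :=
  @DSpace (M * N) (gen ([set k | exists2 h, sm M h & k = h \o fst] `|`
                        [set k | exists2 h, sm N h & k = h \o snd])).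

Definition euclid (n : nat) : dspace := @DSpace 'rV[R]_n (@Cinf n).

Definition smooth_on (M N : dspace) (A : set M) (f : M -> N) : Prop :=
  @smooth (dsub A) N (fun x => f (sval x)).

Definition dopen (M : dspace) (U : set M) : Prop :=
  forall x, U x -> nbh (sm M) x U.

Definition chart_at (n : nat) (M : dspace) (x : M) : Prop :=
  exists (U : set M) (phi : M -> euclid n) (psi : euclid n -> M),
    [/\ dopen U /\ U x, smooth_on U phi, smooth psi,
        forall y, U y -> psi (phi y) = y &
        forall a, U (psi a) /\ phi (psi a) = a].

Definition manifold (M : dspace) : Prop :=
  [/\ gen (sm M) `<=` sm M,
      forall x y : M, (forall h, sm M h -> h x = h y) -> x = y,
      exists B : nat -> set M, (forall n, dopen (B n)) /\
        (forall U x, dopen U -> U x -> exists n, B n x /\ B n `<=` U) &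
      exists n, forall x : M, chart_at n x].

End DifferentialSpaces.

Arguments sm {R} d.

Section TangentVectors.
Variable R : realType.
Local Notation dspace := (dspace R).

(* A tangent vector is a derivation of germs of smooth functions, in the
   C^oo-ring sense (on a manifold this is the same as linearity and the
   Leibniz rule, by Hadamard's lemma).  It is extended by 0 to non-smooth
   functions, so that equality of tangent vectors is Leibniz equality. *)
Record tvec (M : dspace) := TVec {
  tb : M;
  td : (M -> R) -> R;
  tdP : forall (k : nat) (h : 'I_k -> M -> R) (F : 'rV[R]_k -> R) (f : M -> R),
    (forall i, sm M (h i)) -> Cinf F -> sm M f ->
    nbh (sm M) tb [set y | f y = F (\row_i h i y)] ->
    td f = 'D_(\row_i td (h i)) F (\row_i h i tb);
  td0 : forall f, ~ sm M f -> td f = 0 }.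

Lemma tvec_ext (M : dspace) (v w : tvec M) :
  tb v = tb w -> td v = td w -> v = w.
Proof.
case: v => x d dP d0; case: w => y d' dP' d0' /= exy edd.
by subst; congr TVec; exact: Prop_irrelevance.
Qed.

Lemma Cinf_diff n (F : 'rV[R]_n -> R) x : Cinf F -> differentiable F x.
Proof. by move=> /(_ 1%N) []. Qed.

Definition tzero (M : dspace) (x : M) : tvec M.
Proof.
refine (@TVec M x (fun=> 0) _ _) => // k h F f _ _ _ _.
by rewrite (_ : (\row__ 0) = 0) ?derive0 //; apply/rowP => i; rewrite !mxE.
Defined.

Definition tscal (M : dspace) (a : R) (v : tvec M) : tvec M.
Proof.
refine (@TVec M (tb v) (fun f => a * td v f) _ _).
- move=> k h F f hh FC fs fF; rewrite (tdP hh FC fs fF).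
  have dF := Cinf_diff (\row_i h i (tb v)) FC.
  rewrite !deriveE // (_ : (\row_i (a * _)) = a *: \row_i td v (h i)).
    by rewrite linearZ.
  by apply/rowP => i; rewrite !mxE.
- by move=> f nf; rewrite td0 ?mulr0.
Defined.

Definition tadd_at (M : dspace) (v w : tvec M) (vw : tb v = tb w) : tvec M.
Proof.
refine (@TVec M (tb v) (fun f => td v f + td w f) _ _).
- move=> k h F f hh FC fs fF; rewrite (tdP hh FC fs fF).
  have fF' : nbh (sm M) (tb w) [set y | f y = F (\row_i h i y)].
    by rewrite -vw.
  rewrite (tdP hh FC fs fF') -vw.
  have dF := Cinf_diff (\row_i h i (tb v)) FC.
  rewrite !deriveE // -linearD; congr ('d F _ _).
  by apply/rowP => i; rewrite !mxE.
- by move=> f nf; rewrite !td0 ?addr0.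
Defined.

Definition tadd (M : dspace) (v w : tvec M) : tvec M :=
  if pselect (tb v = tb w) is left vw then tadd_at vw else v.

(* the differential of f *)
Definition tmap_of (M N : dspace) (f : M -> N) (fs : smooth f) (v : tvec M) :
  tvec N.
Proof.
refine (@TVec N (f (tb v))
  (fun h => if pselect (sm N h) is left _ then td v (h \o f) else 0) _ _).
- move=> k h F g hh FC gs gF; case: pselect => // _.
  have -> : (\row_i (if pselect (sm N (h i)) is left _
                     then td v (h i \o f) else 0))
            = \row_i td v (h i \o f).
    by apply/rowP => i; rewrite !mxE; case: pselect.
  apply: (tdP (h := fun i => h i \o f)) => //.
  + by move=> i; apply: fs.
  + exact: fs.
  + have [m [c [e [e0 cs cP]]]] := gF.
    exists m, (fun i => c i \o f), e; split => // [i|y yc]; first exact: fs.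
    exact: cP.
- by move=> h nh; case: pselect.
Defined.

Definition tmap (M N : dspace) (f : M -> N) (v : tvec M) : tvec N :=
  if pselect (smooth f) is left fs then tmap_of fs v else tzero (f (tb v)).

End TangentVectors.

Section VectorBundles.
Variable R : realType.
Local Notation dspace := (dspace R).

(* A family of vector spaces over X, given by its total space. *)
Record vfam (X : dspace) := VFam {
  tot :> dspace;
  proj : tot -> X;
  vzero : X -> tot;
  vadd : tot -> tot -> tot;
  vscal : R -> tot -> tot;
  proj0 : forall x, proj (vzero x) = x;
  projD : forall e f, proj e = proj f -> proj (vadd e f) = proj e;
  projZ : forall a e, proj (vscal a e) = proj e;
  vaddC : forall e f, proj e = proj f -> vadd e f = vadd f e;
  vaddA : forall e f g, proj e = proj f -> proj f = proj g ->
    vadd e (vadd f g) = vadd (vadd e f) g;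
  vadd0 : forall e, vadd (vzero (proj e)) e = e;
  vaddN : forall e, vadd (vscal (-1) e) e = vzero (proj e);
  vscal1 : forall e, vscal 1 e = e;
  vscalA : forall a b e, vscal a (vscal b e) = vscal (a * b) e;
  vscalDl : forall a b e, vscal (a + b) e = vadd (vscal a e) (vscal b e);
  vscalDr : forall a e f, proj e = proj f ->
    vscal a (vadd e f) = vadd (vscal a e) (vscal a f) }.

Definition vopp (X : dspace) (E : vfam X) (e : E) : E := vscal (-1) e.
Definition vsub (X : dspace) (E : vfam X) (e f : E) : E := vadd e (vopp f).

Definition linear_over (X Y : dspace) (E : vfam X) (E' : vfam Y)
    (U : set X) (F : E -> E') : Prop :=
  (forall e f, U (proj e) -> proj e = proj f ->
     F (vadd e f) = vadd (F e) (F f)) /\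
  (forall a e, U (proj e) -> F (vscal a e) = vscal a (F e)).

Definition vb_morphism (X Y : dspace) (E : vfam X) (E' : vfam Y)
    (f : X -> Y) (F : E -> E') : Prop :=
  [/\ smooth f, smooth F, forall e, proj (F e) = f (proj e) &
      linear_over setT F].

Definition local_trivialization (r : nat) (X : dspace) (E : vfam X) (x : X) :=
  exists (U : set X) (phi : E -> euclid R r) (psi : X * 'rV[R]_r -> E),
    [/\ dopen U /\ U x,
        smooth_on [set e | U (proj e)] phi /\
          @smooth_on _ (dprod X (euclid R r)) _ [set p | U p.1] psi,
        forall y a, U y -> proj (psi (y, a)) = y /\ phi (psi (y, a)) = a,
        forall e, U (proj e) -> psi (proj e, phi e) = e &
        (forall e f, U (proj e) -> proj e = proj f ->
           phi (vadd e f) = (phi e : 'rV_r) + phi f) /\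
        (forall a e, U (proj e) -> phi (vscal a e) = a *: (phi e : 'rV_r))].

Definition vector_bundle (r : nat) (X : dspace) (E : vfam X) : Prop :=
  [/\ manifold X, manifold E, smooth (@proj X E) &
      forall x, local_trivialization r E x].

Definition smooth_section (X : dspace) (E : vfam X) (s : X -> E) : Prop :=
  smooth s /\ forall x, proj (s x) = x.

Definition fibre_linear (X : dspace) (E : vfam X) (l : E -> R) : Prop :=
  (forall e f, proj e = proj f -> l (vadd e f) = l e + l f) /\
  (forall a e, l (vscal a e) = a * l e).

Section TangentAdd.
Variable M : dspace.
Implicit Types v w : tvec M.

Lemma taddE v w (vw : tb v = tb w) : tadd v w = tadd_at vw.
Proof.
rewrite /tadd; case: pselect => // vw'; congr tadd_at.
exact: Prop_irrelevance.
Qed.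

Lemma tbD v w : tb v = tb w -> tb (tadd v w) = tb v.
Proof. by move=> vw; rewrite (taddE vw). Qed.

Lemma tdD v w : tb v = tb w ->
  td (tadd v w) = (fun f => td v f + td w f).
Proof. by move=> vw; rewrite (taddE vw). Qed.

End TangentAdd.

(* The tangent bundle.  Its smooth functions are generated by h and dh, for h
   smooth on M. *)
Definition tangent (M : dspace) : vfam M.
Proof.
refine (@VFam M
  (@DSpace R (tvec M)
    (gen ([set k | exists2 h, sm M h & k = h \o @tb R M] `|`
          [set k | exists2 h, sm M h & k = (fun v => td v h)])))
  (@tb R M) (@tzero R M) (@tadd R M) (@tscal R M) _ _ _ _ _ _ _ _ _ _ _) => //=.
- exact: tbD.
- move=> e f ef; apply: tvec_ext; first by rewrite !tbD.
  by rewrite !tdD//; apply/funext => h; rewrite addrC.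
- move=> e f g ef fg; apply: tvec_ext.
    by rewrite !tbD// ?tbD// ef.
  rewrite !tdD// ?tbD// ?ef//.
  by apply/funext => h; rewrite addrA.
- move=> e; apply: tvec_ext; first by rewrite tbD.
  by rewrite tdD//; apply/funext => h /=; rewrite add0r.
- move=> e; apply: tvec_ext; first by rewrite tbD.
  by rewrite tdD//; apply/funext => h /=; rewrite mulN1r addNr.
- by move=> e; apply: tvec_ext => //; apply/funext => h /=; rewrite mul1r.
- by move=> a b e; apply: tvec_ext => //; apply/funext => h /=; rewrite mulrA.
- move=> a b e; apply: tvec_ext; first by rewrite tbD.
  by rewrite tdD//; apply/funext => h /=; rewrite mulrDl.
- move=> a e f ef; apply: tvec_ext; first by rewrite /= !tbD.
  by rewrite /= !tdD//; apply/funext => h /=; rewrite mulrDr.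
Defined.

Definition wpairs (X : dspace) (E F : vfam X) : dspace :=
  dsub [set p : dprod E F | proj p.1 = proj p.2].

(* the pair (e, f) of the Whitney sum, meant for proj e = proj f *)
Definition wpair (X : dspace) (E F : vfam X) (e : E) (f : F) : wpairs E F :=
  match pselect (proj e = proj f) with
  | left ef => exist _ (e, f) ef
  | right _ => exist _ (e, vzero F (proj e)) (esym (proj0 F (proj e)))
  end.

Definition wfst (X : dspace) (E F : vfam X) (p : wpairs E F) : E := (sval p).1.
Definition wsnd (X : dspace) (E F : vfam X) (p : wpairs E F) : F := (sval p).2.

Section Wpairs.
Variables (X : dspace) (E F : vfam X).

Lemma wpairE (e : E) (f : F) : proj e = proj f -> sval (wpair e f) = (e, f).
Proof. by rewrite /wpair => ef; case: pselect. Qed.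

Lemma wpairs_ext (p q : wpairs E F) : sval p = sval q -> p = q.
Proof.
case: p q => [p pP] [q qP] /= pq; subst q; congr exist.
exact: Prop_irrelevance.
Qed.

Lemma wpairsP (p : wpairs E F) : proj (sval p).1 = proj (sval p).2.
Proof. by case: p. Qed.

End Wpairs.

Definition whitney (X : dspace) (E F : vfam X) : vfam X.
Proof.
refine (@VFam X (wpairs E F) (fun p => proj (wfst p))
  (fun x => wpair (vzero E x) (vzero F x))
  (fun p q => wpair (vadd (wfst p) (wfst q)) (vadd (wsnd p) (wsnd q)))
  (fun a p => wpair (vscal a (wfst p)) (vscal a (wsnd p)))
  _ _ _ _ _ _ _ _ _ _ _); rewrite /wfst /wsnd.
- by move=> x; rewrite wpairE /= !proj0.
- by move=> e f ef; rewrite wpairE /= !projD// -!wpairsP.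
- by move=> a e; rewrite wpairE /= ?projZ -?wpairsP.
- by move=> e f ef; congr wpair; rewrite vaddC -?wpairsP.
- move=> e f g ef fg; apply: wpairs_ext.
  by rewrite !wpairE /= ?vaddA// ?projD// -?wpairsP ?ef// ?projD// ?fg.
- move=> e; apply: wpairs_ext.
  have e2 : vadd (vzero F (proj (sval e).1)) (sval e).2 = (sval e).2.
    by rewrite (wpairsP e) vadd0.
  by rewrite !wpairE /= ?proj0// vadd0 e2 -?surjective_pairing -?wpairsP.
- move=> e; apply: wpairs_ext.
  by rewrite !wpairE /= ?projZ ?vaddN ?proj0 -?wpairsP.
- by move=> e; apply: wpairs_ext; rewrite wpairE !vscal1 -?surjective_pairing -?wpairsP.
- by move=> a b e; apply: wpairs_ext; rewrite !wpairE /= ?vscalA ?projZ -?wpairsP.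
- by move=> a b e; apply: wpairs_ext; rewrite !wpairE /= -?vscalDl ?projZ -?wpairsP.
- by move=> a e f ef; apply: wpairs_ext; rewrite !wpairE /= ?vscalDr ?projD ?projZ -?wpairsP.
Defined.

(* A point of Hom(S, B): a base point x and a linear map S x -> B_x, where
   S x is a linear subspace of a fibre of E.  The map is extended by 0 outside
   S x, so that equality is Leibniz equality. *)
Record hom (X Y : dspace) (E : vfam Y) (S : X -> set E) (B : vfam X) := Hom {
  hb : X;
  hf :> E -> B;
  hproj : forall v, S hb v -> proj (hf v) = hb;
  haddE : forall v w, S hb v -> S hb w -> hf (vadd v w) = vadd (hf v) (hf w);
  hscalE : forall a v, S hb v -> hf (vscal a v) = vscal a (hf v);
  hjunk : forall v, ~ S hb v -> hf v = vzero B hb }.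

Section Hom.
Variables (X Y : dspace) (E : vfam Y) (S : X -> set E) (B : vfam X).

Lemma hom_ext (p q : hom S B) : hb p = hb q -> hf p = hf q -> p = q.
Proof.
case: p => x f ? ? ? ?; case: q => y g ? ? ? ? /= xy fg.
by subst; congr Hom; exact: Prop_irrelevance.
Qed.

Lemma hom_proj (p : hom S B) v : proj (p v) = hb p.
Proof.
have [Sv|nSv] := pselect (S (hb p) v); first exact: hproj.
by rewrite hjunk// proj0.
Qed.

Lemma vadd00 x : vadd (vzero B x) (vzero B x) = vzero B x.
Proof. by have := vadd0 (vzero B x); rewrite proj0. Qed.

Lemma vscal0 a x : vscal a (vzero B x) = vzero B x.
Proof.
set y := vscal a _.
have py : proj y = x by rewrite projZ proj0.
have yy : vadd y y = y by rewrite -vscalDr// vadd00.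
by rewrite -[in RHS]py -(vaddN y) -{3}yy vaddA ?projZ// vaddN vadd0.
Qed.

Lemma vaddACA (a b c d : B) : proj a = proj b -> proj b = proj c ->
  proj c = proj d -> vadd (vadd a b) (vadd c d) = vadd (vadd a c) (vadd b d).
Proof.
move=> ab bc cd.
have bd : proj b = proj d by rewrite bc.
have ac : proj a = proj c by rewrite ab.
rewrite -(@vaddA _ _ a b) ?projD// (@vaddA _ _ b c d)//.
by rewrite (@vaddC _ _ b c)// -(@vaddA _ _ c b d)// vaddA ?projD.
Qed.

Definition hzero (x : X) : hom S B.
Proof.
by refine (@Hom _ _ E S B x (fun=> vzero B x) _ _ _ _) => // *;
  rewrite ?proj0 ?vadd00 ?vscal0.
Defined.

Definition hscal (a : R) (p : hom S B) : hom S B.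
Proof.
refine (@Hom _ _ E S B (hb p) (fun v => vscal a (p v)) _ _ _ _).
- by move=> v _; rewrite projZ hom_proj.
- by move=> v w Sv Sw; rewrite haddE// vscalDr// !hom_proj.
- by move=> b v Sv; rewrite hscalE// !vscalA mulrC.
- by move=> v nSv; rewrite hjunk// vscal0.
Defined.

Definition hadd_at (p q : hom S B) (pq : hb p = hb q) : hom S B.
Proof.
refine (@Hom _ _ E S B (hb p) (fun v => vadd (p v) (q v)) _ _ _ _).
- by move=> v _; rewrite projD ?hom_proj.
- move=> v w Sv Sw; rewrite !haddE -?pq// vaddACA//; by rewrite !hom_proj.
- by move=> a v Sv; rewrite !hscalE -?pq// vscalDr// !hom_proj.
- by move=> v nSv; rewrite !hjunk -?pq// vadd00.
Defined.

Definition hadd (p q : hom S B) : hom S B :=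
  if pselect (hb p = hb q) is left pq then hadd_at pq else p.

Lemma haddAt p q (pq : hb p = hb q) : hadd p q = hadd_at pq.
Proof.
rewrite /hadd; case: pselect => // pq'; congr hadd_at.
exact: Prop_irrelevance.
Qed.

Lemma hbD p q : hb p = hb q -> hb (hadd p q) = hb p.
Proof. by move=> pq; rewrite (haddAt pq). Qed.

Lemma hfD p q : hb p = hb q -> hf (hadd p q) = (fun v => vadd (p v) (q v)).
Proof. by move=> pq; rewrite (haddAt pq). Qed.

(* Smooth functions on the total space of Hom(S, B) are generated by those of
   X and by the matrix coefficients p |-> l (p (s x)), for s a smooth section
   of S and l a smooth fibrewise linear function on B. *)
Definition hom_bundle : vfam X.
Proof.
refine (@VFam X
  (@DSpace R (hom S B)
    (gen ([set k | exists2 h, sm X h & k = h \o @hb _ _ E S B] `|`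
          [set k | exists (s : X -> E) (l : B -> R),
             [/\ smooth s, (forall x, S x (s x)), sm B l, fibre_linear l &
                 k = (fun p : hom S B => l (p (s (hb p))))]])))
  (@hb _ _ E S B) hzero hadd hscal _ _ _ _ _ _ _ _ _ _ _) => //=.
- exact: hbD.
- move=> p q pq; apply: hom_ext; first by rewrite !hbD.
  by rewrite !hfD//; apply/funext => v; rewrite vaddC// !hom_proj.
- move=> p q r pq qr; apply: hom_ext; first by rewrite !hbD ?pq ?qr ?hbD.
  rewrite !hfD ?hbD ?pq//; apply/funext => v /=.
  by rewrite vaddA ?hom_proj.
- move=> p; apply: hom_ext; first by rewrite hbD.
  by rewrite hfD//; apply/funext => v /=; rewrite -{1}(hom_proj p v) vadd0.
- move=> p; apply: hom_ext; first by rewrite hbD.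
  by rewrite hfD//; apply/funext => v /=; rewrite vaddN hom_proj.
- by move=> p; apply: hom_ext => //=; apply/funext => v; rewrite vscal1.
- by move=> a b p; apply: hom_ext => //=; apply/funext => v; rewrite vscalA.
- move=> a b p; apply: hom_ext; first by rewrite hbD.
  by rewrite hfD//; apply/funext => v /=; rewrite vscalDl.
- move=> a p q pq; apply: hom_ext; first by rewrite /= !hbD.
  rewrite /= !hfD//; apply/funext => v /=.
  by rewrite vscalDr// !hom_proj.
Defined.

End Hom.

(* nabla v s is the covariant derivative of the smooth section s along the
   tangent vector v *)
Definition is_connection (X : dspace) (E : vfam X)
    (nabla : tangent X -> (X -> E) -> E) : Prop :=
  [/\ forall s, smooth_section s ->
        [/\ forall v, proj (nabla v s) = proj v,
            forall v w, proj v = proj w ->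
              nabla (vadd v w) s = vadd (nabla v s) (nabla w s) &
            forall a v, nabla (vscal a v) s = vscal a (nabla v s)],
      forall v s1 s2, smooth_section s1 -> smooth_section s2 ->
        nabla v (fun x => vadd (s1 x) (s2 x)) = vadd (nabla v s1) (nabla v s2),
      forall v f s, sm X f -> smooth_section s ->
        nabla v (fun x => vscal (f x) (s x)) =
        vadd (vscal (td v f) (s (proj v))) (vscal (f (proj v)) (nabla v s)) &
      forall V s, @smooth_section X (tangent X) V -> smooth_section s ->
        smooth_section (fun x => nabla (V x) s)].

(* D is the pullback of the connection nabla along the VB morphism (F, f),
   where F is an isomorphism on fibres: s is the pullback of the section s0 *)
Definition is_pullback_connection (X Y : dspace) (E : vfam X) (E' : vfam Y)
    (f : X -> Y) (F : E -> E') (nabla : tangent Y -> (Y -> E') -> E')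
    (D : tangent X -> (X -> E) -> E) : Prop :=
  is_connection D /\
  forall s0 s, smooth_section s0 -> smooth_section s ->
    (forall x, F (s x) = s0 (f x)) ->
    forall v, F (D v s) = nabla (tmap f v) s0.

(* the difference of two connections on a line bundle, as a real 1-form *)
Definition is_connection_difference (X : dspace) (E : vfam X)
    (D D' : tangent X -> (X -> E) -> E) (eta : tangent X -> R) : Prop :=
  forall v s, smooth_section s ->
    vsub (D v s) (D' v s) = vscal (eta v) (s (proj v)).

Definition vector_field (X : dspace) (V : X -> tangent X) : Prop :=
  @smooth_section X (tangent X) V.

Definition is_bracket (X : dspace) (V W Z : X -> tangent X) : Prop :=
  forall x h, sm X h ->
    td (Z x) h = td (V x) (fun y => td (W y) h) - td (W x) (fun y => td (V y) h).

(* omega = d^D theta; omega is determined by the Koszul formula *)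
Definition is_ext_derivative (X : dspace) (E : vfam X)
    (D : tangent X -> (X -> E) -> E) (theta : tangent X -> E)
    (omega : tangent X -> tangent X -> E) : Prop :=
  [/\ forall v w, proj v = proj w -> proj (omega v w) = proj v,
      forall v v' w, proj v = proj w -> proj v' = proj w ->
        omega (vadd v v') w = vadd (omega v w) (omega v' w) /\
        omega w (vadd v v') = vadd (omega w v) (omega w v'),
      forall a v w, proj v = proj w ->
        omega (vscal a v) w = vscal a (omega v w) /\
        omega v (vscal a w) = vscal a (omega v w) &
      forall V W Z, vector_field V -> vector_field W -> vector_field Z ->
        is_bracket V W Z ->
        forall x, omega (V x) (W x) =
          vsub (vsub (D (V x) (fun y => theta (W y)))
                     (D (W x) (fun y => theta (V y)))) (theta (Z x))].

End VectorBundles.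

Section Groupoids.
Variable R : realType.
Local Notation dspace := (dspace R).

Record gmaps (X A : Type) := GMaps {
  src : A -> X;
  tgt : A -> X;
  one : X -> A;
  inv : A -> A;
  mul : A -> A -> A }.

Record gpd := Gpd { ob : dspace; ar : dspace; gpd_maps :> gmaps ob ar }.

Definition is_groupoid (X A : Type) (G : gmaps X A) : Prop :=
  [/\ forall x, src G (one G x) = x /\ tgt G (one G x) = x,
      forall g h, src G g = tgt G h ->
        src G (mul G g h) = src G h /\ tgt G (mul G g h) = tgt G g,
      forall g h k, src G g = tgt G h -> src G h = tgt G k ->
        mul G g (mul G h k) = mul G (mul G g h) k,
      forall g, mul G (one G (tgt G g)) g = g /\
                mul G g (one G (src G g)) = g &
      forall g, [/\ src G (inv G g) = tgt G g, tgt G (inv G g) = src G g,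
                    mul G g (inv G g) = one G (tgt G g) &
                    mul G (inv G g) g = one G (src G g)]].

Definition composable (G : gpd) : dspace :=
  dsub [set p : dprod (ar G) (ar G) | src G p.1 = tgt G p.2].

Definition pr1 (G : gpd) (p : composable G) : ar G := (sval p).1.
Definition pr2 (G : gpd) (p : composable G) : ar G := (sval p).2.
Definition mul2 (G : gpd) (p : composable G) : ar G := mul G (pr1 p) (pr2 p).

Definition submersion (M N : dspace) (f : M -> N) : Prop :=
  smooth f /\
  forall x (w : tangent N), proj w = f x ->
    exists2 v : tangent M, proj v = x & tmap f v = w.

Definition lie_groupoid (G : gpd) : Prop :=
  [/\ manifold (ob G) /\ manifold (ar G), is_groupoid G,
      submersion (src G : ar G -> ob G) /\ submersion (tgt G : ar G -> ob G),
      smooth (one G : ob G -> ar G) /\ smooth (inv G : ar G -> ar G) &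
      smooth (@mul2 G)].

(* the data of a VB groupoid over G *)
Record vbg (G : gpd) := VBG {
  obV : vfam (ob G);
  arV : vfam (ar G);
  vmaps : gmaps obV arV }.

Definition tot_gpd (G : gpd) (V : vbg G) : gpd := Gpd (vmaps V).
Coercion tot_gpd : vbg >-> gpd.

Definition is_vbg (G : gpd) (V : vbg G) : Prop :=
  [/\ lie_groupoid G /\ lie_groupoid V,
      (exists r, vector_bundle r (obV V)) /\
        (exists r, vector_bundle r (arV V)),
      vb_morphism (E := arV V) (E' := obV V) (src G) (src V) /\
        vb_morphism (E := arV V) (E' := obV V) (tgt G) (tgt V),
      vb_morphism (E := obV V) (E' := arV V) (one G) (one V) /\
        vb_morphism (E := arV V) (E' := arV V) (inv G) (inv V) &
      [/\ forall v v' : arV V, src V v = tgt V v' ->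
            proj (mul V v v' : arV V) = mul G (proj v) (proj v'),
          forall v w v' w' : arV V, proj v = proj w -> proj v' = proj w' ->
            src V v = tgt V v' -> src V w = tgt V w' ->
            mul V (vadd v w) (vadd v' w') =
            vadd (mul V v v' : arV V) (mul V w w') &
          forall a (v v' : arV V), src V v = tgt V v' ->
            mul V (vscal a v) (vscal a v') = vscal a (mul V v v' : arV V)]].

Definition line_bundle_groupoid (G : gpd) (L : vbg G) : Prop :=
  [/\ is_vbg L, vector_bundle 1 (obV L) & vector_bundle 1 (arV L)].

Record vbg_morphism (G H : gpd) (V : vbg G) (W : vbg H) := VBGMorphism {
  mor_ob : obV V -> obV W;
  mor :> arV V -> arV W;
  base_ob : ob G -> ob H;
  base_ar : ar G -> ar H;
  mor_obP : vb_morphism base_ob mor_ob;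
  morP : vb_morphism base_ar mor;
  mor_src : forall v, src W (mor v) = mor_ob (src V v);
  mor_tgt : forall v, tgt W (mor v) = mor_ob (tgt V v);
  mor_one : forall w, mor (one V w) = one W (mor_ob w);
  mor_mul : forall v v', src V v = tgt V v' ->
    mor (mul V v v') = mul W (mor v) (mor v');
  base_src : forall g, src H (base_ar g) = base_ob (src G g);
  base_tgt : forall g, tgt H (base_ar g) = base_ob (tgt G g);
  base_one : forall x, base_ar (one G x) = one H (base_ob x);
  base_mul : forall g h, src G g = tgt G h ->
    base_ar (mul G g h) = mul H (base_ar g) (base_ar h) }.

(* (T, tau) is a linear natural isomorphism from F to F' *)
Definition linear_natural_iso (G H : gpd) (V : vbg G) (W : vbg H)
    (F F' : vbg_morphism V W) (tau : ob G -> ar H) (T : obV V -> arV W) : Prop :=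
  [/\ vb_morphism tau T,
      forall w, src W (T w) = mor_ob F w /\ tgt W (T w) = mor_ob F' w &
      forall v, mul W (F' v) (T (src V v)) = mul W (T (tgt V v)) (F v)].

(* the element of the fibre of L over g with source p *)
Definition src_inv (G : gpd) (L : vbg G) (g : ar G) (p : obV L) : arV L :=
  match pselect (exists l : arV L, proj l = g /\ src L l = p) with
  | left h => sval (cid h)
  | right _ => vzero (arV L) g
  end.

Definition act (G : gpd) (L : vbg G) (g : ar G) (p : obV L) : obV L :=
  tgt L (src_inv g p).

Definition line_form (G : gpd) (L : vbg G)
    (theta : tangent (ar G) -> arV L) : Prop :=
  vb_morphism (E := tangent (ar G)) (E' := arV L) id theta.

(* pr2^* theta - m^* theta + pr1^* theta = 0.  The three pullbacks take values
   in the line bundle L^(2) of composable pairs of L, which pr1, pr2 and m map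
   to L by isomorphisms on fibres: a1, a2 and a3 are the values at xi of
   pr1^* theta, pr2^* theta and m^* theta. *)
Definition multiplicative (G : gpd) (L : vbg G)
    (theta : tangent (ar G) -> arV L) : Prop :=
  let over (xi : tangent (composable G)) (a : composable L) :=
    proj (pr1 a : arV L) = pr1 (proj xi) /\
    proj (pr2 a : arV L) = pr2 (proj xi) in
  forall (xi : tangent (composable G)) (a1 a2 a3 : composable L),
    over xi a1 -> over xi a2 -> over xi a3 ->
    pr1 a1 = theta (tmap (@pr1 G) xi) ->
    pr2 a2 = theta (tmap (@pr2 G) xi) ->
    mul2 a3 = theta (tmap (@mul2 G) xi) ->
    vadd (vsub (pr1 a2 : arV L) (pr1 a3)) (pr1 a1) =
      vzero (arV L) (pr1 (proj xi)) /\
    vadd (vsub (pr2 a2 : arV L) (pr2 a3)) (pr2 a1) =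
      vzero (arV L) (pr2 (proj xi)).

(* mT is the multiplication dm of the tangent groupoid TG, on composable pairs
   of tangent vectors identified with tangent vectors of composable pairs *)
Definition tangent_multiplication (G : gpd)
    (mT : tangent (ar G) -> tangent (ar G) -> tangent (ar G)) : Prop :=
  forall xi : tangent (composable G),
    mT (tmap (@pr1 G) xi) (tmap (@pr2 G) xi) = tmap (@mul2 G) xi.

Definition morita_kernel (G : gpd) (L : vbg G)
    (mT : tangent (ar G) -> tangent (ar G) -> tangent (ar G))
    (theta : tangent (ar G) -> arV L) : vbg G :=
  let E := whitney (tangent (ar G)) (arV L) in
  let E0 := whitney (tangent (ob G)) (obV L) in
  @VBG G E0 E (@GMaps E0 E
    (fun p => wpair (E := tangent (ob G))
                (tmap (src G) (wfst p)) (src L (wsnd p)))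
    (fun p => wpair (E := tangent (ob G))
                (tmap (tgt G) (wfst p))
                (tgt L (vadd (wsnd p) (theta (wfst p)))))
    (fun w => wpair (E := tangent (ar G))
                (tmap (one G) (wfst w)) (one L (wsnd w)))
    (* the inverse has source (dt v, t (l + theta v)) *)
    (fun p => wpair (E := tangent (ar G))
                (tmap (inv G) (wfst p))
                (src_inv (inv G (proj p))
                         (tgt L (vadd (wsnd p) (theta (wfst p))))))
    (fun p q => wpair (E := tangent (ar G))
                (mT (wfst p) (wfst q))
                (src_inv (mul G (proj p) (proj q)) (src L (wsnd q))))).

Definition core (G : gpd) (V : vbg G) (x : ob G) : set (arV V) :=
  [set c | proj c = one G x /\ src V c = vzero (obV V) x].

Definition fibre (G : gpd) (V : vbg G) (g : ar G) : set (arV V) :=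
  [set v | proj v = g].

Definition dual_ar (G : gpd) (V L : vbg G) : vfam (ar G) :=
  hom_bundle (@fibre G V) (arV L).
Definition dual_ob (G : gpd) (V L : vbg G) : vfam (ob G) :=
  hom_bundle (@core G V) (obV L).

Definition dual_vbg (G : gpd) (V L : vbg G)
    (D : gmaps (dual_ob V L) (dual_ar V L)) : vbg G := VBG D.

(* D gives the structure maps of the L-twisted dual of V *)
Definition twisted_dual (G : gpd) (V L : vbg G)
    (D : gmaps (dual_ob V L) (dual_ar V L)) : Prop :=
  [/\ is_groupoid D,
      forall p : hom (@fibre G V) (arV L),
        hb (src D p) = src G (hb p) /\
        forall c, core (src G (hb p)) c ->
          src D p c =
          vopp (src L (p (mul V (vzero (arV V) (hb p)) (inv V c))) : obV L),
      forall p : hom (@fibre G V) (arV L),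
        hb (tgt D p) = tgt G (hb p) /\
        forall c, core (tgt G (hb p)) c ->
          tgt D p c = tgt L (p (mul V c (vzero (arV V) (hb p)))),
      forall p q : hom (@fibre G V) (arV L), src D p = tgt D q ->
        hb (mul D p q) = mul G (hb p) (hb q) /\
        forall v w : arV V, proj v = hb p -> proj w = hb q ->
          src V v = tgt V w ->
          mul D p q (mul V v w) =
          src_inv (mul G (hb p) (hb q))
            (vadd (act (inv G (hb q)) (src L (p v)) : obV L) (src L (q w))) &
      (* V restricted to the units is the direct sum of the core and obV V *)
      forall p : hom (@core G V) (obV L),
        hb (one D p) = one G (hb p) /\
        forall (c : arV V) (w : obV V), core (hb p) c -> proj w = hb p ->
          one D p (vadd c (one V w : arV V)) = one L (p c)].

(* F is the Morita curvature of theta defined through nabla; an element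
   (phi, r) of Hom(TG, L) + R is identified with (w, m) |-> phi w + r m *)
Definition is_morita_curvature (G : gpd) (L : vbg G)
    (mT : tangent (ar G) -> tangent (ar G) -> tangent (ar G))
    (theta : tangent (ar G) -> arV L)
    (D : gmaps (dual_ob (morita_kernel mT theta) L)
               (dual_ar (morita_kernel mT theta) L))
    (nabla : tangent (ob G) -> (ob G -> obV L) -> obV L)
    (F : vbg_morphism (morita_kernel mT theta) (dual_vbg D)) : Prop :=
  [/\ base_ob F = id, base_ar F = id &
      exists (Ds Dt : tangent (ar G) -> (ar G -> arV L) -> arV L)
             (eta : tangent (ar G) -> R)
             (omega : tangent (ar G) -> tangent (ar G) -> arV L),
        [/\ is_pullback_connection (E := arV L) (src G) (src L) nabla Ds,
            is_pullback_connection (E := arV L) (tgt G) (tgt L) nabla Dt,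
            is_connection_difference Ds Dt eta,
            is_ext_derivative Dt theta omega &
            forall p q : whitney (tangent (ar G)) (arV L), proj p = proj q ->
              (F p : hom (@fibre G (morita_kernel mT theta)) (arV L)) q =
              vadd (vadd (omega (wfst p) (wfst q))
                         (vscal (eta (wfst q)) (wsnd p)))
                   (vscal (- eta (wfst p)) (wsnd q))]].

End Groupoids.

(* Main.v *)
Require Import Defs.
From mathcomp Require Import all_boot all_order all_algebra.
From mathcomp Require Import boolp classical_sets reals topology normedtype derive.
From mathcomp Require Import functions sequences realfun exp.
From mathcomp Require Import ring lra.
Import Order.TTheory GRing.Theory Num.Theory numFieldNormedType.Exports.
(* [Defs] once more, since its names [one], [inv], [multiplicative] are shadowed
   by the libraries above *)
Require Import Defs.

Set Implicit Arguments.
Unset Strict Implicit.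
Unset Printing Implicit Defensive.
Local Open Scope classical_set_scope.
Local Open Scope ring_scope.

(* Let [beta] be the real 1-form [nabla' - nabla] on [M], and let
   [K((v, l), (w, m)) = beta(v) m - beta(w) l], an [L_M]-valued pairing on
   [TM + L_M].  Since [s^*nabla' - s^*nabla = s^*beta], likewise for [t], and
   [d^(t^*nabla') theta - d^(t^*nabla) theta = t^*beta /\ theta], the two Morita
   curvatures satisfy
     [MR'(p)(q) - MR(p)(q) = t^(-1) K(t p, t q) - s^(-1) K(s p, s q)],
   where [s] and [t] are those of the Morita kernel.  Hence
     [T(w) = MR(1_w) + (q |-> 1_(K(w, t q)))]
   is an arrow over a unit from [MR(w)] to [MR'(w)], and it is natural.
   Smoothness of [T] amounts to that of [beta] as a function on [TM].  As
   connections only act on global sections, this and the existence of [beta]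
   rest on bump functions, built from [exp(-1/t)]; the formula for
   [d^(t^*nabla) theta] requires the Lie bracket of vector fields through two
   given tangent vectors, hence the symmetry of second derivatives. *)

(** * Smooth functions on R^n *)

(** The terms in [theta] fit into the formula because the target of the Morita kernel shifts [l] to
    [l + theta(v)]: expanding [t^(-1) K(t p, t q)] produces exactly [beta(dt v) theta(w) - beta(dt
    w) theta(v)] besides the terms in [l] and [m], and these come from
    [eta' - eta = s^*beta - t^*beta]. Thus [T(w)] is the unit [MR(1_w)] at [MR(w)], corrected by
    [K]. The source does not see the correction, because [theta] changes sign under inversion over
    units, so that [t] kills [0 . c^(-1)] for [c] in the core; the target sees all of it. The
    product of the dual is specified only on products of composable elements; naturality is
    therefore tested on [q = q 1_(s q) = 1_(t q) q], where [T] takes the values [K(s p, s q)] and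
    [K(t p, t q)]. That [s] and [t] of [L] are isomorphisms on fibres has to be derived from the VB
    groupoid axioms and rank one. Equations between elements of a fibre are proved by applying a
    linear coordinate, which turns them into identities in [R]. *)

Section SmoothFunctions.
Variable R : realType.

Lemma CkW n k (F : 'rV[R]_n -> R) : Ck k.+1 F -> Ck k F.
Proof.
elim: k F => [|k IH] F [dF dFk].
  by move=> x; apply: differentiable_continuous; exact: dF.
by split => // v; apply: IH; exact: dFk.
Qed.

Lemma Cinf_continuous n (F : 'rV[R]_n -> R) : Cinf F -> continuous F.
Proof. by move=> /(_ 0%N). Qed.

Lemma Cinf_derive n (F : 'rV[R]_n -> R) v : Cinf F -> Cinf (fun x => 'D_v F x).
Proof. by move=> FC k; have [_ DC] := FC k.+1; exact: DC. Qed.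

Lemma eq_Ck n k (F G : 'rV[R]_n -> R) : F =1 G -> Ck k G -> Ck k F.
Proof. by move=> /funext ->. Qed.

Lemma Ck_cst n k (c : R) : Ck k (fun _ : 'rV[R]_n => c).
Proof.
elim: k c => [|k IH] c; first exact: cst_continuous.
split=> [x|v]; first exact: differentiable_cst.
by apply: (eq_Ck (G := fun=> 0)) => // x; rewrite derive_cst.
Qed.

Lemma CkD n k (F G : 'rV[R]_n -> R) :
  Ck k F -> Ck k G -> Ck k (fun x => F x + G x).
Proof.
elim: k F G => [|k IH] F G.
  by move=> cF cG x; apply: continuousD; [exact: cF|exact: cG].
move=> [dF FC] [dG GC]; split=> [x|v]; first exact: differentiableD.
apply: (eq_Ck (G := fun x => 'D_v F x + 'D_v G x)) => [x|].
  by rewrite deriveD//; exact: diff_derivable.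
by apply: IH; [exact: FC|exact: GC].
Qed.

Lemma CkM n k (F G : 'rV[R]_n -> R) :
  Ck k F -> Ck k G -> Ck k (fun x => F x * G x).
Proof.
elim: k F G => [|k IH] F G.
  by move=> cF cG x; apply: continuousM; [exact: cF|exact: cG].
move=> CF CG; have [[dF FC] [dG GC]] := (CF, CG).
split=> [x|v]; first exact: differentiableM.
apply: (eq_Ck (G := fun x => F x * 'D_v G x + G x * 'D_v F x)) => [x|].
  by rewrite deriveM//; exact: diff_derivable.
by apply: CkD; apply: IH; [exact: CkW|exact: GC|exact: CkW|exact: FC].
Qed.

Lemma Ck_sum n k m (F : 'I_m -> 'rV[R]_n -> R) :
  (forall i, Ck k (F i)) -> Ck k (fun x => \sum_i F i x).
Proof.
elim: m F => [|m IH] F CF.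
  apply: (eq_Ck (G := fun=> 0)) => [x|]; last exact: Ck_cst.
  by rewrite big_ord0.
apply: (eq_Ck (G := fun x => F ord0 x + \sum_(i < m) F (lift ord0 i) x)).
  by move=> x; rewrite big_ord_recl.
by apply: CkD => //; apply: IH.
Qed.

Lemma derive_coord n (i : 'I_n) (x v : 'rV[R]_n) :
  'D_v (fun y : 'rV[R]_n => y 0 i) x = v 0 i.
Proof.
have := @derive_mx _ _ _ _ (@id 'rV[R]_n) x v (@derivable_id _ _ x v).
by rewrite derive_id => /(congr1 (fun A : 'rV[R]_n => A 0 i)); rewrite mxE.
Qed.

Lemma Ck_coord n k (i : 'I_n) : Ck k (fun x : 'rV[R]_n => x 0 i).
Proof.
case: k => [|k]; first exact: coord_continuous.
split=> [x|v]; first exact: differentiable_coord.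
apply: (eq_Ck (G := fun=> v 0 i)) => [x|]; last exact: Ck_cst.
by rewrite derive_coord.
Qed.

Lemma row_sum_coord n (u : 'rV[R]_n) :
  u = \sum_i u 0 i *: (delta_mx 0 i : 'rV[R]_n).
Proof. exact: row_sum_delta. Qed.

Lemma differentiable_row n m (G : 'I_m -> 'rV[R]_n -> R) x :
  (forall i, differentiable (G i) x) ->
  differentiable (fun y => \row_i G i y : 'rV[R]_m) x.
Proof.
move=> dG; pose H i (y : 'rV[R]_n) : 'rV[R]_m := G i y *: delta_mx 0 i.
have -> : (fun y => \row_i G i y) = \sum_i H i.
  apply/funext => y; rewrite fct_sumE [LHS]row_sum_coord.
  by apply: eq_bigr => i _; rewrite mxE.
by apply: differentiable_sum => i; apply: differentiableZl.
Qed.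

Lemma derive_row n m (G : 'I_m -> 'rV[R]_n -> R) x v :
  (forall i, differentiable (G i) x) ->
  'D_v (fun y => \row_i G i y : 'rV[R]_m) x = \row_i 'D_v (G i) x.
Proof.
move=> dG; rewrite derive_mx; last exact/diff_derivable/differentiable_row.
apply/rowP => i; rewrite !mxE; congr ('D_v _ x).
by apply/funext => y; rewrite mxE.
Qed.

Lemma derive_compose n m (F : 'rV[R]_m -> R) (G : 'I_m -> 'rV[R]_n -> R) x v :
  (forall i, differentiable (G i) x) -> differentiable F (\row_i G i x) ->
  'D_v (fun y => F (\row_i G i y)) x =
  'D_(\row_i 'D_v (G i) x) F (\row_i G i x).
Proof.
move=> dG dF; have dr := differentiable_row dG.
rewrite (deriveE _ (differentiable_comp dr dF)) diff_comp//=.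
by rewrite -!deriveE// derive_row.
Qed.

Lemma derive_lin n (F : 'rV[R]_n -> R) x : differentiable F x ->
  forall u, 'D_u F x = \sum_i u 0 i * 'D_(delta_mx 0 i) F x.
Proof.
move=> dF u; rewrite {1}(row_sum_coord u) deriveE// linear_sum.
by apply: eq_bigr => i _; rewrite linearZ deriveE.
Qed.

(** By the chain rule the derivative is a sum of products of ['D_v (G i)] with a partial derivative
    of [F] composed with the same [G]; the induction on [k] therefore varies [F]. *)
Lemma Ck_comp n m k (F : 'rV[R]_m -> R) (G : 'I_m -> 'rV[R]_n -> R) :
  Ck k F -> (forall i, Ck k (G i)) -> Ck k (fun x => F (\row_i G i x)).
Proof.
elim: k F G => [|k IH] F G CF CG.
  move=> x; apply: (@continuous_comp _ _ _ (fun x => \row_i G i x) F);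
    last exact: CF.
  apply/(@cvg_ballP _ _ _ (nbhs x)) => e e0.
  have H : \forall y \near x, forall j, ball (G j x) e (G j y).
    apply: (@filter_forall _ _ _ (nbhs x) _) => j.
    by have /(@cvg_ballP _ _ _ (nbhs x))/(_ e e0) := CG j x.
  by apply: (@filterS _ (nbhs x) _ _ _ _ H) => y yG; split=> // i j; rewrite !mxE.
have [dF FC] := CF.
have dG i x : differentiable (G i) x by have [] := CG i.
split=> [x|v].
  exact: (differentiable_comp (differentiable_row (fun i => dG i x)) (dF _)).
apply: (eq_Ck (G := fun x =>
    \sum_i 'D_v (G i) x * 'D_(delta_mx 0 i) F (\row_i G i x))) => [x|].
  rewrite derive_compose// derive_lin//.
  by apply: eq_bigr => i _; rewrite mxE.
apply: Ck_sum => i; apply: CkM.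
  by have [_ DC] := CG i; exact: DC.
by apply: (IH (fun y => 'D_(delta_mx 0 i) F y)) => [|j]; [exact: FC|exact: CkW].
Qed.

(** The derivative [- F^-2 * 'D_v F] involves only [F^-1] itself and ['D_v F], so the induction on
    [k] feeds on its own conclusion. *)
Lemma CkV n k (F : 'rV[R]_n -> R) :
  (forall x, F x != 0) -> Ck k F -> Ck k (fun x => (F x)^-1).
Proof.
move=> F0; elim: k => [|k IH] CF.
  by move=> x; apply: continuousV; [exact: F0|exact: CF].
have [dF FC] := CF.
split=> [x|v]; first exact: differentiableV.
have CV := IH (CkW CF).
apply: (eq_Ck (G := fun x => - 1 * ((F x)^-1 * (F x)^-1) * 'D_v F x)) => [x|].
  rewrite deriveV//; last exact: diff_derivable.
  by rewrite expr2 invfM /GRing.scale /= mulN1r.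
apply: (@CkM _ _ (fun x => - 1 * ((F x)^-1 * (F x)^-1)) _ _ (FC v)).
apply: (@CkM _ _ (fun=> - 1)); first exact: Ck_cst.
exact: CkM.
Qed.

Lemma eq_Cinf n (F G : 'rV[R]_n -> R) : F =1 G -> Cinf G -> Cinf F.
Proof. by move=> /funext ->. Qed.

Lemma Cinf_cst n (c : R) : Cinf (fun _ : 'rV[R]_n => c).
Proof. by move=> k; exact: Ck_cst. Qed.

Lemma Cinf_coord n i : Cinf (fun x : 'rV[R]_n => x 0 i).
Proof. by move=> k; exact: Ck_coord. Qed.

Lemma CinfD n (F G : 'rV[R]_n -> R) :
  Cinf F -> Cinf G -> Cinf (fun x => F x + G x).
Proof. by move=> FC GC k; apply: CkD. Qed.

Lemma CinfM n (F G : 'rV[R]_n -> R) :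
  Cinf F -> Cinf G -> Cinf (fun x => F x * G x).
Proof. by move=> FC GC k; apply: CkM. Qed.

Lemma Cinf_sum n m (F : 'I_m -> 'rV[R]_n -> R) :
  (forall i, Cinf (F i)) -> Cinf (fun x => \sum_i F i x).
Proof. by move=> FC k; apply: Ck_sum => i; exact: FC. Qed.

Lemma Cinf_comp n m (F : 'rV[R]_m -> R) (G : 'I_m -> 'rV[R]_n -> R) :
  Cinf F -> (forall i, Cinf (G i)) -> Cinf (fun x => F (\row_i G i x)).
Proof. by move=> FC GC k; apply: Ck_comp => // i; exact: GC. Qed.

Lemma CinfV n (F : 'rV[R]_n -> R) :
  (forall x, F x != 0) -> Cinf F -> Cinf (fun x => (F x)^-1).
Proof. by move=> F0 FC k; exact: CkV. Qed.

(** * Symmetry of second derivatives *)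

Section Schwarz.
Variable n : nat.
Implicit Types (F : 'rV[R]_n -> R) (u v x : 'rV[R]_n).

Lemma line_MVT F x v (h : R) : 0 < h -> (forall y, differentiable F y) ->
  exists2 c, 0 < c < h & F (h *: v + x) - F x = h * 'D_v F (c *: v + x).
Proof.
move=> h0 dF; pose f (t : R) := F (t *: v + x).
have fD (t : R) : is_derive t 1 f ('D_v F (t *: v + x)).
  have E : (fun h : R => h^-1 *: (f (h *: 1 + t) - f t)) =
     (fun h : R => h^-1 *: (F (h *: v + (t *: v + x)) - F (t *: v + x))).
    by apply/funext => s; rewrite /f addrA -scalerDl -[s *: 1]/(s * 1) mulr1.
  have dv : derivable F (t *: v + x) v by exact: diff_derivable.
  by apply: DeriveDef; rewrite /derivable /derive /= E.
have [|c c0h] := MVT h0 (fun t _ => fD t).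
  apply: continuous_subspaceT => t.
  apply: differentiable_continuous; apply/derivable1_diffP.
  by have [] := fD t.
rewrite subr0 /f scale0r add0r mulrC => ->; exists c => //.
Qed.

(** The mean value theorem is used twice: for [y |-> F (h v + y) - F y] in the direction [u], then
    for ['D_u F] in the direction [v]. *)
Lemma second_difference F u v x (h : R) : 0 < h -> Ck 2 F ->
  exists s t, [/\ 0 < s < h, 0 < t < h &
    F (h *: u + (h *: v + x)) - F (h *: u + x) - F (h *: v + x) + F x =
    h * (h * 'D_v (fun y => 'D_u F y) (t *: v + (s *: u + x)))].
Proof.
move=> h0 [dF FC]; have [dDF _] := FC u.
have dsh y : differentiable (fun y => F (h *: v + y)) y.
  apply: (@differentiable_comp _ _ _ _ (fun y => h *: v + y) F y) => //.
have shD y : 'D_u (fun y => F (h *: v + y)) y = 'D_u F (h *: v + y).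
  rewrite /derive; congr lim; apply: f_equal2 => //.
  by apply/funext => s; rewrite /= addrCA.
have [|s s0h Es] := @line_MVT (fun y => F (h *: v + y) - F y) x u h h0.
  by move=> y; exact: differentiableB.
have [t t0h Et] := @line_MVT _ (s *: u + x) v h h0 dDF.
exists s, t; split=> //; rewrite -Et -shD -deriveB; do ?exact: diff_derivable.
by rewrite -[RHS]Es addrCA; ring.
Qed.

(** The second difference is symmetric in [u] and [v], so the two mixed derivatives agree at two
    points that are as close to [x] as desired; continuity of both concludes. *)
Lemma Schwarz F u v x : Ck 2 F ->
  'D_u (fun y => 'D_v F y) x = 'D_v (fun y => 'D_u F y) x.
Proof.
move=> FC; have [_ DFC] := FC.
pose A y := 'D_u (fun y => 'D_v F y) y; pose B y := 'D_v (fun y => 'D_u F y) y.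
have cA : continuous A by have [_ /(_ u)] := DFC v.
have cB : continuous B by have [_ /(_ v)] := DFC u.
apply/eqP; rewrite -subr_eq0 -normr_le0; apply/ler_addgt0Pr => e e0; rewrite add0r.
have e2 : 0 < e / 2 by lra.
have /(@cvg_ballP _ _ _ (nbhs x))/(_ _ e2) nA := cA x.
have /(@cvg_ballP _ _ _ (nbhs x))/(_ _ e2) nB := cB x.
have [d /= d0 dAB] :=
  (nbhs_ballP x _).1 (@filterI _ (nbhs x) (nbhs_filter x) _ _ nA nB).
(* With [h = d / M], every [t v + s u + x] with [s, t < h] stays within [d] of [x]; the summand 1
   makes [M] positive and the bound strict. *)
pose M := 1 + `|u| + `|v|.
have M0 : 0 < M by rewrite /M; have := normr_ge0 u; have := normr_ge0 v; lra.
pose h := d / M.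
have h0 : 0 < h by exact: divr_gt0.
have close s t : 0 < s < h -> 0 < t < h -> ball x d (t *: v + (s *: u + x)).
  move=> /andP[s0 sh] /andP[t0 th].
  rewrite -ball_normE /= addrA opprD addrCA subrr addr0 normrN.
  apply: (le_lt_trans (ler_normD _ _)); rewrite !normrZ.
  rewrite (gtr0_norm s0) (gtr0_norm t0).
  have -> : d = h + h * `|u| + h * `|v|.
    by rewrite -[LHS](divfK (lt0r_neq0 M0)) -/h /M; ring.
  have := ler_wpM2r (normr_ge0 u) (ltW sh).
  by have := ler_wpM2r (normr_ge0 v) (ltW th); lra.
have [s [t [s0h t0h E1]]] := second_difference u v x h0 FC.
have [s' [t' [s'0h t'0h E2]]] := second_difference v u x h0 FC.
have AB : A (t' *: u + (s' *: v + x)) = B (t *: v + (s *: u + x)).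
  apply: (mulfI (lt0r_neq0 h0)); apply: (mulfI (lt0r_neq0 h0)).
  rewrite -[LHS]E2 -[RHS]E1.
  by rewrite (addrCA (h *: v)); ring.
rewrite -/(A x) -/(B x); clearbody A B.
have [+ _] := dAB _ (close _ _ t'0h s'0h).
rewrite addrCA AB -ball_normE /= => H1.
have [_ +] := dAB _ (close _ _ s0h t0h).
rewrite -ball_normE /= => H2.
apply: (le_trans (ler_distD (B (t *: v + (s *: u + x))) _ _)).
by rewrite (splitr e); apply: lerD; [exact: ltW|rewrite distrC; exact: ltW].
Qed.

End Schwarz.

End SmoothFunctions.

(** * Flat functions and globally smooth substitutes for the reciprocal *)

Section FlatFunctions.
Variable R : realType.

(* [flat m t = t^(-m) exp(-1/t)] for [t > 0], and 0 otherwise: these functions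
   are closed under differentiation up to linear combinations. *)
Definition flat (m : nat) (t : R) : R :=
  if 0 < t then t^-1 ^+ m * expR (- t^-1) else 0.

(** The single term [t^-(m+2) / (m+2)!] of the series of [exp(1/t)] already beats the pole [t^-m]
    with a factor [t^2] to spare; the square makes the difference quotient at 0 tend to 0. *)
Lemma flat_le_sqr m : exists2 C, 0 < C & forall t, `|flat m t| <= C * t ^+ 2.
Proof.
exists (m.+2)`!%:R; first by rewrite ltr0n fact_gt0.
move=> t; rewrite /flat; case: ifPn => t0; last first.
  by rewrite normr0 mulr_ge0// sqr_ge0.
have i0 : 0 < t^-1 by rewrite invr_gt0.
rewrite ger0_norm; last by rewrite mulr_ge0 ?exprn_ge0 ?expR_ge0// ltW.
rewrite expRN ler_pdivrMr ?expR_gt0//.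
have f0 : (0 : R) < (m.+2)`!%:R by rewrite ltr0n fact_gt0.
have := expR_ge1Dxn m.+1 (ltW i0); move: (expR _) => E HE.
have {}HE : t^-1 ^+ m.+2 <= (m.+2)`!%:R * E.
  by rewrite mulrC -ler_pdivrMr//; lra.
rewrite mulrAC -ler_pdivrMr; last by rewrite exprn_gt0.
by rewrite -exprVn -exprD addn2.
Qed.

Lemma flat_is_derive0 m : is_derive (0 : R) 1 (flat m) 0.
Proof.
have [C C0 fC] := flat_le_sqr m.
have H : h^-1 *: (flat m (h *: 1 + 0) - flat m 0) @[h --> (0 : R)^'] --> (0 : R).
  apply/cvgrPdist_le => /= e e0; near=> h.
  have h0 : h != 0 by near: h; exact: nbhs_dnbhs_neq.
  have hC : `|h| < e / C by near: h; apply: dnbhs0_lt; exact: divr_gt0.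
  have n0 : 0 < `|h| by rewrite normr_gt0.
  rewrite addr0 -[h *: 1]/(h * 1) mulr1 [flat m 0]/flat ltxx subr0 sub0r normrN.
  rewrite normrZ normfV ler_pdivrMl//.
  have := fC h; rewrite -real_normK ?num_real// expr2 => /le_trans; apply.
  by rewrite mulrA mulrC ler_pM2l// -ler_pdivlMl// mulrC ltW.
apply: DeriveDef; first exact: (cvgP _ H).
exact: (cvg_lim _ H).
Unshelve. all: by end_near. Qed.

Lemma flat_is_derive m (t : R) :
  is_derive t 1 (flat m) (- m%:R * flat m.+1 t + flat m.+2 t).
Proof.
have [t0|t0|<-] := ltgtP 0 t.
- have tn : t != 0 by exact: lt0r_neq0.
  have dV : is_derive t 1 (@GRing.inv R) (- (t ^- 2) *: 1).
    have di : derivable (@id R) t 1 by exact: derivable_id.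
    apply: DeriveDef; first exact: (@derivableV _ _ id).
    by rewrite (@deriveV _ _ id)// derive_id.
  refine (@near_eq_is_derive _ R R (fun s => s^-1 ^+ m * expR (- s^-1))
    (flat m) t 1 _ _ _).
    near=> s; rewrite /flat ifT//; near: s.
    exact: lt_nbhsr.
  rewrite /flat t0.
  have dE : is_derive t 1 (fun s : R => expR (- s^-1)) (t ^- 2 * expR (- t^-1)).
    have dN : is_derive t 1 (fun s : R => - s^-1) (t ^- 2).
      rewrite (_ : t ^- 2 = - (- (t ^- 2) *: 1)); first exact: is_deriveN.
      by rewrite -[_ *: 1]/(_ * 1) mulr1 opprK.
    rewrite mulrC.
    exact: (@is_derive1_comp _ expR _ _ _ _ (is_derive_expR _) dN).
  have dX : is_derive t 1 (fun s : R => s^-1 ^+ m) (- m%:R * t^-1 ^+ m.+1).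
    case: m => [|m]; first by rewrite oppr0 mul0r; exact: is_derive_cst.
    rewrite (_ : _ * _ = (m.+1%:R * t^-1 ^+ m) *: (- (t ^- 2) *: 1)).
      have -> : (fun s : R => s^-1 ^+ m.+1) = (@GRing.inv R) ^+ m.+1.
        by apply/funext => s; rewrite exprfctE.
      exact: (@is_deriveX _ _ (@GRing.inv R) m.+1 t 1 _ dV).
    by rewrite -[_ *: 1]/(_ * 1) mulr1 /GRing.scale /= -exprVn !exprS; ring.
  rewrite (_ : _ + _ = t^-1 ^+ m *: (t ^- 2 * expR (- t^-1)) +
      expR (- t^-1) *: (- m%:R * t^-1 ^+ m.+1)); first exact: is_deriveM.
  by rewrite /GRing.scale /= -exprVn !exprS; ring.
- rewrite [flat m.+1 t]/flat [flat m.+2 t]/flat ltNge ltW//= mulr0 addr0.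
  refine (@near_eq_is_derive _ R R (cst 0) (flat m) t 1 _ _ _).
    near=> s; rewrite /flat ifF //; apply/negbTE; rewrite -leNgt ltW//.
    by near: s; exact: lt_nbhsl.
- rewrite /flat ltxx mulr0 addr0; exact: flat_is_derive0.
Unshelve. all: by end_near. Qed.

(** Transfers derivatives in one real variable to directional derivatives on row vectors, in terms
    of which [Ck] is defined. *)
Lemma is_derive_coord n i (f : R -> R) (df : R) (x v : 'rV[R]_n) :
  is_derive (x 0 i) 1 f df ->
  differentiable (fun y : 'rV[R]_n => f (y 0 i)) x /\
  'D_v (fun y : 'rV[R]_n => f (y 0 i)) x = v 0 i * df.
Proof.
move=> fd; have [/derivable1_diffP df' fE] := fd.
have dc := differentiable_coord x 0 i.
have dfc := differentiable_comp dc df'.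
split; first exact: dfc.
rewrite (deriveE _ dfc) diff_comp//= -(deriveE _ dc) derive_coord.
rewrite (_ : 'd f (x 0 i) (v 0 i) = v 0 i *: 'd f (x 0 i) 1).
  by rewrite -deriveE// fE.
by rewrite -linearZ -[_ *: 1]/(_ * 1) mulr1.
Qed.

Lemma Cinf_flat n i m : Cinf (fun x : 'rV[R]_n => flat m (x 0 i)).
Proof.
move=> k; elim: k m => [|k IH] m.
  move=> x; apply: differentiable_continuous.
  by have [] := is_derive_coord x (flat_is_derive m (x 0 i)).
split=> [x|v]; first by have [] := is_derive_coord x (flat_is_derive m (x 0 i)).
apply: (eq_Ck (G := fun x : 'rV[R]_n => v 0 i * (- m%:R * flat m.+1 (x 0 i) +
    flat m.+2 (x 0 i)))) => [x|].
  by have [_ ->] := is_derive_coord v (flat_is_derive m (x 0 i)).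
apply: (@CkM _ _ _ (fun=> v 0 i)); first exact: Ck_cst.
apply: CkD => //; apply: (@CkM _ _ _ (fun=> - m%:R)) => //; exact: Ck_cst.
Qed.

Lemma flat0_gt0 t : 0 < t -> 0 < flat 0 t.
Proof. by move=> t0; rewrite /flat t0 mul1r expR_gt0. Qed.

Lemma flat0_ge0 t : 0 <= flat 0 t.
Proof. by rewrite /flat; case: ifP => // _; rewrite mul1r expR_ge0. Qed.

Lemma flat0_le s t : s <= t -> flat 0 s <= flat 0 t.
Proof.
move=> st; rewrite {1}/flat; case: ifPn => [s0|_]; last exact: flat0_ge0.
have t0 := lt_le_trans s0 st.
by rewrite /flat t0 !mul1r ler_expR lerN2 lef_pV2.
Qed.

(* The function [t + (1 + t^2) flat 0 (c - t) / flat 0 c] is smooth, positive,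
   and equal to [t] for [t >= c]. *)
Lemma Cinf_inv_ge (c : R) : 0 < c ->
  exists2 F : 'rV[R]_1 -> R, Cinf F &
    forall x : 'rV[R]_1, c <= x 0 0 -> F x = (x 0 0)^-1.
Proof.
move=> c0; have fc := flat0_gt0 c0.
pose P (x : 'rV[R]_1) : R :=
  x 0 0 + (1 + x 0 0 * x 0 0) * (flat 0 (c + -1 * x 0 0) * (flat 0 c)^-1).
have PC : Cinf P.
  have CX : Cinf (fun x : 'rV[R]_1 => x 0 0) by exact: Cinf_coord.
  apply: CinfD => //; apply: CinfM.
    by apply: (@CinfD _ _ (fun=> 1)); [exact: Cinf_cst|exact: CinfM].
  apply: (@CinfM _ _ _ (fun=> (flat 0 c)^-1)); last exact: Cinf_cst.
  apply: (eq_Cinf (G := fun x =>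
    (fun z : 'rV[R]_1 => flat 0 (z 0 0)) (\row__ (c + -1 * x 0 0)))) => [x|].
    by rewrite mxE.
  apply: (Cinf_comp (Cinf_flat 0 0)) => _.
  apply: (@CinfD _ _ (fun=> c)); first exact: Cinf_cst.
  by apply: (@CinfM _ _ (fun=> -1)) => //; exact: Cinf_cst.
have P0 x : P x != 0.
  apply/lt0r_neq0; rewrite /P; set t := x 0 0.
  have q0 : 0 <= flat 0 (c + -1 * t) / flat 0 c.
    by rewrite divr_ge0 ?flat0_ge0.
  have [t0|t0] := ltP 0 t; first by rewrite ltr_pwDl// mulr_ge0//; nra.
  (* As [t <= 0], one has [c - t >= c], so the quotient is at least 1 and
     [P x >= 1 + t + t^2 > 0]. *)
  have q1 : 1 <= flat 0 (c + -1 * t) / flat 0 c.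
    by rewrite ler_pdivlMr// mul1r flat0_le//; lra.
  move: (_ / _) q1 => q q1.
  have t2 : 0 <= 1 + t * t by nra.
  by have := ler_wpM2l t2 q1; nra.
exists (fun x => (P x)^-1) => [|x cx]; first exact: CinfV.
by rewrite /P [flat 0 (_ + _)]/flat ifF ?mul0r ?mulr0 ?addr0//; apply/negbTE; lra.
Qed.

(** [gen] only composes with functions smooth on all of [R^k], so [1/t] must be replaced near [t0]
    by a globally smooth function. Points within [|t0| / 2] of [t0] keep its sign and have absolute
    value at least [|t0| / 2]; a negative [t0] is reduced to a positive one by [1/t = - 1/(-t)]. *)
Lemma Cinf_inv_near (t0 : R) : t0 != 0 ->
  exists (F : 'rV[R]_1 -> R) (e : R), [/\ Cinf F, 0 < e &
    forall t, `|t - t0| < e -> F (\row__ t) = t^-1].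
Proof.
move=> t00.
have e0 : 0 < `|t0| / 2 by rewrite divr_gt0// normr_gt0.
have [F FC FE] := Cinf_inv_ge e0.
have [tp|tn] := ltP 0 t0.
  exists F, (`|t0| / 2); split=> // t; rewrite (gtr0_norm tp) in FE * => tt.
  by rewrite FE mxE//; move: tt; rewrite ltr_norml; lra.
have {}tn : t0 < 0 by rewrite lt_neqAle t00.
exists (fun x => -1 * F (\row_i (-1 * x 0 0))), (`|t0| / 2); split=> //.
  apply: (@CinfM _ _ (fun=> -1)); first exact: Cinf_cst.
  apply: (Cinf_comp FC) => _.
  by apply: (@CinfM _ _ (fun=> -1)); [exact: Cinf_cst|exact: Cinf_coord].
move=> t; rewrite (ltr0_norm tn) in FE * => tt.
rewrite FE !mxE; first by rewrite !mulN1r invrN opprK.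
by move: tt; rewrite ltr_norml; lra.
Qed.

End FlatFunctions.

(** * Local smoothness in differential spaces *)

Section LocallySmooth.
Variable R : realType.

Section Nbh.
Variables (T : Type) (S : set (T -> R)).
Implicit Types (x : T) (U V : set T).

Lemma nbhW x U V : U `<=` V -> nbh S x U -> nbh S x V.
Proof.
by move=> UV [k [h [e [e0 hS hU]]]]; exists k, h, e; split=> // y /hU/UV.
Qed.

Lemma nbh_singleton x U : nbh S x U -> U x.
Proof. by move=> [k [h [e [e0 hS]]]]; apply=> i; rewrite subrr normr0. Qed.

Lemma nbhT x : nbh S x setT.
Proof. by exists 0%N, (fun=> fun=> 0), 1; split=> // -[]. Qed.

Lemma nbhI x U V : nbh S x U -> nbh S x V -> nbh S x (U `&` V).
Proof.
move=> [k [h [e [e0 hS hU]]]] [k' [h' [e' [e'0 hS' hV]]]].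
exists (k + k')%N, (fun i : 'I_(k + k') =>
    match fintype.split i with inl j => h j | inr j => h' j end),
  (Num.min e e'); split=> [|i|y yx].
- by rewrite lt_min e0.
- by case: fintype.split.
- split; [apply: hU => i; have := yx (lshift k' i)|apply: hV => i;
    have := yx (rshift k i)].
  + by rewrite (unsplitK (inl i)) lt_min => /andP[].
  + by rewrite (unsplitK (inr i)) lt_min => /andP[].
Qed.

Lemma nbh_fin n x (U : 'I_n -> set T) :
  (forall i, nbh S x (U i)) -> nbh S x [set y | forall i, U i y].
Proof.
elim: n U => [|n IH] U nU; first by apply: nbhW (nbhT x) => y _ [].
apply: nbhW (nbhI (nU ord0) (IH _ (fun i => nU (lift ord0 i)))) => y [y0 yl] i.
by have [j ->|->] := unliftP ord0 i.
Qed.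

(** Halving the radius leaves room for the triangle inequality. *)
Lemma nbh_open x U : nbh S x U -> nbh S x [set y | nbh S y U].
Proof.
move=> [k [h [e [e0 hS hU]]]]; exists k, h, (e / 2).
split=> [||y yx]; [by rewrite divr_gt0|by []|].
exists k, h, (e / 2); split=> [||z zy]; [by rewrite divr_gt0|by []|].
apply: hU => i; rewrite (_ : h i z - h i x = (h i z - h i y) + (h i y - h i x)).
  by apply: (le_lt_trans (ler_normD _ _)); have := yx i; have := zy i; lra.
by ring.
Qed.

Lemma nbh_dist x f (e : R) : S f -> 0 < e -> nbh S x [set y | `|f y - f x| < e].
Proof.
by move=> Sf e0; exists 1%N, (fun=> f), e; split=> // y /(_ ord0).
Qed.

(* [gen S f] unfolds to [forall x, lsm S f x] *)
Definition lsm (f : T -> R) x : Prop :=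
  exists (k : nat) (h : 'I_k -> T -> R) (F : 'rV[R]_k -> R),
    [/\ forall i, S (h i), Cinf F & nbh S x [set y | f y = F (\row_i h i y)]].

Lemma lsm_near f g x : nbh S x [set y | f y = g y] -> lsm g x -> lsm f x.
Proof.
move=> fg [k [h [F [hS FC gF]]]]; exists k, h, F; split=> //.
by apply: nbhW (nbhI fg gF) => y /= [-> ->].
Qed.

Lemma eq_lsm f g x : f =1 g -> lsm g x -> lsm f x.
Proof. by move=> /funext ->. Qed.

Lemma lsm_in f x : S f -> lsm f x.
Proof.
move=> Sf; exists 1%N, (fun=> f), (fun z => z 0 0); split=> //.
  exact: Cinf_coord.
by apply: nbhW (nbhT x) => y _ /=; rewrite mxE.
Qed.

Lemma lsm_cst (c : R) x : lsm (fun=> c) x.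
Proof.
exists 0%N, (fun=> fun=> 0), (fun=> c); split; [by case|exact: Cinf_cst|].
by apply: nbhW (nbhT x).
Qed.

Lemma nbh_cvg k (h : 'I_k -> T -> R) x (V : set 'rV[R]_k) :
  (forall i (e : R), 0 < e -> nbh S x [set y | `|h i y - h i x| < e]) ->
  nbhs (\row_i h i x) V -> nbh S x [set y | V (\row_i h i y)].
Proof.
move=> hc /nbhs_ballP[e /= e0 eV].
apply: nbhW (nbh_fin (fun i => hc i e e0)) => y yx; apply: eV.
split=> [|i j]; first exact: e0.
by rewrite !mxE -ball_normE /= distrC; exact: yx.
Qed.

Lemma lsm_dist f x (e : R) : lsm f x -> 0 < e ->
  nbh S x [set y | `|f y - f x| < e].
Proof.
move=> [k [h [F [hS FC fF]]]] e0.
have cF : {for \row_i h i x, continuous F} by exact: Cinf_continuous.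
have /(nbh_cvg (fun i d d0 => nbh_dist x (hS i) d0)) :
    nbhs (\row_i h i x) [set z | `|F z - F (\row_i h i x)| < e].
  have /(@cvgr_distC_lt _ _ _ (nbhs (\row_i h i x)))/(_ e e0) := cF.
  exact.
move=> Fe; apply: nbhW (nbhI fF Fe) => y /= [-> //].
by rewrite (nbh_singleton fF).
Qed.

(** Each [f i] comes with its own number [k i] of generators; all of them are gathered into one
    family indexed by the pairs [J], enumerated as an ordinal, and each smooth function reads off
    its own coordinates. *)
Lemma lsm_comp n (f : 'I_n -> T -> R) (F : 'rV[R]_n -> R) x :
  (forall i, lsm (f i) x) -> Cinf F -> lsm (fun y => F (\row_i f i y)) x.
Proof.
move=> fx FC.
have fxs i : {k & {h : 'I_k -> T -> R & {F : 'rV[R]_k -> R |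
    [/\ forall i, S (h i), Cinf F & nbh S x [set y | f i y = F (\row_i h i y)]]}}}.
  by have [k /cid[h /cid[G ?]]] := cid (fx i); exists k, h, G.
pose k i := projT1 (fxs i); pose h i := projT1 (projT2 (fxs i)).
pose G i := sval (projT2 (projT2 (fxs i))).
have hG i := svalP (projT2 (projT2 (fxs i))).
pose J := {i : 'I_n & 'I_(k i)}.
pose g (q : 'I_#|{: J}|) := h _ (tagged (enum_val q)).
pose H i (z : 'rV[R]_#|{: J}|) :=
  G i (\row_j z 0 (enum_rank (Tagged (fun i => 'I_(k i)) j))).
exists #|{: J}|, g, (fun z => F (\row_i H i z)); split.
- by move=> q; have [hS _ _] := hG (tag (enum_val q)); exact: hS.
- apply: Cinf_comp => // i; have [_ GC _] := hG i.
  by apply: Cinf_comp => // j; exact: Cinf_coord.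
- have : nbh S x [set y | forall i, f i y = G i (\row_j h i j y)].
    by apply: nbh_fin => i; have [_ _ fG] := hG i; exact: fG.
  apply: nbhW => y /= fG; congr F.
  apply/rowP => i; rewrite !mxE fG /H; congr (G i _).
  by apply/rowP => j; rewrite !mxE /g enum_rankK.
Qed.

Lemma lsm_comp1 (f : T -> R) (F : 'rV[R]_1 -> R) x :
  lsm f x -> Cinf F -> lsm (fun y => F (\row__ f y)) x.
Proof. by move=> fx; apply: lsm_comp. Qed.

Lemma lsm_comp2 (f g : T -> R) (F : 'rV[R]_2 -> R) x : lsm f x -> lsm g x ->
  Cinf F -> lsm (fun y => F (\row_i if i == 0 then f y else g y)) x.
Proof.
move=> fx gx FC.
apply: (eq_lsm (g := fun y => F (\row_i (if i == 0 then f else g) y))).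
  by move=> y; congr F; apply/rowP => i; rewrite !mxE; case: ifP.
by apply: lsm_comp => // i; case: ifP.
Qed.

Lemma lsmD f g x : lsm f x -> lsm g x -> lsm (fun y => f y + g y) x.
Proof.
move=> fx gx.
have FC : Cinf (fun z : 'rV[R]_2 => z 0 0 + z 0 1).
  by apply: CinfD; exact: Cinf_coord.
by apply: eq_lsm (lsm_comp2 fx gx FC) => y; rewrite !mxE.
Qed.

Lemma lsmM f g x : lsm f x -> lsm g x -> lsm (fun y => f y * g y) x.
Proof.
move=> fx gx.
have FC : Cinf (fun z : 'rV[R]_2 => z 0 0 * z 0 1).
  by apply: CinfM; exact: Cinf_coord.
by apply: eq_lsm (lsm_comp2 fx gx FC) => y; rewrite !mxE.
Qed.

Lemma lsmN f x : lsm f x -> lsm (fun y => - f y) x.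
Proof.
move=> fx; apply: (@eq_lsm _ (fun y => -1 * f y)) => [y|].
  by rewrite mulN1r.
by apply: lsmM => //; exact: lsm_cst.
Qed.

Lemma lsmB f g x : lsm f x -> lsm g x -> lsm (fun y => f y - g y) x.
Proof. by move=> fx gx; apply: lsmD => //; exact: lsmN. Qed.

Lemma lsm_sum n (f : 'I_n -> T -> R) x :
  (forall i, lsm (f i) x) -> lsm (fun y => \sum_i f i y) x.
Proof.
move=> fx; have FC : Cinf (fun z : 'rV[R]_n => \sum_i z 0 i).
  by apply: Cinf_sum => i; exact: Cinf_coord.
apply: eq_lsm (lsm_comp fx FC) => y.
by apply: eq_bigr => i _; rewrite mxE.
Qed.

Lemma lsmV f x : f x != 0 -> lsm f x -> lsm (fun y => (f y)^-1) x.
Proof.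
move=> f0 fx; have [F [e [FC e0 FE]]] := Cinf_inv_near f0.
apply: lsm_near (lsm_comp1 fx FC).
by apply: nbhW (lsm_dist fx e0) => y /FE.
Qed.

Lemma lsm_neq0 f x : lsm f x -> f x != 0 -> nbh S x [set y | f y != 0].
Proof.
move=> fx f0; have e0 : 0 < `|f x| by rewrite normr_gt0.
apply: nbhW (lsm_dist fx e0) => y /=; apply: contraTneq => ->.
by rewrite sub0r normrN ltxx.
Qed.

End Nbh.

Lemma nbh_pull (T T' : Type) (S : set (T -> R)) (S' : set (T' -> R))
    (f : T -> T') x U : (forall h, S' h -> lsm S (h \o f) x) ->
  nbh S' (f x) U -> nbh S x (f @^-1` U).
Proof.
move=> fS [k [h [e [e0 hS hU]]]].
apply: nbhW (nbh_fin (fun i => lsm_dist (fS _ (hS i)) e0)) => y yx.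
exact: hU.
Qed.

Lemma lsm_pull (T T' : Type) (S : set (T -> R)) (S' : set (T' -> R))
    (f : T -> T') x g : (forall h, S' h -> lsm S (h \o f) x) ->
  lsm S' g (f x) -> lsm S (g \o f) x.
Proof.
move=> fS [k [h [F [hS FC gF]]]].
by apply: lsm_near (nbh_pull fS gF) _; apply: lsm_comp => // i; exact: fS.
Qed.

Lemma lsm_gen (T : Type) (S : set (T -> R)) f x : lsm (gen S) f x -> lsm S f x.
Proof. by apply: (@lsm_pull _ _ S (gen S) id) => h; exact. Qed.

(** Charts and trivializations are total functions that are smooth only near some points, hence a
    pointwise notion. *)
Definition lsmooth (M N : dspace R) (f : M -> N) (x : M) : Prop :=
  forall h, sm N h -> lsm (sm M) (h \o f) x.

(** The first axiom of [manifold], isolated because it is what turns smoothness near every point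
    into smoothness, and because every generated structure satisfies it. *)
Definition dclosed (M : dspace R) : Prop := gen (sm M) `<=` sm M.

Lemma dclosed_gen (T : Type) (S : set (T -> R)) : dclosed (DSpace (gen S)).
Proof. by move=> f fS x; apply: lsm_gen. Qed.

Section LocallySmoothMaps.
Implicit Types M N P : dspace R.

Lemma smooth_lsmooth M N (f : M -> N) x : smooth f -> lsmooth f x.
Proof. by move=> fs h /fs; exact: lsm_in. Qed.

Lemma lsmooth_smooth M N (f : M -> N) :
  dclosed M -> (forall x, lsmooth f x) -> smooth f.
Proof. by move=> Mc fs h hN; apply: Mc => x; exact: fs. Qed.

Lemma lsmooth_comp M N P (f : M -> N) (g : N -> P) x :
  lsmooth f x -> lsmooth g (f x) -> lsmooth (g \o f) x.
Proof. by move=> fx gx h /gx; exact: lsm_pull. Qed.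

Lemma lsmooth_lsm M N (f : M -> N) h x :
  lsmooth f x -> lsm (sm N) h (f x) -> lsm (sm M) (fun y => h (f y)) x.
Proof. exact: lsm_pull. Qed.

Lemma lsmooth_nbh M N (f : M -> N) x U :
  lsmooth f x -> nbh (sm N) (f x) U -> nbh (sm M) x [set y | U (f y)].
Proof. exact: nbh_pull. Qed.

Lemma lsmooth_near M N (f g : M -> N) x :
  nbh (sm M) x [set y | f y = g y] -> lsmooth g x -> lsmooth f x.
Proof.
move=> fg gx h hN; apply: lsm_near (gx h hN).
by apply: nbhW fg => y /= ->.
Qed.

Lemma lsmooth_gen M (T : Type) (S : set (T -> R)) (f : M -> T) x :
  (forall h, S h -> lsm (sm M) (h \o f) x) ->
  @lsmooth M (DSpace (gen S)) f x.
Proof. by move=> fS h hS; apply: lsm_pull fS _; exact: hS. Qed.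

Lemma smooth_id M : @smooth R M M id.
Proof. by []. Qed.

Lemma smooth_comp M N P (f : M -> N) (g : N -> P) :
  smooth f -> smooth g -> smooth (g \o f).
Proof. by move=> fs gs h /gs/fs. Qed.

Lemma dsub_lsmooth M N (A : set N) (f : M -> dsub A) x :
  lsmooth (fun y => sval (f y) : N) x -> lsmooth f x.
Proof. by move=> fx; apply: lsmooth_gen => _ [h hN ->]; exact: fx. Qed.

Lemma sval_smooth M (A : set M) : @smooth R (dsub A) M sval.
Proof. by move=> h hM x; apply: lsm_in; exists h. Qed.

Lemma fst_smooth M N : @smooth R (dprod M N) M fst.
Proof. by move=> h hM x; apply: lsm_in; left; exists h. Qed.

Lemma snd_smooth M N : @smooth R (dprod M N) N snd.
Proof. by move=> h hM x; apply: lsm_in; right; exists h. Qed.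

Lemma dprod_lsmooth M N P (f : M -> dprod N P) x :
  lsmooth (fun y => (f y).1 : N) x -> lsmooth (fun y => (f y).2 : P) x ->
  lsmooth f x.
Proof.
by move=> f1 f2; apply: lsmooth_gen => _ [[h hN ->]|[h hN ->]];
  [exact: f1|exact: f2].
Qed.

(** The structure of [dsub U] is generated by restrictions of functions smooth on all of [M]; these
    functions, chosen for the generators and for the neighbourhood, witness smoothness in [M] near
    [x]. *)
Lemma smooth_on_lsmooth M N (U : set M) (f : M -> N) x :
  smooth_on U f -> nbh (sm M) x U -> lsmooth f x.
Proof.
move=> fU xU h hN; have Ux := nbh_singleton xU.
have [k [g [F [gS FC [m [c [e [e0 cS cE]]]]]]]] := fU h hN (exist _ x Ux).
have /choice[g' gE] : forall i, exists g' : M -> R,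
    sm M g' /\ g i = g' \o sval.
  by move=> i; have [g' ? ?] := gS i; exists g'.
have /choice[c' cE'] : forall i, exists c' : M -> R,
    sm M c' /\ c i = c' \o sval.
  by move=> i; have [c' ? ?] := cS i; exists c'.
exists k, g', F; split=> [i||]; [by have [] := gE i|by []|].
have nc : nbh (sm M) x [set y | forall i, `|c' i y - c' i x| < e].
  by apply: nbh_fin => i; apply: nbh_dist => //; have [] := cE' i.
apply: nbhW (nbhI xU nc) => y /= [Uy yc].
have /= -> := cE (exist _ y Uy); last first.
  by move=> i; have [_ ->] := cE' i; exact: yc.
by congr F; apply/rowP => i; rewrite !mxE; have [_ ->] := gE i.
Qed.

Lemma coord_smooth n (i : 'I_n) : sm (euclid R n) (fun x : 'rV[R]_n => x 0 i).
Proof. exact: Cinf_coord. Qed.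

Lemma euclid_lsmooth M n (f : M -> euclid R n) x :
  (forall i, lsm (sm M) (fun y => (f y : 'rV_n) 0 i) x) -> lsmooth f x.
Proof.
move=> fx h hC; apply: eq_lsm (lsm_comp fx hC) => y /=; congr h.
by apply/rowP => i; rewrite mxE.
Qed.

Lemma lsmooth_coord M n (f : M -> euclid R n) x i :
  lsmooth f x -> lsm (sm M) (fun y => (f y : 'rV_n) 0 i) x.
Proof. by move=> fx; apply: (fx (fun z : 'rV_n => z 0 i)); exact: coord_smooth. Qed.

Lemma nbhs_euclid n (a : 'rV[R]_n) (U : set 'rV[R]_n) :
  nbh (@Cinf R n) a U -> nbhs a U.
Proof.
move=> [k [h [e [e0 hS hU]]]].
have H : \forall y \near a, forall i, `|h i y - h i a| < e.
  apply: (@filter_forall _ _ _ (nbhs a) _) => i.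
  have ch : {for a, continuous (h i)} by exact/Cinf_continuous/hS.
  by have /(@cvgr_distC_lt _ _ _ (nbhs a))/(_ e e0) := ch.
by apply: (@filterS _ (nbhs a) _ _ _ _ H) => y /hU.
Qed.

End LocallySmoothMaps.

(** The function is the product of the [flat 0 ((e/2)^2 - (h_i - h_i x)^2)]. Outside [U] some
    [|h_i y - h_i x|] is at least [e], so the margin [e/2] makes it vanish near [y] and not only at
    [y]; this is what allows extending by zero what is defined on [U]. It is only nonzero at [x], so
    later uses divide by its value there. *)
Lemma bump_function (M : dspace R) (x : M) (U : set M) :
  dclosed M -> nbh (sm M) x U ->
  exists phi : M -> R, [/\ sm M phi, phi x != 0 &
    forall y, ~ U y -> nbh (sm M) y [set z | phi z = 0]].
Proof.
move=> Mc [k [h [e [e0 hS hU]]]].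
have e20 : 0 < e / 2 by rewrite divr_gt0.
pose b i y := flat 0 ((e / 2) ^+ 2 + -1 * ((h i y - h i x) * (h i y - h i x))).
have bS i y : lsm (sm M) (b i) y.
  have hl : lsm (sm M) (fun z => h i z - h i x) y.
    by apply: lsmB; [exact: lsm_in|exact: lsm_cst].
  have al : lsm (sm M) (fun z => (e / 2) ^+ 2 +
      -1 * ((h i z - h i x) * (h i z - h i x))) y.
    by apply: lsmD; [exact: lsm_cst|apply: lsmM; [exact: lsm_cst|exact: lsmM]].
  by apply: eq_lsm (lsm_comp1 al (@Cinf_flat R 1 0 0)) => z; rewrite mxE.
exists (fun y => \prod_i b i y); split.
- apply: Mc => y; rewrite -/(lsm _ _ _).
  elim: (k) (b) bS => [|m IH] c cS.
    apply: (@eq_lsm _ _ _ (fun=> 1)) => [z|]; last exact: lsm_cst.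
    by rewrite big_ord0.
  apply: (@eq_lsm _ _ _ (fun y => c ord0 y * \prod_(i < m) c (lift ord0 i) y)).
    by move=> z; rewrite big_ord_recl.
  by apply: lsmM => //; exact: IH.
- apply/prodf_neq0 => i _; apply/lt0r_neq0; rewrite /b subrr mulr0 mulr0 addr0.
  by apply: flat0_gt0; rewrite exprn_gt0.
- move=> y /(contra_not (@hU y))/existsNP[i /negP]; rewrite -leNgt => hy.
  apply: nbhW (nbh_dist y (hS i) e20) => z /= zy.
  apply/eqP/prodf_eq0; exists i => //; rewrite /b /flat ifF//.
  apply/negbTE; rewrite -leNgt mulN1r subr_le0 -expr2 -[leRHS]real_normK ?num_real//.
  rewrite lerXn2r ?nnegrE ?normr_ge0 ?ltW//.
  have := ler_normD (h i z - h i x) (h i y - h i z); rewrite distrC in zy.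
  by rewrite (_ : h i z - h i x + (h i y - h i z) = h i y - h i x); [lra|ring].
Qed.

End LocallySmooth.

(** * Tangent vectors and vector fields *)

Section Tangent.
Variable R : realType.
Implicit Types M N P X : dspace R.

Lemma manifold_closed M : manifold M -> dclosed M.
Proof. by case. Qed.

Section Derivations.
Variable M : dspace R.
Hypothesis Mc : dclosed M.
Implicit Types (v : tvec M) (f g : M -> R).

Lemma smM f g : sm M f -> sm M g -> sm M (fun x => f x * g x).
Proof. by move=> fs gs; apply: Mc => x; apply: lsmM; exact: lsm_in. Qed.

Lemma sm_sum n (f : 'I_n -> M -> R) :
  (forall i, sm M (f i)) -> sm M (fun x => \sum_i f i x).
Proof. by move=> fs; apply: Mc => x; apply: lsm_sum => i; exact: lsm_in. Qed.

Lemma sm_comp n (h : 'I_n -> M -> R) (F : 'rV[R]_n -> R) :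
  (forall i, sm M (h i)) -> Cinf F -> sm M (fun x => F (\row_i h i x)).
Proof. by move=> hs FC; apply: Mc => x; apply: lsm_comp => // i; exact: lsm_in. Qed.

(** Locality is built into [tdP]: near the base point [f] is the composite of [g] with the
    coordinate function of [R^1]. *)
Lemma td_near v f g : sm M f -> sm M g ->
  nbh (sm M) (tb v) [set y | f y = g y] -> td v f = td v g.
Proof.
move=> fs gs fg.
rewrite (@tdP _ _ v 1 (fun=> g) (fun z => z 0 0) f) => //.
- by rewrite derive_coord mxE.
- exact: Cinf_coord.
- by apply: nbhW fg => y /= ->; rewrite mxE.
Qed.

Lemma td_compE v n (h : 'I_n -> M -> R) (F : 'rV[R]_n -> R) :
  (forall i, sm M (h i)) -> Cinf F ->
  td v (fun x => F (\row_i h i x)) =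
  \sum_i td v (h i) * 'D_(delta_mx 0 i) F (\row_i h i (tb v)).
Proof.
move=> hs FC; rewrite (tdP hs FC (sm_comp hs FC)).
  rewrite derive_lin; last exact: Cinf_diff.
  by apply: eq_bigr => i _; rewrite mxE.
exact: nbhW (nbhT _ _).
Qed.

Lemma td_sum v n (f : 'I_n -> M -> R) : (forall i, sm M (f i)) ->
  td v (fun x => \sum_i f i x) = \sum_i td v (f i).
Proof.
move=> fs; pose F (z : 'rV[R]_n) := \sum_i z 0 i.
have FC : Cinf F by apply: Cinf_sum => i; exact: Cinf_coord.
have FE u a : 'D_u F a = \sum_i u 0 i.
  rewrite (_ : F = \sum_i (fun z : 'rV[R]_n => z 0 i)); last first.
    by apply/funext => z; rewrite fct_sumE.
  rewrite derive_sum => [|i]; first by apply: eq_bigr => i _; exact: derive_coord.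
  by apply: diff_derivable; exact: differentiable_coord.
rewrite (@tdP _ _ v n f F) ?FE//; first by apply: eq_bigr => i _; rewrite mxE.
  exact: sm_sum.
by apply: nbhW (nbhT _ _) => y _ /=; apply: eq_bigr => i _; rewrite mxE.
Qed.

Lemma td_mul v f g : sm M f -> sm M g ->
  td v (fun x => f x * g x) = f (tb v) * td v g + g (tb v) * td v f.
Proof.
move=> fs gs; pose F (z : 'rV[R]_2) := z 0 0 * z 0 1.
pose h (i : 'I_2) := if i == 0 then f else g.
have FC : Cinf F by apply: CinfM; exact: Cinf_coord.
have dc i a u : derivable (fun z : 'rV[R]_2 => z 0 i) a u.
  by apply: diff_derivable; exact: differentiable_coord.
rewrite (@tdP _ _ v 2 h F) //.
- by rewrite /F deriveM// !derive_coord !mxE.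
- by move=> i; rewrite /h; case: ifP.
- exact: smM.
- by apply: nbhW (nbhT _ _) => y _ /=; rewrite /F !mxE.
Qed.

End Derivations.

Section TangentMaps.

Lemma tb_vadd M (v w : tangent M) : tb v = tb w -> tb (vadd v w) = tb v.
Proof. exact: tbD. Qed.

Lemma td_vadd M (v w : tangent M) h : tb v = tb w ->
  td (vadd v w) h = td v h + td w h.
Proof. by move=> vw; rewrite [LHS](congr1 (@^~ h) (tdD vw)). Qed.

Lemma tb_vscal M a (v : tangent M) : tb (vscal a v) = tb v.
Proof. by []. Qed.

Lemma td_vscal M a (v : tangent M) h : td (vscal a v) h = a * td v h.
Proof. by []. Qed.

Lemma tb_tmap M N (f : M -> N) (v : tvec M) : tb (tmap f v) = f (tb v).
Proof. by rewrite /tmap; case: pselect. Qed.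

Lemma td_tmap M N (f : M -> N) (v : tvec M) h :
  smooth f -> sm N h -> td (tmap f v) h = td v (h \o f).
Proof. by move=> fs hs; rewrite /tmap; case: pselect => //= ?; case: pselect. Qed.

Lemma tmap_id M (v : tvec M) : tmap (id : M -> M) v = v.
Proof.
apply: tvec_ext; first by rewrite tb_tmap.
apply/funext => h; have [hs|hs] := pselect (sm M h); last by rewrite !td0.
by rewrite td_tmap//; exact: smooth_id.
Qed.

Lemma tmap_comp M N P (f : M -> N) (g : N -> P) (v : tvec M) :
  smooth f -> smooth g -> tmap g (tmap f v) = tmap (g \o f) v.
Proof.
move=> fs gs; apply: tvec_ext; first by rewrite !tb_tmap.
apply/funext => h; have [hs|hs] := pselect (sm P h); last by rewrite !td0.
by rewrite !td_tmap//; [exact: smooth_comp gs|exact: gs].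
Qed.

Lemma tmapD M N (f : M -> N) (v w : tangent M) : smooth f ->
  proj v = proj w -> tmap f (vadd v w) = vadd (tmap f v : tangent N) (tmap f w).
Proof.
move=> fs vw; have vw' : tb (tmap f v) = tb (tmap f w) by rewrite !tb_tmap; congr f.
apply: tvec_ext; first by rewrite tb_tmap !tb_vadd// tb_tmap.
apply/funext => h; have [hs|hs] := pselect (sm N h); last by rewrite !td0.
by rewrite td_tmap// !td_vadd// !td_tmap.
Qed.

Lemma tmapZ M N (f : M -> N) a (v : tangent M) : smooth f ->
  tmap f (vscal a v) = vscal a (tmap f v : tangent N).
Proof.
move=> fs; apply: tvec_ext; first by rewrite tb_vscal !tb_tmap.
apply/funext => h; have [hs|hs] := pselect (sm N h); last by rewrite !td0.
by rewrite td_tmap// !td_vscal td_tmap.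
Qed.

Lemma tangent_closed M : dclosed (tangent M).
Proof. exact: dclosed_gen. Qed.

Lemma tb_smooth M : @smooth R (tangent M) M (@tb R M).
Proof. by move=> h hs x; apply: lsm_in; left; exists h. Qed.

Lemma td_smooth M h : sm M h -> sm (tangent M) (fun v => td v h).
Proof. by move=> hs x; apply: lsm_in; right; exists h. Qed.

Lemma tangent_lsmooth M N (f : M -> tangent N) x :
  lsmooth (fun y => tb (f y)) x ->
  (forall h, sm N h -> lsm (sm M) (fun y => td (f y) h) x) -> lsmooth f x.
Proof.
by move=> fb fd; apply: lsmooth_gen => _ [[h hs ->]|[h hs ->]];
  [exact: fb|exact: fd].
Qed.

Lemma tmap_smooth M N (f : M -> N) : smooth f ->
  @smooth R (tangent M) (tangent N) (tmap f).
Proof.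
move=> fs; apply: lsmooth_smooth => [|v]; first exact: tangent_closed.
apply: tangent_lsmooth => [h hs|h hs].
  apply: (@eq_lsm _ _ _ _ ((h \o f) \o @tb R M)) => [w|].
    by rewrite /= tb_tmap.
  by apply: lsm_in; apply/tb_smooth/fs.
apply: (@eq_lsm _ _ _ _ (fun w => td w (h \o f))) => [w|]; first by rewrite td_tmap.
by apply: lsm_in; apply/td_smooth/fs.
Qed.

(** The directional derivative as a tangent vector; the test on [Cinf f] implements the convention
    [td0]. *)
Definition dirv n (a u : 'rV[R]_n) : tvec (euclid R n).
Proof.
refine (@TVec R (euclid R n) a
  (fun f => if pselect (Cinf f) is left _ then 'D_u f a else 0) _ _).
- move=> k h F f hh FC fs fF; case: pselect => // _.
  have -> : (\row_i (if pselect (Cinf (h i)) is left _ then 'D_u (h i) a else 0))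
      = \row_i 'D_u (h i) a.
    by apply/rowP => i; rewrite !mxE; case: pselect => // nC; case: (nC (hh i)).
  rewrite -derive_compose; first last.
  + exact: Cinf_diff.
  + by move=> i; exact/Cinf_diff/hh.
  by apply: near_eq_derive; exact: nbhs_euclid fF.
- by move=> f nf; case: pselect.
Defined.

Lemma td_dirv n (a u : 'rV[R]_n) f : Cinf f -> td (dirv a u) f = 'D_u f a.
Proof. by move=> FC /=; case: pselect. Qed.

End TangentMaps.

Lemma sm_td X (V : X -> tangent X) f :
  vector_field V -> sm X f -> sm X (fun y => td (V y) f).
Proof. by move=> [Vs _] fs; exact: (Vs _ (td_smooth fs)). Qed.

(** [V u] is the coordinate field of direction [u] of a chart, multiplied by a bump function [b] so
    as to be global. The [p i] are global functions that agree with the chart coordinates near [x];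
    there the components of [v] are the [td v (p i)]. *)
Lemma local_frame X (x : X) : manifold X ->
  exists (n : nat) (p : 'I_n -> X -> R) (b : X -> R)
    (V : 'rV[R]_n -> X -> tangent X),
  [/\ (forall i, sm X (p i)) /\ sm X b /\ b x != 0,
      forall u, vector_field (V u),
      forall u u' y, V (u + u') y = vadd (V u y) (V u' y),
      forall a u y, V (a *: u) y = vscal a (V u y) &
      nbh (sm X) x [set y | forall v : tangent X, tb v = y ->
        vscal (b y) v = V (\row_i td v (p i)) y]].
Proof.
move=> mX; have Xc := manifold_closed mX.
case: mX => _ _ _ [n /(_ x)[U [phi [psi [[Uo Ux] phis psis psiK phiK]]]]].
have phil y : U y -> lsmooth phi y.
  by move=> Uy; apply: smooth_on_lsmooth phis _; exact: Uo.
have [b [bs bx b0]] := bump_function Xc (Uo x Ux).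
(* The chart coordinates are smooth on [U] only, and [td] is 0 on functions that are not smooth on
   [X], so global functions with the same germs at [x] take their place. *)
have /choice[p pP] : forall i, exists p : X -> R, sm X p /\
    nbh (sm X) x [set y | (phi y : 'rV_n) 0 i = p y].
  move=> i; have [k [h [F [hs FC fF]]]] := lsmooth_coord i (phil x Ux).
  by exists (fun y => F (\row_i h i y)); split; [exact: sm_comp|].
have psiC f : sm X f -> Cinf (f \o psi) by move=> /psis.
pose T u (y : X) : tangent X :=
  if pselect (U y) is left _ then tmap psi (dirv (phi y : 'rV_n) u) else tzero y.
have tbT u y : tb (T u y) = y.
  by rewrite /T; case: pselect => // Uy; rewrite tb_tmap psiK.
have tdT u y f : sm X f -> U y -> td (T u y) f = 'D_u (f \o psi) (phi y).
  move=> fs Uy; rewrite /T; case: pselect => // _.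
  by rewrite td_tmap// td_dirv//; exact: psiC.
have tdT0 u y f : ~ U y -> td (T u y) f = 0.
  by move=> nUy; rewrite /T; case: pselect.
clearbody T.
pose V u y : tangent X := vscal (b y) (T u y).
have tbV u y : tb (V u y) = y by rewrite tb_vscal tbT.
have tdV u y f : td (V u y) f = b y * td (T u y) f by exact: td_vscal.
clearbody V.
exists n, p, b, V; split.
- by split=> // i; have [] := pP i.
- move=> u; split=> [|y]; last exact: tbV.
  apply: lsmooth_smooth => // y; apply: tangent_lsmooth => [h hs|h hs].
    by apply: (@eq_lsm _ _ _ _ h) => [z|]; [rewrite /= tbV|exact: lsm_in].
  (* Outside [U] the bump function vanishes near [y], so the values chosen for [T] there do not
     matter. *)
  have [Uy|/b0 b0y] := pselect (U y); last first.
    apply: (lsm_near (g := fun=> 0)); last exact: lsm_cst.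
    by apply: nbhW b0y => z /= bz; rewrite tdV bz mul0r.
  apply: (lsm_near (g := fun y => b y * 'D_u (h \o psi) (phi y))).
    by apply: nbhW (Uo y Uy) => z Uz /=; rewrite tdV tdT.
  apply: lsmM; first exact: lsm_in.
  apply: (phil y Uy (fun z => 'D_u (h \o psi) z)).
  exact/Cinf_derive/psiC.
- move=> u u' y; have tbu : tb (V u y) = tb (V u' y) by rewrite !tbV.
  apply: tvec_ext; first by rewrite tb_vadd// !tbV.
  apply/funext => f; have [fs|nfs] := pselect (sm X f); last by rewrite !td0.
  rewrite td_vadd// !tdV -mulrDr; congr (_ * _).
  have [Uy|nUy] := pselect (U y); last by rewrite !tdT0// addr0.
  have df := Cinf_diff (phi y : 'rV_n) (psiC f fs).
  by rewrite !tdT// !deriveE// linearD.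
- move=> a u y; apply: tvec_ext; first by rewrite tb_vscal !tbV.
  apply/funext => f; have [fs|nfs] := pselect (sm X f); last by rewrite !td0.
  rewrite td_vscal !tdV mulrCA; congr (_ * _).
  have [Uy|nUy] := pselect (U y); last by rewrite !tdT0// mulr0.
  have df := Cinf_diff (phi y : 'rV_n) (psiC f fs).
  by rewrite !tdT// !deriveE// linearZ.
- have np : nbh (sm X) x [set y | forall i, (phi y : 'rV_n) 0 i = p i y].
    by apply: nbh_fin => i; have [] := pP i.
  (* [tdP] at [y] asks for [f = (f \o psi) (\row_i p i)] on a neighbourhood of [y], hence the
     passage to interior points. *)
  have := nbh_open (nbhI (Uo x Ux) np); apply: nbhW => y ny v vy.
  have [Uy py] := nbh_singleton ny.
  apply: tvec_ext; first by rewrite tb_vscal tbV.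
  apply/funext => f; have [fs|nfs] := pselect (sm X f); last by rewrite !td0.
  rewrite td_vscal tdV tdT//; congr (_ * _).
  rewrite (@tdP _ _ v n p (f \o psi) f) //.
  + have -> // : \row_i p i (tb v) = (phi y : 'rV_n).
    by apply/rowP => i; rewrite mxE vy py.
  + by move=> i; have [] := pP i.
  + exact: psiC.
  + rewrite vy; apply: nbhW ny => z [Uz pz] /=.
    rewrite -[in LHS](psiK z Uz); congr (f (psi _)).
    by apply/rowP => i; rewrite mxE pz.
Qed.

Lemma vector_extension X (v : tangent X) : manifold X ->
  exists2 V, vector_field V & V (tb v) = v.
Proof.
move=> mX; have Xc := manifold_closed mX.
have [n [p [b [V [[ps [bs b0]] VF _ _ nV]]]]] :=
  local_frame (tb v) mX.
have VE := nbh_singleton nV.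
(* The components of [v] and the factor [1 / b] are frozen at the base point of [v]. *)
exists (fun y => vscal (b (tb v))^-1 (V (\row_i td v (p i)) y)).
  have [Vs Vp] := VF (\row_i td v (p i)).
  split=> [|y]; last by rewrite projZ Vp.
  apply: lsmooth_smooth => // y; apply: tangent_lsmooth => [h hs|h hs].
    apply: (@eq_lsm _ _ _ _ h) => [z|]; last exact: lsm_in.
    by rewrite /comp tb_vscal; congr h; exact: Vp.
  apply: (@eq_lsm _ _ _ _ (fun y => (b (tb v))^-1 *
    td (V (\row_i td v (p i)) y) h)) => [z|]; first exact: td_vscal.
  apply: lsmM; first exact: lsm_cst.
  by apply: lsm_in; exact: sm_td.
by rewrite -VE// vscalA mulVf// vscal1.
Qed.

(** * Lie brackets of vector fields *)

Section Bracket.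
Variable X : dspace R.
Hypothesis Xc : dclosed X.
Implicit Types V W : X -> tangent X.

(** The first sum is the chain rule for a derivation; the double sum is the Hessian part, which is
    symmetric in [V] and [W] and so disappears from the commutator. *)
Lemma td_td V W n (h : 'I_n -> X -> R) (F : 'rV[R]_n -> R) f x :
  vector_field V -> vector_field W -> (forall i, sm X (h i)) -> Cinf F ->
  sm X f -> nbh (sm X) x [set y | f y = F (\row_i h i y)] ->
  let DF i := 'D_(delta_mx 0 i) F in
  td (V x) (fun y => td (W y) f) =
  \sum_i td (V x) (fun y => td (W y) (h i)) * DF i (\row_i h i x) +
  \sum_i \sum_j td (V x) (h i) * td (W x) (h j) *
    'D_(delta_mx 0 i) (DF j) (\row_i h i x).
Proof.
move=> VF WF hs FC fs fF DF.
have DFC i : Cinf (DF i) by exact: Cinf_derive.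
have Vx y : tb (V y) = y by have [_] := VF; apply.
have Wx y : tb (W y) = y by have [_] := WF; apply.
have Whs i : sm X (fun y => td (W y) (h i)) by exact: sm_td.
have DFs i : sm X (fun y => DF i (\row_i h i y)) by exact: sm_comp.
rewrite (@td_near _ _ _ (fun y => \sum_i td (W y) (h i) * DF i (\row_i h i y))).
- rewrite td_sum => [|//|i]; last exact: smM.
  transitivity (\sum_i (td (V x) (fun y => td (W y) (h i)) * DF i (\row_i h i x)
    + \sum_j td (V x) (h j) * td (W x) (h i) *
    'D_(delta_mx 0 j) (DF i) (\row_i h i x))).
    apply: eq_bigr => i _; rewrite td_mul// td_compE// Vx addrC mulrC mulr_sumr.
    by congr (_ + _); apply: eq_bigr => j _; ring.
  rewrite big_split [X in _ + X = _]exchange_big; reflexivity.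
- exact: sm_td.
- by apply: sm_sum => // i; exact: smM.
- rewrite Vx; apply: nbhW (nbh_open fF) => y fFy /=.
  rewrite (tdP (t := W y) hs FC fs) ?Wx// derive_lin; last exact: Cinf_diff.
  by apply: eq_bigr => i _; rewrite mxE.
Qed.

Definition bracket_at V W (VF : vector_field V) (WF : vector_field W) (x : X) :
  tangent X.
Proof.
refine (@TVec R X x (fun f => if pselect (sm X f) is left _ then
  td (V x) (fun y => td (W y) f) - td (W x) (fun y => td (V y) f) else 0) _ _).
- move=> k h F f hs FC fs fF; case: pselect => // _.
  rewrite (td_td VF WF hs FC fs fF) (td_td WF VF hs FC fs fF) /=.
  rewrite derive_lin; last exact: Cinf_diff.
  (* The Hessian parts cancel by [Schwarz] once the two summation indices are exchanged. *)
  rewrite opprD addrACA [X in _ + X](_ : _ = 0); last first.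
    apply/eqP; rewrite subr_eq0 exchange_big; apply/eqP/eq_bigr => i _.
    apply: eq_bigr => j _; rewrite Schwarz; first by rewrite [X in X * _]mulrC.
    exact: FC.
  rewrite addr0 -sumrB; apply: eq_bigr => i _; rewrite mxE.
  by case: pselect => [_|/(_ (hs i))//]; rewrite mulrBl.
- by move=> f nf; case: pselect.
Defined.

Lemma bracket_exists V W : vector_field V -> vector_field W ->
  exists2 Z, vector_field Z & is_bracket V W Z.
Proof.
move=> VF WF; exists (bracket_at VF WF).
  split=> [|//]; apply: lsmooth_smooth => // x.
  apply: tangent_lsmooth => [h hs|h hs] /=; first exact: lsm_in.
  case: pselect => // _.
  by apply: lsmB; apply: lsm_in; do 2!apply: sm_td => //.
by move=> x h hs /=; case: pselect.
Qed.

End Bracket.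

End Tangent.

(** * Line bundles and connections *)

Section LineBundles.
Variable R : realType.
Implicit Types X Y M : dspace R.

Section Fibres.
Variables (X : dspace R) (E : vfam X).
Implicit Types (x y : X) (e f : E) (a : R).

Lemma vscal0l e : vscal 0 e = vzero E (proj e).
Proof.
by rewrite -(vaddN e) -{2}(vscal1 e) -(addNr (1 : R)) vscalDl vscal1.
Qed.

Lemma projN e : proj (vopp e) = proj e.
Proof. exact: projZ. Qed.

Lemma projB e f : proj e = proj f -> proj (vsub e f) = proj e.
Proof. by move=> ef; rewrite projD ?projN. Qed.

(** A linear isomorphism from the fibre over [x] to [R]; surjectivity is expressed by reaching 1.
    Nothing is asked of [c] on other fibres. *)
Definition coord_at x (c : E -> R) : Prop :=
  [/\ forall e f, proj e = x -> proj f = x -> c (vadd e f) = c e + c f,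
      forall a e, proj e = x -> c (vscal a e) = a * c e,
      forall e f, proj e = x -> proj f = x -> c e = c f -> e = f &
      exists2 e, proj e = x & c e = 1].

Section Coord.
Variables (x : X) (c : E -> R).
Hypothesis cx : coord_at x c.

Lemma coordD e f : proj e = x -> proj f = x -> c (vadd e f) = c e + c f.
Proof. by have [cD _ _ _] := cx; exact: cD. Qed.

Lemma coordZ a e : proj e = x -> c (vscal a e) = a * c e.
Proof. by have [_ cZ _ _] := cx; exact: cZ. Qed.

Lemma coordN e : proj e = x -> c (vopp e) = - c e.
Proof. by move=> ex; rewrite coordZ// mulN1r. Qed.

Lemma coordB e f : proj e = x -> proj f = x -> c (vsub e f) = c e - c f.
Proof. by move=> ex fx; rewrite coordD ?projN// coordN. Qed.

Lemma coord0 : c (vzero E x) = 0.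
Proof. by rewrite -[x in vzero E x](proj0 E x) -vscal0l coordZ ?proj0// mul0r. Qed.

Lemma coord_inj e f : proj e = x -> proj f = x -> c e = c f -> e = f.
Proof. by have [_ _ ci _] := cx; exact: ci. Qed.

Lemma coord_eq0 e : proj e = x -> c e = 0 -> e = vzero E x.
Proof. by move=> ex e0; apply: coord_inj; rewrite ?proj0// coord0. Qed.

End Coord.

(** A rank one trivialization as a coordinate [c] and a frame [e1] with [c (e1 y) = 1]. Smoothness
    of the frame is stated for its multiples by smooth coefficients, the form in which sections are
    built. *)
Lemma line_chart x : vector_bundle 1 E ->
  exists (U : set X) (c : E -> R) (e1 : X -> E),
  [/\ dopen U /\ U x,
      forall y, U y -> coord_at y c /\ (proj (e1 y) = y /\ c (e1 y) = 1),
      forall e, U (proj e) -> lsm (sm E) c e &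
      forall (M : dspace R) (f : M -> X) (a : M -> R) m, U (f m) ->
        lsmooth f m -> lsm (sm M) a m ->
        lsmooth (fun m => vscal (a m) (e1 (f m))) m].
Proof.
move=> [mX mE projs /(_ x)[U [phi [psi [[Uo Ux] [phis psis] projpsi psiphi]]]]].
move=> [phiD phiZ].
pose c (e : E) : R := (phi e : 'rV_1) 0 0.
pose e1 y := psi (y, \row__ 1).
have phiE e : (phi e : 'rV_1) = \row__ c e.
  by apply/rowP => i; rewrite mxE /c ord1.
have e1P y : U y -> proj (e1 y) = y /\ c (e1 y) = 1.
  by move=> /(projpsi y (\row__ 1))[py]; rewrite /c /e1 => ->; rewrite mxE.
have cU y : U y -> coord_at y c.
  move=> Uy; split=> [e f ey fy|a e ey|e f ey fy ef|].
  - by rewrite /c phiD ?ey ?fy// mxE.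
  - by rewrite /c phiZ ?ey// mxE.
  - rewrite -(psiphi e) ?ey// -(psiphi f) ?fy//; congr (psi (_, _)).
    by rewrite !phiE ef.
  - by have [? ?] := e1P y Uy; exists (e1 y).
have psiE y a : U y -> psi (y, \row__ a) = vscal a (e1 y).
  move=> Uy; have [py ey] := e1P y Uy.
  have [pa ea] := projpsi y (\row__ a) Uy.
  apply: (coord_inj (cU y Uy)); rewrite ?projZ//.
  by rewrite (coordZ (cU y Uy))// ey mulr1 {1}/c ea mxE.
exists U, c, e1; split => // [y Uy|e Ue|M f a m Um fm am].
- by split; [exact: cU|exact: e1P].
- apply: lsmooth_coord; apply: smooth_on_lsmooth phis _.
  exact: (lsmooth_nbh (smooth_lsmooth e projs) (Uo _ Ue)).
- have psil : lsmooth (psi : dprod X (euclid R 1) -> E) (f m, \row__ a m).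
    apply: smooth_on_lsmooth psis _.
    apply: (lsmooth_nbh (U := U) (smooth_lsmooth _ (@fst_smooth R X (euclid R 1)))).
    exact: Uo.
  have pl : @lsmooth R M (dprod X (euclid R 1)) (fun m => (f m, \row__ a m)) m.
    apply: dprod_lsmooth => //; apply: euclid_lsmooth => i.
    by apply: eq_lsm am => z; rewrite mxE.
  apply: lsmooth_near (lsmooth_comp pl psil).
  by apply: nbhW (lsmooth_nbh fm (Uo _ Um)) => z /= Uz; rewrite psiE.
Qed.

Lemma connection_proj D (v : tangent X) s : is_connection D ->
  smooth_section s -> proj (D v s : E) = proj v.
Proof. by move=> [DC _ _ _] /DC[]. Qed.

Hypothesis Evb : vector_bundle 1 E.

Lemma vector_bundle_closed : dclosed X.
Proof. by case: Evb => mX _ _ _; exact: manifold_closed. Qed.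

Lemma coord_exists x : exists c, coord_at x c.
Proof.
by have [U [c [e1 [[_ Ux] /(_ x Ux)[cx _] _ _]]]] := line_chart x Evb; exists c.
Qed.

Lemma vzero_lsmooth x : lsmooth (vzero E) x.
Proof.
have [U [c [e1 [[Uo Ux] cU _ e1s]]]] := line_chart x Evb.
apply: lsmooth_near (e1s X id (fun=> 0) x Ux _ _).
- by apply: nbhW (Uo x Ux) => y /cU[_ [py _]]; rewrite /= vscal0l py.
- exact: smooth_lsmooth.
- exact: lsm_cst.
Qed.

Lemma section_through (e : E) :
  exists2 s : X -> E, smooth_section s & s (proj e) = e.
Proof.
have Xc := vector_bundle_closed.
have [U [c [e1 [[Uo Ux] cU _ e1s]]]] := line_chart (proj e) Evb.
have [b [bs bx b0]] := bump_function Xc (Uo _ Ux).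
(* The bump function is only known to be nonzero at [proj e]; dividing by its value there makes the
   section pass through [e]. *)
pose k y := c e / b (proj e) * b y.
exists (fun y => if pselect (U y) is left _ then vscal (k y) (e1 y)
                 else vzero E y).
  split=> [|y]; last first.
    by case: pselect => [/cU[_ [py _]]|_]; rewrite ?projZ ?proj0.
  apply: lsmooth_smooth => // y; have [Uy|nUy] := pselect (U y).
    apply: lsmooth_near (e1s X id k y Uy _ _).
    - by apply: nbhW (Uo y Uy) => z Uz /=; case: pselect.
    - exact: smooth_lsmooth.
    - by apply: lsmM; [exact: lsm_cst|exact: lsm_in].
  apply: lsmooth_near (vzero_lsmooth y).
  apply: nbhW (b0 y nUy) => z /= bz; case: pselect => // /cU[_ [pz _]].
  by rewrite /k bz mulr0 vscal0l pz.
case: pselect => // _; have [cx [p1 c1]] := cU _ Ux.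
apply: (coord_inj cx); rewrite ?projZ//.
by rewrite (coordZ cx)// c1 /k divfK// mulr1.
Qed.

(* [s = (f / f0) s0] with denominators cleared, so that [f] and [f0] can be
   cut off outside of a trivializing neighbourhood *)
Lemma section_ratio (s s0 : X -> E) x (c : E -> R) :
  smooth_section s -> smooth_section s0 -> coord_at x c -> c (s0 x) != 0 ->
  exists f f0 : X -> R, [/\ sm X f, sm X f0, f0 x != 0 &
    forall y, vscal (f0 y) (s y) = vscal (f y) (s0 y)].
Proof.
move=> [ss ps] [s0s ps0] cx s0x; have Xc := vector_bundle_closed.
have [U [c' [e1 [[Uo Ux] cU cs _]]]] := line_chart x Evb.
have [b [bs bx b0]] := bump_function Xc (Uo _ Ux).
have sb (s' : X -> E) : smooth_section s' -> sm X (fun y => b y * c' (s' y)).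
  move=> [s's ps']; apply: Xc => y; have [Uy|/b0 b0y] := pselect (U y).
    apply: lsmM; first exact: lsm_in.
    apply: lsmooth_lsm; first exact: smooth_lsmooth.
    by apply: cs; rewrite ps'.
  apply: (lsm_near (g := fun=> 0)); last exact: lsm_cst.
  by apply: nbhW b0y => z /= ->; rewrite mul0r.
exists (fun y => b y * c' (s y)), (fun y => b y * c' (s0 y)).
split; [exact: sb|exact: sb| |move=> y].
  rewrite mulf_neq0//; apply: contra_neq s0x => s0x.
  have [c'x _] := cU x Ux.
  by rewrite (coord_eq0 c'x (ps0 x) s0x) (coord0 cx).
have [Uy|nUy] := pselect (U y).
  have [cy _] := cU y Uy; apply: (coord_inj cy); rewrite ?projZ//.
  by rewrite !(coordZ cy)//; ring.
by rewrite (nbh_singleton (b0 y nUy)) !mul0r !vscal0l ps ps0.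
Qed.

(** Fix [s0] nonzero at the base point. Applying the Leibniz rule to [f0 s = f s0] expresses [D v s]
    through [D v s0]; the terms in [td v f] and [td v f0] are the same for both connections and drop
    out of the difference, which is therefore determined by its value on [s0]. *)
Lemma connection_difference D D' : is_connection (E := E) D ->
  is_connection D' -> exists eta, is_connection_difference D D' eta.
Proof.
move=> DC DC'.
suff /choice[eta etaP] : forall v : tangent X, exists b, forall s,
    smooth_section s -> vsub (D v s) (D' v s) = vscal b (s (proj v)).
  by exists eta.
move=> v; set x := proj v; have [c cx] := coord_exists x.
have [e ex ce] : exists2 e, proj e = x & c e = 1 by case: cx.
have [s0 s0S] := section_through e; rewrite ex => s0x.
exists (c (D v s0) - c (D' v s0)) => s sS.
have pD s' : smooth_section s' -> proj (D v s') = x.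
  exact: connection_proj.
have pD' s' : smooth_section s' -> proj (D' v s') = x.
  exact: connection_proj.
have [ps ps0] : proj (s x) = x /\ proj (s0 x) = x.
  by split; [case: sS => _|case: s0S => _]; apply.
have c0 : c (s0 x) != 0 by rewrite s0x ce oner_eq0.
have [f [f0 [fs f0s f0x fE]]] := section_ratio sS s0S cx c0.
apply: (coord_inj cx); rewrite ?projZ ?projB ?pD ?pD'//.
rewrite (coordB cx) ?pD ?pD'// (coordZ cx)//.
have Leib D1 : is_connection D1 -> td v f0 * c (s x) + f0 x * c (D1 v s) =
    td v f * c (s0 x) + f x * c (D1 v s0).
  move=> D1C; have [_ _ L _] := D1C.
  have pD1 s' : smooth_section s' -> proj (D1 v s') = x.
    exact: connection_proj.
  rewrite -!(coordZ cx) ?pD1// -!(coordD cx) ?projZ ?pD1//.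
  by rewrite -!L//; congr (c (D1 v _)); apply/funext.
have := congr1 c (fE x); rewrite !(coordZ cx)// s0x ce mulr1 => fx.
have := Leib D DC; have := Leib D' DC'; rewrite -fx => L' L.
apply: (mulfI f0x).
rewrite (_ : f0 x * (c (D v s) - c (D' v s)) =
  (td v f0 * c (s x) + f0 x * c (D v s)) -
  (td v f0 * c (s x) + f0 x * c (D' v s))); last by ring.
by rewrite L L'; ring.
Qed.

Section Difference.
Variables (D D' : tangent X -> (X -> E) -> E) (eta : tangent X -> R).
Hypotheses (DC : is_connection D) (DC' : is_connection D').
Hypothesis etaP : is_connection_difference D D' eta.

Lemma connection_differenceD v w : proj v = proj w ->
  eta (vadd v w) = eta v + eta w.
Proof.
move=> vw; have [c cx] := coord_exists (proj v).
have [e ex ce] : exists2 e, proj e = proj v & c e = 1 by case: cx.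
have [s sS] := section_through e; rewrite ex => sx.
have pvw : proj (vadd v w) = proj v by rewrite projD.
have [DD _ _ _] := DC; have [DD' _ _ _] := DC'.
have [pD aD _] := DD s sS; have [pD' aD' _] := DD' s sS.
have H u : proj u = proj v -> eta u = c (D u s) - c (D' u s).
  move=> ux; rewrite -(coordB cx) ?pD ?pD'// etaP//.
  by rewrite ux sx (coordZ cx)// ce mulr1.
rewrite !H// aD// aD'// !(coordD cx) ?pD ?pD'//; ring.
Qed.

Lemma connection_differenceZ a v : eta (vscal a v) = a * eta v.
Proof.
have [c cx] := coord_exists (proj v).
have [e ex ce] : exists2 e, proj e = proj v & c e = 1 by case: cx.
have [s sS] := section_through e; rewrite ex => sx.
have [DD _ _ _] := DC; have [DD' _ _ _] := DC'.
have [pD _ aD] := DD s sS; have [pD' _ aD'] := DD' s sS.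
have H u : proj u = proj v -> eta u = c (D u s) - c (D' u s).
  move=> ux; rewrite -(coordB cx) ?pD ?pD'// etaP//.
  by rewrite ux sx (coordZ cx)// ce mulr1.
rewrite !H ?projZ// aD// aD'// !(coordZ cx) ?pD ?pD'//; ring.
Qed.

Lemma linear_row n (A : 'rV[R]_n -> R) :
  (forall u u', A (u + u') = A u + A u') -> (forall a u, A (a *: u) = a * A u) ->
  forall u, A u = \sum_i u 0 i * A (delta_mx 0 i).
Proof.
move=> AD AZ u; rewrite [in LHS](row_sum_coord u).
have A0 : A 0 = 0 by rewrite -(scale0r (0 : 'rV_n)) AZ mul0r.
by rewrite (big_morph A AD A0); apply: eq_bigr => i _.
Qed.

(** Near [v0] the form is [eta v = \sum_i td v (p i) * g i (tb v)] by linearity along a local frame.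
    The [td v (p i)] are generators of the structure of the tangent bundle, and the [g i] are smooth
    because connections send smooth fields and sections to smooth sections. *)
Lemma connection_difference_smooth : sm (tangent X) eta.
Proof.
have mX : manifold X by case: Evb.
apply: tangent_closed => v0; set x := tb v0.
have [n [p [b [V [[ps [bs bx]] VF VD VZ nV]]]]] := local_frame x mX.
have [U [c [e1 [[Uo Ux] cU cs _]]]] := line_chart x Evb.
have [cx [p1 c1]] := cU x Ux.
have [s sS] := section_through (e1 x); rewrite p1 => sx.
have [ss sp] := sS.
have csl : lsm (sm X) (fun y => c (s y)) x.
  apply: lsmooth_lsm; first exact: smooth_lsmooth.
  by apply: cs; rewrite sp.
have csx : c (s x) != 0 by rewrite sx c1 oner_eq0.
have DS D1 i : is_connection D1 ->
    lsm (sm X) (fun y => c (D1 (V (delta_mx 0 i) y) s)) x.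
  move=> [_ _ _ DV]; have [Ds Dp] := DV _ s (VF (delta_mx 0 i)) sS.
  apply: (lsmooth_lsm (f := fun y => D1 (V (delta_mx 0 i) y) s)).
    exact: smooth_lsmooth.
  by apply: cs; rewrite Dp.
(* Dividing by [c (s y)] gives [eta] of the frame field; dividing by [b y] undoes the scaling of the
   frame. *)
pose g i y := (c (D (V (delta_mx 0 i) y) s) - c (D' (V (delta_mx 0 i) y) s)) /
  (c (s y) * b y).
have gl i : lsm (sm X) (g i) x.
  apply: lsmM; first by apply: lsmB; exact: DS.
  apply: lsmV; first by rewrite mulf_neq0.
  by apply: lsmM => //; exact: lsm_in.
have tbl : lsmooth (@tb R X : tangent X -> X) v0.
  exact/smooth_lsmooth/tb_smooth.
apply: (lsm_near (g := fun v => \sum_i td v (p i) * g i (tb v))); last first.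
  apply: lsm_sum => i; apply: lsmM.
    by apply: lsm_in; exact: td_smooth.
  exact: (lsmooth_lsm tbl).
have nW := nbhI (nbhI (Uo x Ux) nV) (nbhI (lsm_neq0 csl csx)
  (lsm_neq0 (lsm_in x bs) bx)).
apply: nbhW (lsmooth_nbh tbl nW) => v /= [[Uv vE] [csv bv]].
have [cv _] := cU _ Uv.
have Vp u y : proj (V u y) = y by have [_] := VF u; apply.
have -> : eta v = eta (V (\row_i td v (p i)) (tb v)) / b (tb v).
  by rewrite -vE// connection_differenceZ [b _ * _]mulrC mulfK.
rewrite (linear_row (A := fun u => eta (V u (tb v)))); first last.
- by move=> a u; rewrite VZ connection_differenceZ.
- by move=> u u'; rewrite VD connection_differenceD// !Vp.
rewrite mulr_suml; apply: eq_bigr => i _; rewrite mxE -mulrA; congr (_ * _).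
set w := V _ _; have wv : proj w = tb v by exact: Vp.
have := congr1 c (etaP w sS); rewrite wv.
rewrite (coordB cv) ?(connection_proj _ DC) ?(connection_proj _ DC')//.
rewrite (coordZ cv) ?sp// /g => ->.
by rewrite invfM mulrA mulfK.
Qed.

End Difference.

(** Both forms are evaluated by the Koszul formula on the same fields through [v] and [w]: the
    bracket term is common and cancels, and the other two differ by [b] applied to the fields. *)
Lemma ext_derivative_difference D D' b theta omega omega' :
  is_connection_difference (E := E) D' D b -> is_connection D -> is_connection D' ->
  vb_morphism (E := tangent X) (E' := E) id theta ->
  is_ext_derivative D theta omega -> is_ext_derivative D' theta omega' ->
  forall v w, proj v = proj w ->
  omega' v w =
  vadd (omega v w) (vsub (vscal (b v) (theta w)) (vscal (b w) (theta v))).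
Proof.
move=> bP DC DC' [_ ths thp _] [op _ _ oK] [op' _ _ oK'] v w vw.
have mX : manifold X by case: Evb.
have [V VF Vv] := vector_extension v mX.
have [W WF Ww] := vector_extension w mX.
have [Z ZF ZP] := bracket_exists vector_bundle_closed VF WF.
have := oK V W Z VF WF ZF ZP (proj v); have := oK' V W Z VF WF ZF ZP (proj v).
have thS U : vector_field U -> smooth_section (fun y => theta (U y)).
  move=> [Us Up]; split; first exact: smooth_comp Us ths.
  by move=> y; rewrite thp Up.
have Vx : V (proj v) = v by [].
have Wx : W (proj v) = w by rewrite vw.
rewrite Vx Wx => -> ->.
have [c cx] := coord_exists (proj v).
have pZ : proj (theta (Z (proj v))) = proj v by have [_] := thS Z ZF; apply.
have b1 := bP v _ (thS W WF); have b2 := bP w _ (thS V VF).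
rewrite Wx in b1; rewrite -vw Vx in b2.
have pD u s := @connection_proj D u s DC.
have pD' u s := @connection_proj D' u s DC'.
have TV := thS V VF; have TW := thS W WF.
move/(congr1 c): b1; rewrite (coordB cx) ?pD ?pD'// (coordZ cx) ?thp//.
move/(congr1 c): b2; rewrite (coordB cx) ?pD ?pD'// (coordZ cx) ?thp// => b2 b1.
apply: (coord_inj cx).
- by rewrite !projB ?pD' ?pZ ?thp ?pD'.
- by rewrite projD !projB ?projZ ?pD ?pZ ?thp ?pD.
rewrite (coordD cx) ?projB ?projZ ?pD ?pZ ?thp ?pD//.
rewrite !(coordB cx) ?projB ?projZ ?pD ?pD' ?pZ ?thp ?pD ?pD'//.
rewrite !(coordZ cx) ?thp// -b1 -b2; ring.
Qed.

End Fibres.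

(** * Pullback of sections and connections along fibrewise isomorphisms *)

Section Pullback.
Variables (X Y : dspace R) (E : vfam X) (E' : vfam Y) (f : X -> Y) (F : E -> E').
Hypotheses (Evb : vector_bundle 1 E) (Evb' : vector_bundle 1 E').
Hypothesis Fvb : vb_morphism f F.
Hypothesis Fbij : forall y e', proj e' = f y ->
  exists2 e, proj e = y & F e = e'.

(** The section is chosen pointwise; in local frames its coefficient is
    [c' (s0 (f z)) / c' (F (e1 z))], a quotient of smooth functions. *)
Lemma pullback_section (s0 : Y -> E') : smooth_section s0 ->
  exists2 s, smooth_section s & forall y, F (s y) = s0 (f y).
Proof.
have [fs Fs Fp [FD FZ]] := Fvb.
move=> [s0s s0p].
have /choice[s sP] : forall y, exists e, proj e = y /\ F e = s0 (f y).
  by move=> y; have [e ? ?] := Fbij (s0p (f y)); exists e.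
exists s => [|y]; last by have [] := sP y.
have sp y : proj (s y) = y by have [] := sP y.
split=> //; apply: lsmooth_smooth => [|y]; first exact: vector_bundle_closed Evb.
have [U [c [e1 [[Uo Uy] cU cs e1s]]]] := line_chart y Evb.
have [U' [c' [e1' [[Uo' Uy'] cU' cs' _]]]] := line_chart (f y) Evb'.
have fl : lsmooth f y by exact: smooth_lsmooth.
(* [line_chart] gives smoothness of multiples of the frame, so the frame itself is used as its
   multiple by 1. *)
have e1l : lsmooth (fun z => vscal 1 (e1 z)) y.
  by apply: (e1s X id (fun=> 1)) => //; [exact: smooth_lsmooth|exact: lsm_cst].
have Fe1 z : U z -> U' (f z) ->
    c' (s0 (f z)) = c (s z) * c' (F (vscal 1 (e1 z))).
  move=> Uz Uz'; have [cz [pz c1]] := cU z Uz; have [cz' _] := cU' _ Uz'.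
  have [_ <-] := sP z; rewrite -(coordZ cz') ?Fp ?projZ ?pz// -FZ; last by [].
  rewrite vscal1; congr (c' (F _)).
  by apply: (coord_inj cz); rewrite ?projZ// (coordZ cz)// c1 mulr1.
(* If [F] killed the frame at [y] it would be zero on the whole fibre and miss the element of
   coordinate 1. *)
have F1 : c' (F (vscal 1 (e1 y))) != 0.
  have [cy [py c1]] := cU y Uy; have [cy' _] := cU' _ Uy'.
  have [e' e'p ce'] : exists2 e', proj e' = f y & c' e' = 1 by case: cy'.
  have [e ep Fe] := Fbij e'p.
  apply/eqP => F10; have := ce'.
  rewrite -Fe (_ : e = vscal (c e) (vscal 1 (e1 y))); last first.
    by apply: (coord_inj cy); rewrite ?projZ// !(coordZ cy) ?projZ// c1 !mulr1.
  rewrite FZ// (coordZ cy') ?Fp ?projZ ?py// F10 mulr0 => /esym/eqP.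
  by rewrite oner_eq0.
have c1l : lsm (sm X) (fun z => c' (F (vscal 1 (e1 z)))) y.
  apply: (lsmooth_lsm (f := fun z => F (vscal 1 (e1 z)))).
    exact: lsmooth_comp e1l (smooth_lsmooth _ Fs).
  by apply: cs'; rewrite Fp projZ; have [_ [-> _]] := cU y Uy.
pose a z := c' (s0 (f z)) / c' (F (vscal 1 (e1 z))).
have al : lsm (sm X) a y.
  apply: lsmM; last exact: lsmV.
  apply: (lsmooth_lsm (f := fun z => s0 (f z))).
    exact: lsmooth_comp fl (smooth_lsmooth _ s0s).
  by apply: cs'; rewrite s0p.
apply: lsmooth_near (e1s X id a y Uy _ al); last exact: smooth_lsmooth.
apply: nbhW (nbhI (nbhI (Uo y Uy) (lsmooth_nbh fl (Uo' _ Uy'))) (lsm_neq0 c1l F1)).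
move=> z /= [[Uz Uz'] Fz]; have [cz [pz c1]] := cU z Uz.
apply: (coord_inj cz); rewrite ?projZ// (coordZ cz)// c1 mulr1.
by rewrite /a Fe1// mulfK.
Qed.

(** The difference of [D'] and [D] is already known to be some 1-form, so its value at [v] can be
    read off one section: the pullback of a section that does not vanish at [f (proj v)]. *)
Lemma pullback_difference nabla nabla' D D' beta :
  is_pullback_connection f F nabla D -> is_pullback_connection f F nabla' D' ->
  is_connection_difference nabla' nabla beta ->
  is_connection_difference D' D (fun v => beta (tmap f v)).
Proof.
have [fs Fs Fp [FD FZ]] := Fvb.
move=> [DC DP] [DC' DP'] betaP.
have [eta etaP] := connection_difference Evb DC' DC.
suff etaE v : eta v = beta (tmap f v) by move=> v s sS; rewrite -etaE; exact: etaP.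
have [c cx] := coord_exists Evb' (f (proj v)).
have [e ex ce] : exists2 e, proj e = f (proj v) & c e = 1 by case: cx.
have [s0 s0S] := section_through Evb' e; rewrite ex => s0x.
have [s sS sP] := pullback_section s0S.
have := congr1 F (etaP v s sS).
rewrite FD// ?(connection_proj _ DC')//; last first.
  by rewrite projN (connection_proj _ DC).
rewrite !FZ// (DP _ _ s0S sS sP) (DP' _ _ s0S sS sP) sP -[LHS]/(vsub _ _).
have ptf : proj (tmap f v : tangent Y) = f (proj v) by exact: tb_tmap.
rewrite betaP// ptf s0x => /(congr1 c).
by rewrite !(coordZ cx)// ce !mulr1.
Qed.

End Pullback.

End LineBundles.

(** * Line bundle groupoids *)

Section GroupoidTheory.
Variables (X A : Type) (G : gmaps X A).
Hypothesis HG : is_groupoid G.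

Lemma gsrc1 x : src G (one G x) = x.
Proof. by have [/(_ x)[? _] _ _ _ _] := HG. Qed.

Lemma gtgt1 x : tgt G (one G x) = x.
Proof. by have [/(_ x)[_ ?] _ _ _ _] := HG. Qed.

Lemma gsrcM g h : src G g = tgt G h -> src G (mul G g h) = src G h.
Proof. by move=> gh; have [_ /(_ g h gh)[? _] _ _ _] := HG. Qed.

Lemma gmulA g h k : src G g = tgt G h -> src G h = tgt G k ->
  mul G g (mul G h k) = mul G (mul G g h) k.
Proof. by have [_ _ mA _ _] := HG; exact: mA. Qed.

Lemma gmul1 g : mul G (one G (tgt G g)) g = g.
Proof. by have [_ _ _ /(_ g)[? _] _] := HG. Qed.

Lemma gmulr1 g : mul G g (one G (src G g)) = g.
Proof. by have [_ _ _ /(_ g)[_ ?] _] := HG. Qed.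

Lemma gsrcV g : src G (inv G g) = tgt G g.
Proof. by have [_ _ _ _ /(_ g)[]] := HG. Qed.

Lemma gtgtV g : tgt G (inv G g) = src G g.
Proof. by have [_ _ _ _ /(_ g)[]] := HG. Qed.

Lemma gmulV g : mul G g (inv G g) = one G (tgt G g).
Proof. by have [_ _ _ _ /(_ g)[]] := HG. Qed.

Lemma gmulVl g : mul G (inv G g) g = one G (src G g).
Proof. by have [_ _ _ _ /(_ g)[]] := HG. Qed.

Lemma ginvK g : inv G (inv G g) = g.
Proof.
rewrite -[LHS]gmulr1 gsrcV gtgtV -gmulVl gmulA ?gsrcV ?gtgtV//.
by rewrite gmulVl gsrcV gmul1.
Qed.

Lemma ginv1 x : inv G (one G x) = one G x.
Proof.
by rewrite -[LHS]gmul1 gtgtV gsrc1 gmulV gtgt1.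
Qed.

Lemma gmul11 x : mul G (one G x) (one G x) = one G x.
Proof. by have := gmul1 (one G x); rewrite gtgt1. Qed.

End GroupoidTheory.

Section Families.
Variable R : realType.

Lemma linear_over0 (X Y : dspace R) (E : vfam X) (E' : vfam Y) (f : X -> Y)
    (F : E -> E') : vb_morphism f F -> forall x, F (vzero E x) = vzero E' (f x).
Proof.
move=> [_ _ Fp [_ FZ]] x.
by rewrite -[x in LHS](proj0 E x) -vscal0l FZ// vscal0l Fp proj0.
Qed.

Section HomTheory.
Variables (X Y : dspace R) (E : vfam Y) (S : X -> set E) (B : vfam X).

Lemma hom0 (p : hom S B) y : S (hb p) (vzero E y) ->
  p (vzero E y) = vzero B (hb p).
Proof.
move=> Sy; have := hscalE 0 Sy.
by rewrite !vscal0l proj0 hom_proj.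
Qed.

Lemma hf_vadd (p q : hom_bundle S B) v : hb p = hb q ->
  hf (vadd p q) v = vadd (hf p v) (hf q v).
Proof. by move=> pq; rewrite [LHS](congr1 (@^~ v) (hfD pq)). Qed.

Lemma hb_vadd (p q : hom_bundle S B) : hb p = hb q -> hb (vadd p q) = hb p.
Proof. exact: hbD. Qed.

Lemma hf_vscal a (p : hom_bundle S B) v : hf (vscal a p) v = vscal a (hf p v).
Proof. by []. Qed.

Lemma hom_bundle_lsmooth (M : dspace R) (f : M -> hom_bundle S B) m :
  lsmooth (fun y => hb (f y)) m ->
  (forall (s : X -> E) (l : B -> R), smooth s -> (forall x, S x (s x)) ->
     sm B l -> fibre_linear l ->
     lsm (sm M) (fun y => l (f y (s (hb (f y))))) m) ->
  lsmooth f m.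
Proof.
move=> fb fl; apply: lsmooth_gen => _ [[h hs ->]|[s [l [ss Ss ls ll ->]]]].
  exact: fb.
exact: (fl s l ss Ss ls ll).
Qed.

End HomTheory.

Section WhitneyTheory.
Variables (X : dspace R) (E F : vfam X).
Implicit Types p q : whitney E F.

Lemma wfstE (e : E) (f : F) : proj e = proj f -> wfst (wpair e f) = e.
Proof. by move=> ef; rewrite /wfst wpairE. Qed.

Lemma wsndE (e : E) (f : F) : proj e = proj f -> wsnd (wpair e f) = f.
Proof. by move=> ef; rewrite /wsnd wpairE. Qed.

Lemma wproj1 p : proj (wfst p) = proj p. Proof. by []. Qed.

Lemma wproj2 p : proj (wsnd p) = proj p.
Proof. by have := wpairsP p => /esym. Qed.

Lemma whitney_ext p q : wfst p = wfst q -> wsnd p = wsnd q -> p = q.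
Proof.
move=> pq1 pq2; apply: wpairs_ext.
by rewrite [LHS]surjective_pairing [RHS]surjective_pairing; congr pair.
Qed.

Lemma wpairK p : wpair (wfst p) (wsnd p) = p.
Proof.
by apply: whitney_ext; rewrite ?wfstE ?wsndE//; rewrite wproj2.
Qed.

Lemma wfst0 x : wfst (vzero (whitney E F) x) = vzero E x.
Proof. by rewrite wfstE// !proj0. Qed.

Lemma wsnd0 x : wsnd (vzero (whitney E F) x) = vzero F x.
Proof. by rewrite wsndE// !proj0. Qed.

Lemma wfstD p q : proj p = proj q -> wfst (vadd p q) = vadd (wfst p) (wfst q).
Proof. by move=> pq; rewrite wfstE// !projD ?wproj2. Qed.

Lemma wsndD p q : proj p = proj q -> wsnd (vadd p q) = vadd (wsnd p) (wsnd q).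
Proof. by move=> pq; rewrite wsndE// !projD ?wproj2. Qed.

Lemma wfstZ a p : wfst (vscal a p) = vscal a (wfst p).
Proof. by rewrite wfstE// !projZ wproj2. Qed.

Lemma wsndZ a p : wsnd (vscal a p) = vscal a (wsnd p).
Proof. by rewrite wsndE// !projZ wproj2. Qed.

Lemma wfst_smooth : @smooth R (whitney E F) E (@wfst R X E F).
Proof. exact: smooth_comp (@sval_smooth R _ _) (@fst_smooth R E F). Qed.

Lemma wsnd_smooth : @smooth R (whitney E F) F (@wsnd R X E F).
Proof. exact: smooth_comp (@sval_smooth R _ _) (@snd_smooth R E F). Qed.

Lemma wproj_smooth :
  smooth (@proj R X E) -> smooth (@proj R X (whitney E F)).
Proof. by move=> ps; exact: smooth_comp wfst_smooth ps. Qed.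

Lemma wpair_lsmooth (M : dspace R) (f : M -> E) (g : M -> F) m :
  (forall m, proj (f m) = proj (g m)) -> lsmooth f m -> lsmooth g m ->
  @lsmooth R M (whitney E F) (fun m => wpair (f m) (g m)) m.
Proof.
move=> fg fm gm; apply: dsub_lsmooth; apply: dprod_lsmooth.
  by apply: lsmooth_near fm; apply: nbhW (nbhT _ _) => y _ /=; rewrite wpairE.
by apply: lsmooth_near gm; apply: nbhW (nbhT _ _) => y _ /=; rewrite wpairE.
Qed.

End WhitneyTheory.
End Families.

Section LineGroupoid.
Variables (R : realType) (G : gpd R) (L : vbg G).
Hypothesis HL : line_bundle_groupoid L.
Implicit Types (g : ar G) (x : ob G) (l : arV L) (p : obV L).

Let HV : is_vbg L. Proof. by case: HL. Qed.

Lemma lbg_base : lie_groupoid G. Proof. by have [[]] := HV. Qed.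

Lemma lbg_gpd : is_groupoid G. Proof. by have [] := lbg_base. Qed.

Lemma lbg_tot_gpd : is_groupoid L. Proof. by have [[_ []]] := HV. Qed.

Lemma lbg_ob : vector_bundle 1 (obV L). Proof. by case: HL. Qed.

Lemma lbg_ar : vector_bundle 1 (arV L). Proof. by case: HL. Qed.

Lemma lbg_ob_closed : dclosed (ob G).
Proof. exact: vector_bundle_closed lbg_ob. Qed.

Lemma lbg_ar_closed : dclosed (ar G).
Proof. exact: vector_bundle_closed lbg_ar. Qed.

Lemma lbg_src : vb_morphism (E := arV L) (E' := obV L) (src G) (src L).
Proof. by have [_ _ []] := HV. Qed.

Lemma lbg_tgt : vb_morphism (E := arV L) (E' := obV L) (tgt G) (tgt L).
Proof. by have [_ _ []] := HV. Qed.

Lemma lbg_one : vb_morphism (E := obV L) (E' := arV L) (one G) (one L).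
Proof. by have [_ _ _ []] := HV. Qed.

Lemma lbg_inv : vb_morphism (E := arV L) (E' := arV L) (inv G) (inv L).
Proof. by have [_ _ _ []] := HV. Qed.

Let gG := lbg_gpd.
Let gL := lbg_tot_gpd.

Lemma proj_src l : proj (src L l) = src G (proj l).
Proof. by have [_ _ P _] := lbg_src. Qed.

Lemma proj_tgt l : proj (tgt L l) = tgt G (proj l).
Proof. by have [_ _ P _] := lbg_tgt. Qed.

Lemma proj_one p : proj (one L p) = one G (proj p).
Proof. by have [_ _ P _] := lbg_one. Qed.

Lemma proj_inv l : proj (inv L l) = inv G (proj l).
Proof. by have [_ _ P _] := lbg_inv. Qed.

Lemma proj_mul l l' : src L l = tgt L l' ->
  proj (mul L l l' : arV L) = mul G (proj l) (proj l').
Proof. by have [_ _ _ _ [P _ _]] := HV; exact: P. Qed.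

Lemma srcD l l' : proj l = proj l' ->
  src L (vadd l l') = vadd (src L l : obV L) (src L l').
Proof. by have [_ _ _ [P _]] := lbg_src; exact: P. Qed.

Lemma srcZ a l : src L (vscal a l) = vscal a (src L l : obV L).
Proof. by have [_ _ _ [_ P]] := lbg_src; exact: P. Qed.

Lemma src0 g : src L (vzero (arV L) g) = vzero (obV L) (src G g).
Proof. exact: (linear_over0 lbg_src). Qed.

Lemma tgtD l l' : proj l = proj l' ->
  tgt L (vadd l l') = vadd (tgt L l : obV L) (tgt L l').
Proof. by have [_ _ _ [P _]] := lbg_tgt; exact: P. Qed.

Lemma tgtZ a l : tgt L (vscal a l) = vscal a (tgt L l : obV L).
Proof. by have [_ _ _ [_ P]] := lbg_tgt; exact: P. Qed.

Lemma tgt0 g : tgt L (vzero (arV L) g) = vzero (obV L) (tgt G g).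
Proof. exact: (linear_over0 lbg_tgt). Qed.

Lemma oneD p p' : proj p = proj p' ->
  one L (vadd p p') = vadd (one L p : arV L) (one L p').
Proof. by have [_ _ _ [P _]] := lbg_one; exact: P. Qed.

Lemma oneZ a p : one L (vscal a p) = vscal a (one L p : arV L).
Proof. by have [_ _ _ [_ P]] := lbg_one; exact: P. Qed.

Lemma one0 x : one L (vzero (obV L) x) = vzero (arV L) (one G x).
Proof. exact: (linear_over0 lbg_one). Qed.

Lemma mul0 g h : src G g = tgt G h ->
  mul L (vzero (arV L) g) (vzero (arV L) h) = vzero (arV L) (mul G g h).
Proof.
move=> gh; have gh0 : src L (vzero (arV L) g) = tgt L (vzero (arV L) h).
  by rewrite src0 tgt0 gh.
have [_ _ _ _ [_ _ mulZ]] := HV.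
rewrite -(proj0 (arV L) g) -(proj0 (arV L) h) -!vscal0l mulZ// vscal0l.
by rewrite proj_mul// !proj0.
Qed.

(** The unit of a nonzero [p] over [x] is nonzero because its source is [p]; hence it spans the line
    over [1_x], and [s] is injective on that line. *)
Lemma core_zero l x : proj l = one G x -> src L l = vzero (obV L) x ->
  l = vzero (arV L) (one G x).
Proof.
move=> lx sl0; have [c cx] := coord_exists lbg_ob x.
have [p px cp] : exists2 p, proj p = x & c p = 1 by case: cx.
have [d dx] := coord_exists lbg_ar (one G x).
have p1 : proj (one L p) = one G x by rewrite proj_one px.
have d1 : d (one L p) != 0.
  apply/eqP => /(coord_eq0 dx p1)/(congr1 (fun l : arV L => c (src L l))).
  rewrite (gsrc1 gL) src0 (gsrc1 gG) (coord0 cx) cp => /eqP.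
  by rewrite oner_eq0.
have lE : l = vscal (d l / d (one L p)) (one L p).
  by apply: (coord_inj dx); rewrite ?projZ// (coordZ dx)// divfK.
have := congr1 c sl0; rewrite lE srcZ (gsrc1 gL) (coordZ cx)// cp (coord0 cx).
by rewrite mulr1 => ->; rewrite vscal0l p1.
Qed.

(* [v] in the kernel of [s] over [g] is the product of the element
   [v . 0_(g^-1)] of the core with [0_g], and the core of [L] vanishes. *)
Lemma src_ker l : src L l = vzero (obV L) (src G (proj l)) ->
  l = vzero (arV L) (proj l).
Proof.
set g := proj l => sl0; set z := vzero (arV L).
have cV : src G g = tgt G (inv G g) by rewrite (gtgtV gG).
have cV' : src G (inv G g) = tgt G g by rewrite (gsrcV gG).
have lz : src L l = tgt L (z (inv G g)) by rewrite sl0 tgt0 (gtgtV gG).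
have zz : src L (z (inv G g)) = tgt L (z g) by rewrite src0 tgt0 (gsrcV gG).
have k0 : mul L l (z (inv G g)) = z (one G (tgt G g)).
  apply: core_zero; first by rewrite proj_mul// proj0 (gmulV gG).
  by rewrite (gsrcM gL)// src0 (gsrcV gG).
have e1 : z (one G (src G g)) = one L (src L l) by rewrite sl0 one0.
have e2 : z (one G (tgt G g)) = one L (tgt L (z g)) by rewrite tgt0 one0.
have := gmulA gL lz zz; rewrite k0 mul0// (gmulVl gG).
rewrite -/(z (one G (src G g))) e1 (gmulr1 gL) => ->.
by rewrite e2 (gmul1 gL).
Qed.

Lemma src_inj l l' : proj l = proj l' -> src L l = src L l' -> l = l'.
Proof.
move=> ll' sll'; have [c cx] := coord_exists lbg_ar (proj l).
have pB : proj (vsub l l') = proj l by rewrite projB.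
have := @src_ker (vsub l l'); rewrite pB.
rewrite srcD ?projN// srcZ -sll' => H; apply: (coord_inj cx) => //.
apply/eqP; rewrite -subr_eq0 -(coordB cx)// H ?(coord0 cx)//.
have [d dx] := coord_exists lbg_ob (src G (proj l)).
apply: (coord_eq0 dx); first by rewrite projD ?projZ// proj_src.
by rewrite (coordD dx) ?(coordZ dx) ?projZ ?proj_src//; ring.
Qed.

(** By [src_ker] the source map is nonzero on a generator of the fibre, and a multiple of that
    generator reaches [p] since the target is a line. *)
Lemma src_surj g p : proj p = src G g ->
  exists2 l : arV L, proj l = g & src L l = p.
Proof.
move=> pg; have [c cg] := coord_exists lbg_ar g.
have [e eg ce] : exists2 e, proj e = g & c e = 1 by case: cg.
have [d dx] := coord_exists lbg_ob (src G g).
have se : proj (src L e) = src G g by rewrite proj_src eg.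
have de : d (src L e) != 0.
  apply/eqP => /(coord_eq0 dx se); rewrite -eg => /src_ker/(congr1 c).
  by rewrite eg ce (coord0 cg) => /eqP; rewrite oner_eq0.
exists (vscal (d p / d (src L e)) e); first by rewrite projZ.
by apply: (coord_inj dx); rewrite ?proj_src ?projZ ?eg// srcZ (coordZ dx)// divfK.
Qed.

Lemma src_invP g p : proj p = src G g ->
  proj (src_inv g p : arV L) = g /\ src L (src_inv g p) = p.
Proof.
move=> pg; rewrite /src_inv; case: pselect => [h|[]].
  by case: (cid h).
by have [l ? ?] := src_surj pg; exists l.
Qed.

Lemma src_invK g l : proj l = g -> src_inv g (src L l) = l.
Proof.
move=> lg; have [pl sl] : proj (src_inv g (src L l) : arV L) = g /\
    src L (src_inv g (src L l)) = src L l.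
  by apply: src_invP; rewrite proj_src lg.
by apply: src_inj => //; rewrite pl.
Qed.

Lemma tgt_surj g p : proj p = tgt G g ->
  exists2 l : arV L, proj l = g & tgt L l = p.
Proof.
rewrite -(gsrcV gG) => /src_surj[l lg lp]; exists (inv L l).
  by rewrite proj_inv lg (ginvK gG).
by rewrite (gtgtV gL).
Qed.

(** The element over [g^(-1)] with source [t(l)] is [l^(-1)], whose target is [s(l)]. *)
Lemma act_inv_tgt l : act (inv G (proj l)) (tgt L l) = src L l.
Proof.
by rewrite /act -(gsrcV gL l) src_invK ?proj_inv// (gtgtV gL).
Qed.

(** Both sides lie over [1_x] and have the same source. Consequently [s] and [t] of [L] agree over
    units. *)
Lemma unit_arrow l x : proj l = one G x -> l = one L (src L l).
Proof.
move=> lx; apply: src_inj; last by rewrite (gsrc1 gL).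
by rewrite proj_one proj_src lx (gsrc1 gG).
Qed.

Lemma unit_tgt l x : proj l = one G x -> tgt L l = src L l.
Proof. by move=> /unit_arrow {1}->; rewrite (gtgt1 gL). Qed.

Lemma act1 p x : proj p = x -> act (inv G (one G x)) p = p.
Proof.
move=> px; have := act_inv_tgt (one L p).
by rewrite proj_one px (gtgt1 gL) (gsrc1 gL).
Qed.

End LineGroupoid.

(** * The Morita kernel *)

Lemma tmap_vb (R : realType) (M N : dspace R) (f : M -> N) : smooth f ->
  vb_morphism (E := tangent M) (E' := tangent N) f (tmap f).
Proof.
move=> fs; split=> //; first exact: tmap_smooth.
  exact: tb_tmap.
by split=> *; [exact: tmapD|exact: tmapZ].
Qed.

Section MoritaKernel.
Variables (R : realType) (G : gpd R) (L : vbg G).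
Hypothesis HL : line_bundle_groupoid L.
Variable theta : tangent (ar G) -> arV L.
Hypotheses (theta_form : line_form theta) (theta_mult : multiplicative theta).
Variable mT : tangent (ar G) -> tangent (ar G) -> tangent (ar G).
Hypothesis HmT : tangent_multiplication mT.

Let gG := lbg_gpd HL.
Let gL := lbg_tot_gpd HL.
Let V := morita_kernel mT theta.

Lemma base_src_smooth : smooth (src G : ar G -> ob G).
Proof. by have [_ _ [[? _] _]] := lbg_base HL. Qed.

Lemma base_tgt_smooth : smooth (tgt G : ar G -> ob G).
Proof. by have [_ _ [_ [? _]]] := lbg_base HL. Qed.

Lemma base_one_smooth : smooth (one G : ob G -> ar G).
Proof. by have [_ _ _ [? _]] := lbg_base HL. Qed.

Lemma base_inv_smooth : smooth (inv G : ar G -> ar G).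
Proof. by have [_ _ _ [_ ?]] := lbg_base HL. Qed.

Lemma base_mul_smooth : smooth (@mul2 _ G).
Proof. by have [_ _ _ _ ?] := lbg_base HL. Qed.

Let ss := base_src_smooth.
Let ts := base_tgt_smooth.
Let us := base_one_smooth.
Let is_ := base_inv_smooth.

Lemma pr1_smooth : smooth (@pr1 _ G).
Proof. exact: smooth_comp (@sval_smooth R _ _) (@fst_smooth R _ _). Qed.

Lemma pr2_smooth : smooth (@pr2 _ G).
Proof. exact: smooth_comp (@sval_smooth R _ _) (@snd_smooth R _ _). Qed.

Section ComposablePair.
Variables (M : dspace R) (a b : M -> ar G).
Hypothesis ab : forall m, src G (a m) = tgt G (b m).
Hypotheses (Mc : dclosed M) (as_ : smooth a) (bs : smooth b).

(** [mT] and multiplicativity of [theta] are only specified on tangent vectors of the space of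
    composable pairs; images of tangent vectors of [M] under such a map supply them. *)
Definition cpair (m : M) : composable G :=
  exist (fun p : dprod (ar G) (ar G) => src G p.1 = tgt G p.2) (a m, b m) (ab m).

Lemma cpair_smooth : smooth cpair.
Proof.
apply: lsmooth_smooth => // m; apply: dsub_lsmooth; apply: dprod_lsmooth.
  exact: (smooth_lsmooth m as_).
exact: (smooth_lsmooth m bs).
Qed.

Lemma tangent_mul_cpair (v : tangent M) :
  mT (tmap a v) (tmap b v) = tmap (fun m => mul G (a m) (b m)) v.
Proof.
have := HmT (tmap cpair v).
rewrite (tmap_comp _ cpair_smooth pr1_smooth).
rewrite (tmap_comp _ cpair_smooth pr2_smooth).
by rewrite (tmap_comp _ cpair_smooth base_mul_smooth).
Qed.

(* Over a pair of units the fibres of [L^(2)] and of [L] are identified through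
   [l |-> (l, l)]. *)
Lemma theta_mult_unit (v : tangent M) x :
  a (proj v) = one G x -> b (proj v) = one G x ->
  vadd (vsub (theta (tmap b v)) (theta (tmap (fun m => mul G (a m) (b m)) v)))
    (theta (tmap a v)) = vzero (arV L) (one G x).
Proof.
move=> ax bx.
have [_ _ thp _] := theta_form.
have pa : proj (theta (tmap a v)) = one G x by rewrite thp [proj _]tb_tmap.
have pb : proj (theta (tmap b v)) = one G x by rewrite thp [proj _]tb_tmap.
have pm : proj (theta (tmap (fun m => mul G (a m) (b m)) v)) = one G x.
  by rewrite thp [proj _]tb_tmap ax bx (gmul11 gG).
have diag (l : arV L) : proj l = one G x -> src L l = tgt L l.
  by move=> lx; rewrite (unit_tgt HL lx).
pose d (l : arV L) (lx : proj l = one G x) : composable L :=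
  exist (fun p : dprod (ar L) (ar L) => src L p.1 = tgt L p.2) (l, l) (diag l lx).
have pxi : pr1 (proj (tmap cpair v : tangent _)) = one G x /\
    pr2 (proj (tmap cpair v : tangent _)) = one G x.
  by rewrite [proj _]tb_tmap.
have := @theta_mult (tmap cpair v) (d _ pa) (d _ pb) (d _ pm).
rewrite (tmap_comp _ cpair_smooth pr1_smooth).
rewrite (tmap_comp _ cpair_smooth pr2_smooth).
rewrite (tmap_comp _ cpair_smooth base_mul_smooth).
have [-> ->] := pxi; case=> //.
(* An element [l] over a unit of [G] is a unit of [L], so [l l = l]: the remaining hypothesis, on
   [mul2], follows. *)
have := gmul1 gL (theta (tmap (fun m => mul G (a m) (b m)) v)).
by rewrite (unit_tgt HL pm) -(unit_arrow HL pm).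
Qed.

End ComposablePair.

(** Differentiate [g 1_(s g) = g] along the smooth family of composable pairs [(g, 1_(s g))]. *)
Lemma mT_unitr (v : tangent (ar G)) :
  mT v (tmap (one G) (tmap (src G) v)) = v.
Proof.
have c m : src G (id m) = tgt G ((one G \o src G) m) by rewrite /= (gtgt1 gG).
have := tangent_mul_cpair c (lbg_ar_closed HL) (@smooth_id R _)
  (smooth_comp ss us) v.
rewrite (tmap_comp v ss us) tmap_id => ->.
rewrite (_ : (fun m => _) = id) ?tmap_id//.
by apply/funext => m; exact: (gmulr1 gG).
Qed.

Lemma mT_unitl (v : tangent (ar G)) :
  mT (tmap (one G) (tmap (tgt G) v)) v = v.
Proof.
have c m : src G ((one G \o tgt G) m) = tgt G (id m) by rewrite /= (gsrc1 gG).
have := tangent_mul_cpair c (lbg_ar_closed HL) (smooth_comp ts us)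
  (@smooth_id R _) v.
rewrite (tmap_comp v ts us) tmap_id => ->.
rewrite (_ : (fun m => _) = id) ?tmap_id//.
by apply/funext => m; exact: (gmul1 gG).
Qed.

Lemma proj_theta v : proj (theta v) = proj v.
Proof. by have [_ _ thp _] := theta_form. Qed.

Lemma thetaD v w : proj v = proj w ->
  theta (vadd v w) = vadd (theta v) (theta w).
Proof. by have [_ _ _ [P _]] := theta_form; exact: P. Qed.

Lemma thetaZ a v : theta (vscal a v) = vscal a (theta v).
Proof. by have [_ _ _ [_ P]] := theta_form; exact: P. Qed.

(** Multiplicativity along the pairs [(1_m, 1_m)], whose product is [1_m], reads
    [theta - theta + theta = 0]. *)
Lemma theta_unit (v : tangent (ob G)) :
  theta (tmap (one G) v) = vzero (arV L) (one G (proj v)).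
Proof.
have c m : src G (one G m) = tgt G (one G m) by rewrite (gtgt1 gG) (gsrc1 gG).
have := theta_mult_unit c (lbg_ob_closed HL) us us (erefl (one G (proj v))) erefl.
rewrite (_ : (fun m => mul G _ _) = one G); last first.
  by apply/funext => m; exact: (gmul11 gG).
have p1 : proj (theta (tmap (one G) v)) = one G (proj v).
  by rewrite proj_theta [proj _]tb_tmap.
have [d dx] := coord_exists (lbg_ar HL) (one G (proj v)).
move/(congr1 d); rewrite (coordD dx) ?projB// (coordB dx)// subrr add0r.
by rewrite (coord0 dx) => /(coord_eq0 dx p1).
Qed.

(** Multiplicativity along the pairs [(g, g^(-1))]: their product is a unit, where [theta] vanishes.
    At a unit both values of [theta] lie in one fibre, so they can be compared without transport. *)
Lemma theta_inv (v : tangent (ar G)) x : proj v = one G x ->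
  theta (tmap (inv G) v) = vopp (theta v).
Proof.
move=> vx.
have c m : src G (id m) = tgt G (inv G m) by rewrite (gtgtV gG).
have ivx : inv G (proj v) = one G x by rewrite vx (ginv1 gG).
have := theta_mult_unit c (lbg_ar_closed HL) (@smooth_id R _) is_ vx ivx.
rewrite (_ : (fun m => mul G _ _) = one G \o tgt G); last first.
  by apply/funext => m; exact: (gmulV gG).
rewrite -(tmap_comp v ts us) theta_unit tmap_id.
have -> : one G (proj (tmap (tgt G) v : tangent (ob G))) = one G x.
  by rewrite [proj _]tb_tmap [tb _]vx (gtgt1 gG).
have [d dx] := coord_exists (lbg_ar HL) (one G x).
have p1 : proj (theta v) = one G x by rewrite proj_theta.
have p2 : proj (theta (tmap (inv G) v)) = one G x.
  by rewrite proj_theta [proj _]tb_tmap.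
move/(congr1 d); rewrite (coordD dx) ?projB ?proj0// (coordB dx) ?proj0//.
rewrite (coord0 dx) => H; apply: (coord_inj dx); rewrite ?projN//.
by rewrite (coordN dx)//; apply/eqP; rewrite -addr_eq0 -[X in _ == X]H subr0.
Qed.

Implicit Types (p q : arV V) (w z : obV V) (g : ar G) (x : ob G).

Lemma mk_src_proj p : proj (tmap (src G) (wfst p) : tangent (ob G)) =
  proj (src L (wsnd p)).
Proof. by rewrite [LHS]tb_tmap (proj_src HL) wproj2. Qed.

Lemma mk_src1 p : wfst (src V p) = tmap (src G) (wfst p).
Proof. by rewrite wfstE//; exact: mk_src_proj. Qed.

Lemma mk_src2 p : wsnd (src V p) = src L (wsnd p).
Proof. by rewrite wsndE//; exact: mk_src_proj. Qed.

Lemma mk_proj_src p : proj (src V p) = src G (proj p).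
Proof. by rewrite -wproj1 mk_src1 [LHS]tb_tmap. Qed.

Lemma proj_shift p : proj (vadd (wsnd p) (theta (wfst p))) = proj p.
Proof. by rewrite projD ?proj_theta wproj2. Qed.

Lemma mk_tgt_proj p : proj (tmap (tgt G) (wfst p) : tangent (ob G)) =
  proj (tgt L (vadd (wsnd p) (theta (wfst p)))).
Proof. by rewrite [LHS]tb_tmap (proj_tgt HL) proj_shift. Qed.

Lemma mk_tgt1 p : wfst (tgt V p) = tmap (tgt G) (wfst p).
Proof. by rewrite wfstE//; exact: mk_tgt_proj. Qed.

Lemma mk_tgt2 p : wsnd (tgt V p) = tgt L (vadd (wsnd p) (theta (wfst p))).
Proof. by rewrite wsndE//; exact: mk_tgt_proj. Qed.

Lemma mk_proj_tgt p : proj (tgt V p) = tgt G (proj p).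
Proof. by rewrite -wproj1 mk_tgt1 [LHS]tb_tmap. Qed.

Lemma mk_one_proj w : proj (tmap (one G) (wfst w) : tangent (ar G)) =
  proj (one L (wsnd w)).
Proof. by rewrite [LHS]tb_tmap (proj_one HL) wproj2. Qed.

Lemma mk_one1 w : wfst (one V w) = tmap (one G) (wfst w).
Proof. by rewrite wfstE//; exact: mk_one_proj. Qed.

Lemma mk_one2 w : wsnd (one V w) = one L (wsnd w).
Proof. by rewrite wsndE//; exact: mk_one_proj. Qed.

Lemma mk_proj_one w : proj (one V w) = one G (proj w).
Proof. by rewrite -wproj1 mk_one1 [LHS]tb_tmap. Qed.

Lemma mk_srcK w : src V (one V w) = w.
Proof.
apply: whitney_ext; first rewrite mk_src1 mk_one1 (tmap_comp _ us ss).
  rewrite (_ : _ \o _ = id) ?tmap_id//; apply/funext => y; exact: (gsrc1 gG).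
by rewrite mk_src2 mk_one2 (gsrc1 gL).
Qed.

Lemma mk_tgtK w : tgt V (one V w) = w.
Proof.
apply: whitney_ext; first rewrite mk_tgt1 mk_one1 (tmap_comp _ us ts).
  rewrite (_ : _ \o _ = id) ?tmap_id//; apply/funext => y; exact: (gtgt1 gG).
rewrite mk_tgt2 mk_one1 mk_one2 theta_unit wproj1 -(wproj2 w) -(proj_one HL).
by rewrite vaddC ?proj0// vadd0 (gtgt1 gL).
Qed.

Lemma mk_mulE p q : mul V p q = wpair (mT (wfst p) (wfst q))
  (src_inv (mul G (proj p) (proj q)) (src L (wsnd q))).
Proof. by []. Qed.

Lemma mk_invE p : inv V p = wpair (tmap (inv G) (wfst p) : tangent (ar G))
  (src_inv (inv G (proj p)) (tgt L (vadd (wsnd p) (theta (wfst p))))).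
Proof. by []. Qed.

Lemma mk_inv_proj p : proj (tmap (inv G) (wfst p) : tangent (ar G)) =
  proj (src_inv (inv G (proj p)) (tgt L (vadd (wsnd p) (theta (wfst p)))) : arV L).
Proof.
rewrite [LHS]tb_tmap; apply/esym.
have [] // := @src_invP _ _ _ HL (inv G (proj p))
  (tgt L (vadd (wsnd p) (theta (wfst p)))).
by rewrite (proj_tgt HL) proj_shift (gsrcV gG).
Qed.

Lemma mk_inv1 p : wfst (inv V p) = tmap (inv G) (wfst p).
Proof. by rewrite mk_invE wfstE//; exact: mk_inv_proj. Qed.

Lemma mk_inv2 p : wsnd (inv V p) =
  src_inv (inv G (proj p)) (tgt L (vadd (wsnd p) (theta (wfst p)))).
Proof. by rewrite mk_invE wsndE//; exact: mk_inv_proj. Qed.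

Lemma mk_mul_one p : mul V p (one V (src V p)) = p.
Proof.
rewrite mk_mulE mk_one1 mk_one2 mk_src1 mk_src2 mT_unitr (gsrc1 gL).
by rewrite mk_proj_one mk_proj_src (gmulr1 gG) (src_invK HL) ?wproj2// wpairK.
Qed.

Lemma mk_one_mul p : mul V (one V (tgt V p)) p = p.
Proof.
rewrite mk_mulE mk_one1 mk_tgt1 mT_unitl.
by rewrite mk_proj_one mk_proj_tgt (gmul1 gG) (src_invK HL) ?wproj2// wpairK.
Qed.

Lemma mk_src0 g : src V (vzero (arV V) g) = vzero (obV V) (src G g).
Proof.
apply: whitney_ext.
  by rewrite mk_src1 !wfst0 (linear_over0 (tmap_vb ss)).
by rewrite mk_src2 !wsnd0 (src0 HL).
Qed.

Lemma mk_core0 x : core x (vzero (arV V) (one G x)).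
Proof. by split; [exact: proj0|rewrite mk_src0 (gsrc1 gG)]. Qed.

(** The component in [L] lies in the core of [L], which vanishes; this is the identification of the
    core with [A]. *)
Lemma mk_coreP p x : core x p ->
  [/\ proj (wfst p) = one G x,
      tmap (src G) (wfst p) = vzero (tangent (ob G)) x &
      wsnd p = vzero (arV L) (one G x)].
Proof.
move=> [px sp]; split=> //; first by rewrite -mk_src1 sp wfst0.
by apply: (core_zero HL); rewrite ?wproj2// -mk_src2 sp wsnd0.
Qed.

(** For [p] in the core, the zero vector over [1_x] is the unit [du (ds v)] of its tangent component
    [v]. *)
Lemma mk_core_mul p x : core x p -> mul V p (vzero (arV V) (one G x)) = p.
Proof.
move=> px; have [p1 sp p2] := mk_coreP px.
rewrite mk_mulE wsnd0 wfst0 proj0 (src0 HL).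
have -> : proj p = one G x by rewrite -wproj1.
rewrite (gmul11 gG) -(src0 HL) (src_invK HL) ?proj0// -p2 -[RHS]wpairK.
congr wpair; rewrite -[RHS]mT_unitr sp; congr (mT _ _).
by rewrite [RHS](linear_over0 (tmap_vb us)).
Qed.

(** This makes the correction invisible to the source of [T]. The inverse of a core element [(v, 0)]
    is [(di v, theta(v))]; its target has components [ds v = 0] and [t (theta(v) + theta(di v))],
    which vanishes by [theta_inv]. *)
Lemma mk_tgt_inv_core p x : core x p ->
  let q := mul V (vzero (arV V) (one G x)) (inv V p) in
  proj q = one G x /\ tgt V q = vzero (obV V) x.
Proof.
move=> px q; rewrite /q {q}; have [p1 sp p2] := mk_coreP px.
have pp : proj p = one G x by rewrite -wproj1.
have i1 := mk_inv1 p.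
have i2 : wsnd (inv V p) = theta (wfst p).
  have p3 : proj (theta (wfst p)) = one G x by rewrite proj_theta.
  rewrite mk_inv2 pp (ginv1 gG) p2 -p3 vadd0.
  by rewrite (unit_tgt HL p3) (src_invK HL).
have pi : proj (inv V p) = one G x.
  by rewrite -wproj1 i1 [LHS]tb_tmap [tb _]p1 (ginv1 gG).
have m1 : mul V (vzero (arV V) (one G x)) (inv V p) = inv V p.
  have dt0 : tmap (tgt G) (wfst (inv V p)) = vzero (tangent (ob G)) x.
    rewrite i1 (tmap_comp _ is_ ts) (_ : tgt G \o inv G = src G)//.
    by apply/funext => y; exact: (gtgtV gG).
  rewrite mk_mulE wfst0 proj0 -[RHS]wpairK; congr wpair.
    rewrite -[RHS]mT_unitl dt0; congr (mT _ _).
    by rewrite [RHS](linear_over0 (tmap_vb us)).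
  by rewrite pi (gmul11 gG) (src_invK HL) ?wproj2.
rewrite m1; split=> //; apply: whitney_ext.
  rewrite mk_tgt1 i1 (tmap_comp _ is_ ts) (_ : tgt G \o inv G = src G) ?wfst0//.
  by apply/funext => y; exact: (gtgtV gG).
rewrite mk_tgt2 i2 i1 (theta_inv p1) wsnd0 vaddC ?projN// vaddN.
by rewrite (tgt0 HL) proj_theta p1 (gtgt1 gG).
Qed.

End MoritaKernel.

(** * The natural isomorphism *)

Section NaturalIso.
Variables (R : realType) (G : gpd R) (L : vbg G).
Hypothesis HL : line_bundle_groupoid L.
Variable theta : tangent (ar G) -> arV L.
Hypotheses (theta_form : line_form theta) (theta_mult : multiplicative theta).
Variable mT : tangent (ar G) -> tangent (ar G) -> tangent (ar G).
Hypothesis HmT : tangent_multiplication mT.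

Let gG := lbg_gpd HL.
Let gL := lbg_tot_gpd HL.
Let V := morita_kernel mT theta.

Implicit Types (p q : arV V) (w z : obV V) (g : ar G) (x : ob G).

Let thp := proj_theta theta_form.
Let srcP := mk_proj_src HL (theta := theta) (mT := mT).
Let tgtP := mk_proj_tgt HL theta_form (mT := mT).
Let oneP := mk_proj_one HL (theta := theta) (mT := mT).
Let src1 := mk_src1 HL (theta := theta) (mT := mT).
Let src2 := mk_src2 HL (theta := theta) (mT := mT).
Let tgt1 := mk_tgt1 HL theta_form (mT := mT).
Let tgt2 := mk_tgt2 HL theta_form (mT := mT).
Let one1 := mk_one1 HL (theta := theta) (mT := mT).
Let one2 := mk_one2 HL (theta := theta) (mT := mT).

Lemma mk_tgtD p q : proj p = proj q ->
  tgt V (vadd p q) = vadd (tgt V p : obV V) (tgt V q).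
Proof.
move=> pq; have tpq : proj (tgt V p) = proj (tgt V q) by rewrite !tgtP pq.
have pq2 : proj (wsnd p) = proj (wsnd q) by rewrite !wproj2.
apply: whitney_ext.
  by rewrite wfstD// !tgt1 wfstD// tmapD//; exact: base_tgt_smooth HL.
rewrite wsndD// !tgt2 wfstD// wsndD// (thetaD theta_form)//.
rewrite vaddACA ?thp ?wproj1 ?wproj2//.
by rewrite (tgtD HL)// !(proj_shift theta_form).
Qed.

Lemma mk_tgtZ a p : tgt V (vscal a p) = vscal a (tgt V p : obV V).
Proof.
apply: whitney_ext.
  by rewrite wfstZ !tgt1 wfstZ tmapZ//; exact: base_tgt_smooth HL.
rewrite wsndZ !tgt2 wfstZ wsndZ (thetaZ theta_form) -vscalDr; last first.
  by rewrite thp wproj1 wproj2.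
by rewrite (tgtZ HL).
Qed.

Lemma mk_one_vb : vb_morphism (E := obV V) (E' := arV V) (one G) (one V).
Proof.
have us := base_one_smooth HL.
have [_ uLs _ _] := lbg_one HL.
have pV (w : obV V) : proj (one V w) = one G (proj w) by exact: oneP.
split=> //; last first.
  split=> [w z _ wz|a w _]; apply: whitney_ext.
  + by rewrite wfstD ?pV ?wz// !one1 wfstD// tmapD.
  + by rewrite wsndD ?pV ?wz// !one2 wsndD// (oneD HL)// !wproj2.
  + by rewrite wfstZ !one1 wfstZ tmapZ.
  + by rewrite wsndZ !one2 wsndZ (oneZ HL).
apply: lsmooth_smooth => [|w]; first exact: dclosed_gen.
apply: wpair_lsmooth => [z||]; first by rewrite [LHS]tb_tmap (proj_one HL) wproj2.
  apply: smooth_lsmooth.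
  exact: (smooth_comp (@wfst_smooth R _ (tangent (ob G)) (obV L))
    (tmap_smooth us)).
apply: smooth_lsmooth.
exact: (smooth_comp (@wsnd_smooth R _ (tangent (ob G)) (obV L)) uLs).
Qed.

Variables nabla nabla' : tangent (ob G) -> (ob G -> obV L) -> obV L.
Hypotheses (Hnabla : is_connection nabla) (Hnabla' : is_connection nabla').
Variable beta : tangent (ob G) -> R.
Hypothesis betaP : is_connection_difference nabla' nabla beta.

Let betaD (v w : tangent (ob G)) : proj v = proj w ->
  beta (vadd v w) = beta v + beta w.
Proof. exact: (connection_differenceD (lbg_ob HL) Hnabla' Hnabla betaP). Qed.

Let betaZ a (v : tangent (ob G)) : beta (vscal a v) = a * beta v.
Proof. exact: (connection_differenceZ (lbg_ob HL) Hnabla' Hnabla betaP). Qed.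

Let beta_smooth : sm (tangent (ob G)) beta.
Proof. exact: (connection_difference_smooth (lbg_ob HL) Hnabla' Hnabla betaP). Qed.

Definition pairing w z : obV L :=
  vsub (vscal (beta (wfst w)) (wsnd z)) (vscal (beta (wfst z)) (wsnd w)).

Lemma proj_pairing w z : proj w = proj z -> proj (pairing w z) = proj w.
Proof. by move=> wz; rewrite projB ?projZ !wproj2. Qed.

Lemma coord_pairing x c w z : coord_at x c -> proj w = x -> proj z = x ->
  c (pairing w z) = beta (wfst w) * c (wsnd z) - beta (wfst z) * c (wsnd w).
Proof.
by move=> cx wx zx; rewrite (coordB cx) ?projZ ?wproj2// !(coordZ cx) ?wproj2.
Qed.

Lemma pairingDr w z z' : proj w = proj z -> proj z = proj z' ->
  pairing w (vadd z z') = vadd (pairing w z) (pairing w z').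
Proof.
move=> wz zz'; have [c cx] := coord_exists (lbg_ob HL) (proj w).
have zw : proj (vadd z z') = proj w by rewrite projD.
have z'w : proj z' = proj w by rewrite wz.
have pz : proj (pairing w z) = proj w by exact: proj_pairing.
have pz' : proj (pairing w z') = proj w by exact: proj_pairing.
apply: (coord_inj cx); first exact: proj_pairing.
  by rewrite projD ?pz.
rewrite (coordD cx pz pz').
rewrite !(coord_pairing cx)// wfstD// wsndD// betaD//.
by rewrite (coordD cx) ?wproj2//; ring.
Qed.

Lemma pairingZr a w z : proj w = proj z ->
  pairing w (vscal a z) = vscal a (pairing w z).
Proof.
move=> wz; have [c cx] := coord_exists (lbg_ob HL) (proj w).
have zw : proj (vscal a z) = proj w by rewrite projZ.
have pz : proj (pairing w z) = proj w by exact: proj_pairing.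
apply: (coord_inj cx); first exact: proj_pairing.
  by rewrite projZ.
rewrite (coordZ cx _ pz).
rewrite !(coord_pairing cx)// wfstZ wsndZ betaZ.
by rewrite (coordZ cx) ?wproj2//; ring.
Qed.

Lemma pairingC w z : proj w = proj z -> pairing w z = vopp (pairing z w).
Proof.
move=> wz; have [c cx] := coord_exists (lbg_ob HL) (proj w).
have pz : proj (pairing z w) = proj w by rewrite proj_pairing.
apply: (coord_inj cx); [exact: proj_pairing|by rewrite projN|].
by rewrite (coordN cx pz) !(coord_pairing cx)//; ring.
Qed.

Lemma pairingDl w w' z : proj w = proj z -> proj w' = proj z ->
  pairing (vadd w w') z = vadd (pairing w z) (pairing w' z).
Proof.
move=> wz wz'; have ww' : proj w = proj w' by rewrite wz.
rewrite pairingC ?projD// pairingDr// (pairingC wz) (pairingC wz').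
by rewrite /vopp vscalDr// !proj_pairing.
Qed.

Lemma pairingZl a w z : proj w = proj z ->
  pairing (vscal a w) z = vscal a (pairing w z).
Proof.
move=> wz; rewrite pairingC ?projZ// pairingZr// (pairingC wz).
by rewrite /vopp !vscalA mulrC.
Qed.

Lemma pairing0r w x : proj w = x ->
  pairing w (vzero (obV V) x) = vzero (obV L) x.
Proof.
move=> wx; rewrite -[x in LHS](proj0 (obV V) x) -vscal0l pairingZr ?proj0//.
by rewrite vscal0l proj_pairing ?proj0// wx.
Qed.

(** Off the fibre over [1_x], the zero value is the one prescribed by [hjunk]. *)
Definition kappa_fun w p : arV L :=
  if pselect (proj p = one G (proj w)) is left _
  then one L (pairing w (tgt V p)) else vzero (arV L) (one G (proj w)).

Lemma kappa_funE w p : proj p = one G (proj w) ->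
  kappa_fun w p = one L (pairing w (tgt V p)).
Proof. by rewrite /kappa_fun; case: pselect. Qed.

Lemma proj_unit_tgt w p : proj p = one G (proj w) -> proj w = proj (tgt V p).
Proof. by move=> pw; rewrite tgtP pw (gtgt1 gG). Qed.

Lemma proj_kappa_fun w p : proj (kappa_fun w p) = one G (proj w).
Proof.
rewrite /kappa_fun; case: pselect => [pw|_]; last exact: proj0.
by rewrite (proj_one HL) proj_pairing//; exact: proj_unit_tgt.
Qed.

Definition kappa w : hom (@fibre R G V) (arV L).
Proof.
refine (@Hom R (ar G) (ar G) (arV V) (@fibre R G V) (arV L)
  (one G (proj w)) (kappa_fun w) _ _ _ _).
- by move=> p _; exact: proj_kappa_fun.
- move=> p q pw qw; have pq : proj p = proj q by rewrite pw qw.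
  have [pt qt] := (proj_unit_tgt pw, proj_unit_tgt qw).
  rewrite !kappa_funE// ?projD// mk_tgtD// pairingDr// -?pt//.
  by rewrite (oneD HL)// !proj_pairing.
- move=> a p pw; have pt := proj_unit_tgt pw.
  by rewrite !kappa_funE ?projZ// mk_tgtZ pairingZr// (oneZ HL).
- by move=> p pw; rewrite /kappa_fun; case: pselect.
Defined.

Lemma kappaD w z : proj w = proj z ->
  kappa (vadd w z) = vadd (kappa w : dual_ar V L) (kappa z).
Proof.
move=> wz; have wzp : proj (vadd w z) = proj w by rewrite projD.
have hwz : hb (kappa w) = hb (kappa z) by exact: (congr1 (one G) wz).
apply: hom_ext; first by rewrite hb_vadd//; exact: (congr1 (one G) wzp).
apply/funext => p; rewrite hf_vadd// /kappa /hf.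
have [pw|npw] := pselect (proj p = one G (proj w)); last first.
  rewrite /kappa_fun !wzp -wz; case: pselect => // _.
  by rewrite vadd00.
have pz : proj p = one G (proj z) by rewrite -wz.
rewrite !kappa_funE ?wzp// pairingDl; try exact: proj_unit_tgt.
by rewrite (oneD HL)// !proj_pairing//; exact: proj_unit_tgt.
Qed.

Lemma kappaZ a w : kappa (vscal a w) = vscal a (kappa w : dual_ar V L).
Proof.
have wp : proj (vscal a w) = proj w by rewrite projZ.
apply: hom_ext; first exact: (congr1 (one G) wp).
apply/funext => p; rewrite hf_vscal /kappa /hf.
have [pw|npw] := pselect (proj p = one G (proj w)); last first.
  rewrite /kappa_fun !wp; case: pselect => // _.
  by rewrite vscal0.
by rewrite !kappa_funE ?wp// pairingZl ?(oneZ HL)//; exact: proj_unit_tgt.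
Qed.

Variable D : gmaps (dual_ob V L) (dual_ar V L).
Hypothesis HD : twisted_dual D.

Lemma hb_curvature nabla0 (F0 : vbg_morphism V (dual_vbg D)) p :
  is_morita_curvature nabla0 F0 -> hb (F0 p : dual_ar V L) = proj p.
Proof.
move=> [_ bF _]; have [_ _ Fp _] := morP F0.
by have := Fp p; rewrite bF.
Qed.

Variables F F' : vbg_morphism V (dual_vbg D).
Hypotheses (HF : is_morita_curvature nabla F) (HF' : is_morita_curvature nabla' F').

Let hb_mor p := hb_curvature p HF.
Let hb_mor' p := hb_curvature p HF'.

Definition nat_iso w : dual_ar V L := vadd (F (one V w) : dual_ar V L) (kappa w).

Lemma hb_mor_one w : hb (F (one V w) : dual_ar V L) = hb (kappa w).
Proof. by rewrite hb_mor oneP. Qed.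

Lemma hb_nat_iso w : hb (nat_iso w) = one G (proj w).
Proof. by rewrite hb_vadd; [rewrite hb_mor oneP|exact: hb_mor_one]. Qed.

Lemma nat_isoE w p : proj p = one G (proj w) ->
  hf (nat_iso w) p = vadd (hf (F (one V w) : dual_ar V L) p)
    (one L (pairing w (tgt V p))).
Proof.
by move=> pw; rewrite hf_vadd; [rewrite /= kappa_funE|exact: hb_mor_one].
Qed.

Lemma nat_iso_linear : linear_over (E := obV V) (E' := dual_ar V L) setT nat_iso.
Proof.
have [_ _ _ [oD oZ]] := mk_one_vb; have [_ _ _ [FD FZ]] := morP F.
split=> [w z _ wz|a w _]; rewrite /nat_iso.
  rewrite oD// FD//; last by rewrite !oneP wz.
  have hF y : proj (F (one V y) : dual_ar V L) = one G (proj y).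
    by rewrite [LHS]hb_mor oneP.
  have hK y : proj (kappa y : dual_ar V L) = one G (proj y) by [].
  have wz1 : one G (proj w) = one G (proj z) by rewrite wz.
  by rewrite kappaD// vaddACA ?hF ?hK.
by rewrite oZ// FZ// kappaZ vscalDr//; exact: hb_mor_one.
Qed.

(** It suffices to test the generators of the structure of the Hom bundle: functions of the base
    point and matrix coefficients. [zeta] is the test section along the units, as a function of
    [w]. *)
Lemma nat_iso_smooth : @smooth R (obV V) (dual_ar V L) nat_iso.
Proof.
have [us uVs _ _] := mk_one_vb; have [_ Fs _ _] := morP F.
have ps : @smooth R (obV V) (ob G) (@proj R (ob G) (obV V)).
  exact: (@wproj_smooth R _ (tangent (ob G)) (obV L) (@tb_smooth R (ob G))).
have [_ uLs _ _] := lbg_one HL; have [_ tLs _ _] := lbg_tgt HL.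
have [_ ths _ _] := theta_form.
apply: lsmooth_smooth => [|w0]; first exact: dclosed_gen.
apply: hom_bundle_lsmooth => [|s l ss sS ls [lD lZ]].
  apply: (@lsmooth_near _ _ _ _ (one G \o @proj R (ob G) (obV V))).
    by apply: nbhW (nbhT _ _) => w _; exact: hb_nat_iso.
  by apply: smooth_lsmooth; exact: smooth_comp ps us.
pose zeta w := s (one G (proj w)).
have zetas : smooth (zeta : obV V -> arV V).
  exact: smooth_comp (smooth_comp ps us) ss.
have pz w : proj (zeta w) = one G (proj w) by exact: (sS (one G (proj w))).
pose k (p : dual_ar V L) := l (p (s (hb p))).
have ks : sm (dual_ar V L) k.
  by move=> p; apply: lsm_in; right; exists s, l.
pose m (e : obV L) := l (one L e).
have ms : sm (obV L) m by exact: uLs.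
have w1s : smooth (fun w => wfst w : tangent (ob G)) by exact: wfst_smooth.
have z1s : smooth (fun w => wfst (zeta w) : tangent (ar G)).
  exact: smooth_comp zetas (@wfst_smooth R _ _ _).
have z2s : smooth (fun w => wsnd (zeta w) : arV L).
  exact: smooth_comp zetas (@wsnd_smooth R _ _ _).
have t1s : smooth (fun w => tmap (tgt G) (wfst (zeta w)) : tangent (ob G)).
  apply: smooth_comp z1s (tmap_smooth _); exact: base_tgt_smooth HL.
(* The pairing is expanded with the fibrewise linearity of [l], of the units and of the target,
   which leaves sums and products of functions smooth in [w]. *)
apply: (@eq_lsm _ _ _ _ (fun w => k (F (one V w)) +
   (beta (wfst w) * (m (tgt L (wsnd (zeta w))) +
                     m (tgt L (theta (wfst (zeta w))))) -
    beta (tmap (tgt G) (wfst (zeta w))) * m (wsnd w)))) => [w|].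
  rewrite hb_nat_iso -/(zeta w) nat_isoE//.
  have pw := proj_unit_tgt (pz w).
  rewrite lD; last first.
    by rewrite hom_proj hb_mor oneP (proj_one HL) proj_pairing.
  rewrite /k hb_mor oneP; congr (_ + _).
  rewrite /pairing /vsub (oneD HL); last first.
    by rewrite projN !projZ !wproj2.
  rewrite /vopp !(oneZ HL) lD; last first.
    by rewrite !projZ !(proj_one HL) !wproj2 pw.
  rewrite !lZ tgt1 tgt2 (tgtD HL); last by rewrite thp wproj1 wproj2.
  rewrite (oneD HL); last by rewrite !(proj_tgt HL) thp wproj1 wproj2.
  rewrite lD; last by rewrite !(proj_one HL) !(proj_tgt HL) thp wproj1 wproj2.
  by rewrite mulN1r.
have kFs : sm (obV V) (fun w => k (F (one V w))) by exact: (uVs _ (Fs _ ks)).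
have mz2s : sm (obV V) (fun w => m (tgt L (wsnd (zeta w)))).
  exact: (z2s _ (tLs _ ms)).
have mths : sm (obV V) (fun w => m (tgt L (theta (wfst (zeta w))))).
  exact: (z1s _ (ths _ (tLs _ ms))).
have mw2s : sm (obV V) (fun w => m (wsnd w)).
  exact: (@wsnd_smooth R _ (tangent (ob G)) (obV L) _ ms).
have bws : sm (obV V) (fun w => beta (wfst w)) by exact: (w1s _ beta_smooth).
have bts : sm (obV V) (fun w => beta (tmap (tgt G) (wfst (zeta w)))).
  exact: (t1s _ beta_smooth).
apply: lsmD; first exact: lsm_in.
apply: lsmB; last by apply: lsmM; exact: lsm_in.
by apply: lsmM; [exact: lsm_in|apply: lsmD; exact: lsm_in].
Qed.

(** [t^(-1) K(t p, t q)], written without inverting [t], so that it can be expanded in the fibre of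
    [L]. *)
Definition tgt_part p q : arV L :=
  vsub (vscal (beta (wfst (tgt V p))) (vadd (wsnd q) (theta (wfst q))))
       (vscal (beta (wfst (tgt V q))) (vadd (wsnd p) (theta (wfst p)))).

(** [s^(-1) K(s p, s q)], likewise. *)
Definition src_part p q : arV L :=
  vsub (vscal (beta (wfst (src V p))) (wsnd q))
       (vscal (beta (wfst (src V q))) (wsnd p)).

Lemma proj_tgt_part p q : proj p = proj q -> proj (tgt_part p q) = proj p.
Proof. by move=> pq; rewrite projB ?projZ !(proj_shift theta_form). Qed.

Lemma proj_src_part p q : proj p = proj q -> proj (src_part p q) = proj p.
Proof. by move=> pq; rewrite projB ?projZ !wproj2. Qed.

Lemma tgt_tgt_part p q : proj p = proj q ->
  tgt L (tgt_part p q) = pairing (tgt V p) (tgt V q).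
Proof.
move=> pq; rewrite /tgt_part /vsub (tgtD HL); last first.
  by rewrite projN !projZ !(proj_shift theta_form).
by rewrite /vopp !(tgtZ HL) /pairing !tgt2.
Qed.

Lemma src_src_part p q : proj p = proj q ->
  src L (src_part p q) = pairing (src V p) (src V q).
Proof.
move=> pq; rewrite /src_part /vsub (srcD HL); last first.
  by rewrite projN !projZ !wproj2.
by rewrite /vopp !(srcZ HL) /pairing !src2.
Qed.

(** The change of [eta] yields the terms in the components along [L]; the change of the exterior
    derivative yields [beta(dt v) theta(w) - beta(dt w) theta(v)], which the shift by [theta] in
    [tgt_part] matches. *)
Lemma mor_difference p q : proj p = proj q ->
  vadd (hf (F' p : dual_ar V L) q) (src_part p q) =
  vadd (hf (F p : dual_ar V L) q) (tgt_part p q).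
Proof.
move=> pq.
have [_ _ [Ds [Dt [eta [omega [DsP DtP etaP omP FE]]]]]] := HF.
have [_ _ [Ds' [Dt' [eta' [omega' [DsP' DtP' etaP' omP' FE']]]]]] := HF'.
have bs := pullback_difference (lbg_ar HL) (lbg_ob HL) (lbg_src HL)
  (src_surj HL) DsP DsP' betaP.
have bt := pullback_difference (lbg_ar HL) (lbg_ob HL) (lbg_tgt HL)
  (tgt_surj HL) DtP DtP' betaP.
have [[DsC _] [DtC _] [DsC' _] [DtC' _]] := And4 DsP DtP DsP' DtP'.
have pq1 : proj (wfst p) = proj (wfst q) by [].
rewrite FE// FE'//.
rewrite (ext_derivative_difference (lbg_ar HL) bt DtC DtC' theta_form omP omP' pq1).
have [op _ _ _] := omP.
have oP : proj (omega (wfst p) (wfst q)) = proj p by exact: op.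
move: (omega _ _) oP => om oP.
set g := proj p in oP pq *.
have [c cg] := coord_exists (lbg_ar HL) g.
(* [eta' - eta = s^*beta - t^*beta]: all four differences of connections are evaluated on one
   section that does not vanish at [g]. *)
have eta'E (v : tangent (ar G)) : proj v = g ->
    eta' v = eta v + beta (tmap (src G) v) - beta (tmap (tgt G) v).
  move=> vg; have [e eg ce] : exists2 e, proj e = g & c e = 1 by case: cg.
  have [s sS] := section_through (lbg_ar HL) e; rewrite eg => sg.
  have dE D1 D2 e1 : is_connection D1 -> is_connection D2 ->
      is_connection_difference D1 D2 e1 -> c (D1 v s) - c (D2 v s) = e1 v.
    move=> C1 C2 eP.
    rewrite -(coordB cg) ?(connection_proj v C1) ?(connection_proj v C2)//.
    by rewrite eP// vg sg (coordZ cg)// ce mulr1.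
  rewrite -(dE _ _ _ DsC' DtC' etaP') -(dE _ _ _ DsC DtC etaP).
  by rewrite -(dE _ _ _ DsC' DsC bs) -(dE _ _ _ DtC' DtC bt); ring.
have p2 : proj (wsnd p) = g by rewrite wproj2.
have q2 : proj (wsnd q) = g by rewrite wproj2 -pq.
have tp : proj (theta (wfst p)) = g by rewrite thp.
have tq : proj (theta (wfst q)) = g by rewrite thp; exact: (esym pq).
have q1 : proj (wfst q) = g by exact: (esym pq).
rewrite (eta'E (wfst p))// (eta'E (wfst q))//.
rewrite /src_part /tgt_part !tgt1 !src1.
(* From here on only vectors of the fibre over [g] and real coefficients matter; abstracting them
   leaves a ring identity in the coordinate [c]. *)
move: (wsnd p) p2 (wsnd q) q2 (theta _) tp (theta _) tq.
move: (eta _) (eta _) (beta _) (beta _) (beta _) (beta _).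
clear -cg oP => hq hp dq tq dp tp lp lpg lq lqg thp thpg thq thqg.
have pD (e f : arV L) : proj e = g -> proj f = g -> proj (vadd e f) = g.
  by move=> eg fg; rewrite projD ?eg ?fg.
have pZ b (e : arV L) : proj e = g -> proj (vscal b e) = g by rewrite projZ.
have pB (e f : arV L) : proj e = g -> proj f = g -> proj (vsub e f) = g.
  by move=> eg fg; rewrite projB ?eg ?fg.
apply: (coord_inj cg);
  [| |rewrite !(coordB cg, coordD cg, coordZ cg); [ring|..]].
all: by repeat first [assumption | apply pB | apply pD | apply pZ].
Qed.

Lemma core_hom_ext (h h' : dual_ob V L) : hb h = hb h' ->
  (forall p, core (hb h) p -> hf h p = hf h' p) -> h = h'.
Proof.
move=> hh' E; apply: hom_ext => //; apply/funext => p.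
have [cp|ncp] := pselect (core (hb h) p); first exact: E.
by rewrite !hjunk -?hh'.
Qed.

Lemma fibre_hom_ext (h h' : dual_ar V L) : hb h = hb h' ->
  (forall p, proj p = hb h -> hf h p = hf h' p) -> h = h'.
Proof.
move=> hh' E; apply: hom_ext => //; apply/funext => p.
have [cp|ncp] := pselect (fibre (hb h) p); first exact: E.
by rewrite !hjunk -?hh'.
Qed.

Let gD : is_groupoid D. Proof. by case: HD. Qed.

Lemma dual_one_src (h : dual_ob V L) : src D (one D h) = h.
Proof. exact: gsrc1 gD h. Qed.

(** [MR(w)] is the source of its unit [MR(1_w)]. On a core element the correction is [K(w, 0)] by
    [mk_tgt_inv_core]. *)
Lemma src_nat_iso w : src D (nat_iso w) = mor_ob F w.
Proof.
rewrite -[RHS]dual_one_src -[one D _]/(one (dual_vbg D) _) -mor_one.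
have [_ srcE _ _ _] := HD.
have [h1 c1] := srcE (nat_iso w); have [h2 c2] := srcE (F (one V w)).
rewrite hb_nat_iso in h1 c1; rewrite (hb_mor (one V w)) oneP in h2 c2.
apply: core_hom_ext; first by rewrite h1.
move=> p; rewrite h1 => cp; rewrite c1// c2//; congr vopp; congr (src L _).
rewrite (gsrc1 gG) in cp.
have [pq t0] := mk_tgt_inv_core HL theta_form theta_mult HmT cp.
move: (mul V _ _) pq t0 => q pq t0.
rewrite nat_isoE// t0 pairing0r// (one0 HL).
have [c cx] := coord_exists (lbg_ar HL) (one G (proj w)).
have pF : proj (hf (F (one V w) : dual_ar V L) q) = one G (proj w).
  by rewrite hom_proj hb_mor oneP.
apply: (coord_inj cx); rewrite ?projD ?pF ?proj0//.
by rewrite (coordD cx) ?proj0// (coord0 cx) addr0.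
Qed.

(** [MR'(w)] is the target of [MR'(1_w)]. On a core element [p], [mor_difference] at [1_w] has no
    source part because [s p = 0], and its target part is exactly the correction [1_(K(w, t p))]. *)
Lemma tgt_nat_iso w : tgt D (nat_iso w) = mor_ob F' w.
Proof.
rewrite -[RHS](gtgt1 gD) -[one D _]/(one (dual_vbg D) _) -mor_one.
have [_ _ tgtE _ _] := HD.
have [h1 c1] := tgtE (nat_iso w); have [h2 c2] := tgtE (F' (one V w)).
rewrite hb_nat_iso in h1 c1; rewrite (hb_mor' (one V w)) oneP in h2 c2.
apply: core_hom_ext; first by rewrite h1.
move=> p; rewrite h1 => cp; rewrite c1// c2//; congr (tgt L _).
rewrite (gtgt1 gG) in cp.
rewrite (mk_core_mul HL HmT cp).
have [pw sp] := cp.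
have pw1 : proj (one V w) = proj p by rewrite oneP pw.
rewrite nat_isoE//.
have [c cx] := coord_exists (lbg_ar HL) (one G (proj w)).
have pF : proj (hf (F (one V w) : dual_ar V L) p) = one G (proj w).
  by rewrite hom_proj hb_mor oneP.
have pF' : proj (hf (F' (one V w) : dual_ar V L) p) = one G (proj w).
  by rewrite hom_proj hb_mor' oneP.
have tE : tgt_part (one V w) p = one L (pairing w (tgt V p)).
  have pA : proj (tgt_part (one V w) p) = one G (proj w).
    by rewrite proj_tgt_part// oneP.
  rewrite (unit_arrow HL pA) -(unit_tgt HL pA).
  by rewrite tgt_tgt_part// (mk_tgtK HL theta_form theta_mult).
have sE : src_part (one V w) p = vzero (arV L) (one G (proj w)).
  apply: (core_zero HL); first by rewrite proj_src_part// oneP.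
  by rewrite src_src_part// sp pairing0r// (mk_srcK HL).
rewrite -tE -mor_difference// sE.
apply: (coord_inj cx); rewrite ?projD ?pF' ?proj0//.
by rewrite (coordD cx) ?proj0// (coord0 cx) addr0.
Qed.

(** [MR(1_w)] is a unit of the dual, that is, a map precomposed with the projection to the core; it
    therefore vanishes on units, which have zero core component. *)
Lemma mor_one_one w z : proj w = proj z ->
  hf (F (one V w) : dual_ar V L) (one V z) = vzero (arV L) (one G (proj w)).
Proof.
move=> wz; have [_ _ _ _ oneE] := HD.
rewrite mor_one; have [h1 c1] := oneE (mor_ob F w).
have hw : hb (mor_ob F w : dual_ob V L) = proj w.
  by rewrite -src_nat_iso; have [_ srcE _ _ _] := HD;
    have [-> _] := srcE (nat_iso w); rewrite hb_nat_iso (gsrc1 gG).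
have c0 : core (hb (mor_ob F w : dual_ob V L)) (vzero (arV V) (one G (proj w))).
  by rewrite hw; exact: (mk_core0 HL).
have := c1 _ z c0; rewrite hw => /(_ (esym wz)).
have p1 : proj (one V z) = one G (proj w) by rewrite oneP wz.
rewrite -{1}p1 vadd0 => ->.
by rewrite hom0// hw (one0 HL).
Qed.

Lemma nat_iso_one w z : proj w = proj z ->
  hf (nat_iso w) (one V z) = one L (pairing w z).
Proof.
move=> wz; have p1 : proj (one V z) = one G (proj w) by rewrite oneP wz.
rewrite nat_isoE// mor_one_one// (mk_tgtK HL theta_form theta_mult).
by rewrite -(proj_pairing wz) -(proj_one HL) vadd0.
Qed.

(** After evaluation at [q] and passage to sources, the two sides are [s (MR'(p)(q)) + K(s p, s q)]
    and [g^(-1) . K(t p, t q) + s (MR(p)(q))], so the claim is the image of [mor_difference] under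
    [s]. *)
Lemma nat_iso_natural p :
  mul D (F' p) (nat_iso (src V p)) = mul D (nat_iso (tgt V p)) (F p).
Proof.
have [_ _ _ mulE _] := HD.
have c1 : src D (F' p) = tgt D (nat_iso (src V p)).
  by rewrite tgt_nat_iso; exact: (mor_src F' p).
have c2 : src D (nat_iso (tgt V p)) = tgt D (F p).
  by rewrite src_nat_iso; apply/esym; exact: (mor_tgt F p).
have [h1 e1] := mulE _ _ c1; have [h2 e2] := mulE _ _ c2.
rewrite hb_nat_iso (hb_mor' p) srcP (gmulr1 gG) in h1 e1.
rewrite hb_nat_iso (hb_mor p) tgtP (gmul1 gG) in h2 e2.
apply: fibre_hom_ext; first by rewrite h1 h2.
move=> q; rewrite h1 => qp; have pq := esym qp.
have psq : proj (src V p) = proj (src V q) by rewrite !srcP pq.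
have ptq : proj (tgt V p) = proj (tgt V q) by rewrite !tgtP pq.
(* [q] is written as [q 1_(s q)] on the left and as [1_(t q) q] on the right, to match the factors
   of the two products. *)
rewrite -[in LHS](mk_mul_one HL HmT q) e1 ?oneP ?srcP ?qp//; last first.
  by rewrite (mk_tgtK HL theta_form theta_mult).
rewrite -[in RHS](mk_one_mul HL theta_form HmT q) e2 ?oneP ?tgtP ?qp//; last first.
  by rewrite (mk_srcK HL).
rewrite !nat_iso_one// !(gsrc1 gL).
have pF : proj (hf (F p : dual_ar V L) q) = proj p by rewrite hom_proj hb_mor.
have pF' : proj (hf (F' p : dual_ar V L) q) = proj p by rewrite hom_proj hb_mor'.
rewrite (act1 HL); last by rewrite (proj_src HL) pF'.
(* The action of [g^(-1)] is what turns the target pairing into the source of an element over [g],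
   comparable with the left-hand side. *)
have aE : act (inv G (proj p)) (tgt L (tgt_part p q)) = src L (tgt_part p q).
  by rewrite -{1}(proj_tgt_part pq) (act_inv_tgt HL).
rewrite -src_src_part// -tgt_tgt_part// aE.
have := mor_difference pq; have := proj_tgt_part pq; have := proj_src_part pq.
move: (src_part p q) (tgt_part p q) => B A pB pA FAB.
rewrite -!(srcD HL) ?pA ?pB// !(src_invK HL) ?projD ?pA ?pB//.
by rewrite FAB vaddC// pF pA.
Qed.

Lemma nat_iso_linear_natural_iso : linear_natural_iso F F' (one G) nat_iso.
Proof.
split.
- split; [exact: base_one_smooth HL|exact: nat_iso_smooth| |exact: nat_iso_linear].
  by move=> w; exact: hb_nat_iso.
- by move=> w; split; [exact: src_nat_iso|exact: tgt_nat_iso].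
- exact: nat_iso_natural.
Qed.

End NaturalIso.

Theorem proposition5p17 (R : realType) (G : gpd R) (L : vbg G)
    (HL : line_bundle_groupoid L)
    (theta : tangent (ar G) -> arV L)
    (theta_form : line_form theta) (theta_mult : multiplicative theta)
    (mT : tangent (ar G) -> tangent (ar G) -> tangent (ar G))
    (HmT : tangent_multiplication mT)
    (D : gmaps (dual_ob (morita_kernel mT theta) L)
               (dual_ar (morita_kernel mT theta) L))
    (HD : twisted_dual D)
    (nabla nabla' : tangent (ob G) -> (ob G -> obV L) -> obV L)
    (Hnabla : is_connection nabla) (Hnabla' : is_connection nabla')
    (MR MR' : vbg_morphism (morita_kernel mT theta) (dual_vbg D))
    (HMR : is_morita_curvature nabla MR)
    (HMR' : is_morita_curvature nabla' MR') :
  exists (tau : ob G -> ar G)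
         (T : obV (morita_kernel mT theta) -> arV (dual_vbg D)),
    linear_natural_iso MR MR' tau T.
Proof.
have [beta betaP] := connection_difference (lbg_ob HL) Hnabla' Hnabla.
exists (one G), (nat_iso HL theta_form Hnabla Hnabla' betaP MR).
exact: nat_iso_linear_natural_iso.
Qed.
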